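(* Let $\nu\in\mathbb R$ with $|\nu|\neq1$. Let $s,s'\in\mathbb R$ be such that $s\ge0$, $s'\le 2s-\frac12$ and $s'<s+\frac12$. Then for all $b,c'\in\mathbb R$ such that $$\max\left\{\tfrac12,\ \tfrac{s'-s}2+\tfrac12\right\}<b\qquad\text{and}\qquad c'<\min\left\{\tfrac34-\tfrac{s'-s}2,\ \tfrac34\right\},$$ there is a constant $C>0$ (depending only on $\nu,s,s',b,c'$) such that $$\|\partial_x(u_1\overline{u_2})\|_{Y^{s',c'-1}}\le C\,\|u_1\|_{X^{s,b}}\|u_2\|_{X^{s,b}}\qquad\text{for all }u_1,u_2\in X^{s,b}.$$
   Context: Write $\langle\cdot\rangle=\sqrt{1+|\cdot|^2}$ and let $\widehat f(\tau,\xi)=\iint e^{-2\pi i(t\tau+x\xi)}f(t,x)\,dt\,dx$ be the space-time Fourier transform of complex-valued functions on $\mathbb R^2$ (variables $(t,x)$). For $s,b,s',a\in\mathbb R$, the Bourgain spaces $X^{s,b}$ and $Y^{s',a}=Y^{s',a}_\nu$ are the completions of the Schwartz class $\mathcal S(\mathbb R^2)$ under the norms $$\|f\|_{X^{s,b}}=\|\langle\xi\rangle^s\langle\tau+\xi^2\rangle^b\widehat f(\tau,\xi)\|_{L^2_{\tau,\xi}},\qquad \|g\|_{Y^{s',a}}=\|\langle\xi\rangle^{s'}\langle\tau+\nu|\xi|\xi\rangle^{a}\widehat g(\tau,\xi)\|_{L^2_{\tau,\xi}} .$$ *)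

(* Defs.v *)
From mathcomp Require Import all_boot all_order all_algebra.
From mathcomp Require Import all_classical all_reals all_analysis.
From mathcomp Require Import complex.

Set Implicit Arguments.
Unset Strict Implicit.
Unset Printing Implicit Defensive.

Import Order.TTheory GRing.Theory Num.Theory numFieldNormedType.Exports.

Local Open Scope classical_set_scope.
Local Open Scope complex_scope.
Local Open Scope ring_scope.

(* Points of the plane are pairs z = (z.1, z.2), read as (t, x) in physical
   space and as (tau, xi) in frequency space.  R * R carries the product
   measure of the one-dimensional Lebesgue measures. *)
Definition lebesgue2 (R : realType) :
    {measure set (measurableTypeR R * measurableTypeR R) -> \bar R} :=
  (@lebesgue_measure R \x @lebesgue_measure R)%E.
Arguments lebesgue2 : clear implicits.

(* The Japanese bracket <y>. *)
Definition jap (R : realType) (y : R) : R := Num.sqrt (1 + `|y| ^+ 2).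

(* R[i] has no normed R-module structure in the library, so derivatives and
   integrals of complex-valued functions are taken on real and imaginary
   parts. *)
Definition re_part (R : realType) (f : R * R -> R[i]) (z : R * R) : R :=
  complex.Re (f z).
Definition im_part (R : realType) (f : R * R -> R[i]) (z : R * R) : R :=
  complex.Im (f z).

Definition dir_t (R : realType) : R * R := (1, 0).
Definition dir_x (R : realType) : R * R := (0, 1).

(* Iterated partial derivative along a word of directions
   (false for t, true for x). *)
Definition iter_partial (R : realType) (w : seq bool) (g : R * R -> R) :
    R * R -> R :=
  foldr (fun (b : bool) (h : R * R -> R) =>
    'D_(if b then dir_x R else dir_t R) h) g w.

Definition real_schwartz (R : realType) (g : R * R -> R) : Prop :=
  forall w : seq bool,
    (forall z : R * R, differentiable (iter_partial w g) z) /\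
    (forall k : nat, exists M : R, forall z : R * R,
      (1 + `|z|) ^+ k * `|iter_partial w g z| <= M).

Definition schwartz (R : realType) (f : R * R -> R[i]) : Prop :=
  real_schwartz (re_part f) /\ real_schwartz (im_part f).

Definition partial_x (R : realType) (f : R * R -> R[i]) (z : R * R) : R[i] :=
  Complex ('D_(dir_x R) (re_part f) z) ('D_(dir_x R) (im_part f) z).

Definition cintegral (R : realType) (f : R * R -> R[i]) : R[i] :=
  Complex (\int[lebesgue2 R]_z re_part f z) (\int[lebesgue2 R]_z im_part f z).

Definition cis (R : realType) (y : R) : R[i] := Complex (cos y) (sin y).

Definition fourier (R : realType) (f : R * R -> R[i]) (z : R * R) : R[i] :=
  cintegral (fun y => cis (- (2 * pi * (y.1 * z.1 + y.2 * z.2))) * f y).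

Definition fourier_norm (R : realType) (weight : R * R -> R)
    (f : R * R -> R[i]) : \bar R :=
  Lnorm (lebesgue2 R) 2%:E (fun z => (weight z * ComplexField.Normc.normc (fourier f z))%:E).

Definition X_norm (R : realType) (s b : R) : (R * R -> R[i]) -> \bar R :=
  fourier_norm (fun z => jap z.2 `^ s * jap (z.1 + z.2 ^+ 2) `^ b).

Definition Y_norm (R : realType) (nu s' a : R) : (R * R -> R[i]) -> \bar R :=
  fourier_norm
    (fun z => jap z.2 `^ s' * jap (z.1 + nu * `|z.2| * z.2) `^ a).

(* Completion of the Schwartz class under a norm N: an element is given by an
   N-Cauchy sequence of Schwartz functions (two sequences whose difference
   tends to 0 in N give the same element), and its norm is the limit of the
   norms. *)
Definition completion (R : realType) (N : (R * R -> R[i]) -> \bar R) :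
    set (nat -> R * R -> R[i]) :=
  [set u | (forall n, schwartz (u n)) /\
    forall e : R, 0 < e -> exists n0 : nat, forall m n : nat,
      (n0 <= m)%N -> (n0 <= n)%N ->
      (N (fun z => (u m z - u n z)%R) < e%:E)%E].

Definition completion_norm (R : realType) (N : (R * R -> R[i]) -> \bar R)
    (u : nat -> R * R -> R[i]) : \bar R :=
  limn (fun n => N (u n)).

Definition X_space (R : realType) (s b : R) := completion (X_norm s b).
Definition Y_space (R : realType) (nu s' a : R) := completion (Y_norm nu s' a).

Definition dx_mul_conj (R : realType) (f g : R * R -> R[i]) : R * R -> R[i] :=
  partial_x (fun z => f z * conjc (g z)).

(* The extension of dx_mul_conj to completions, computed on representatives.
   The operation is additive in each argument, so when it is bounded and maps
   Cauchy sequences to Cauchy sequences, changing u or v by a null sequence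
   changes the result by a null sequence. *)
Definition completion_dx_mul_conj (R : realType)
    (u v : nat -> R * R -> R[i]) : nat -> R * R -> R[i] :=
  fun n => dx_mul_conj (u n) (v n).

(* Main.v *)
(* The Fourier transform of u1 * conj(u2) at zeta is bounded by a constant times
   the integral over w of |u1^(w)| |u2^(w - zeta)|.  This follows without
   Plancherel: mollifying by a Fejer kernel, which has nonzero mass, gives an
   approximate inversion formula for u1.  By Cauchy-Schwarz and Tonelli, the
   estimate on Schwartz functions reduces to a uniform bound, in (tau, xi), of
   the integral of the squared kernel
     xi^2 <xi>^(2s') <sigma>^(-2a) <xi1>^(-2s) <xi2>^(-2s)
       <tau1 + xi1^2>^(-2b) <tau1 - tau + xi2^2>^(-2b),
   where a = 1 - c', xi2 = xi1 - xi and sigma = tau + nu |xi| xi.  Integrating in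
   tau1 replaces the last two factors by <D>^(-2b) with D = tau + xi1^2 - xi2^2.
   If |xi| <= 1, or if <xi1> and <xi2> both dominate <xi>, then D is affine in xi1
   with slope 2 xi, and |xi| <D>^(-2b) has bounded integral.  Otherwise xi1 or xi2
   is much smaller than xi, and sigma - D = xi (nu |xi| + xi - 2 xi1) is of size
   xi^2 since |nu| <> 1; so either <sigma> or <D> is at least of order <xi>^2. *)

From HB Require Import structures.
Require Import Defs.
From mathcomp Require Import all_boot all_order all_algebra.
From mathcomp Require Import all_classical all_reals all_analysis.
From mathcomp Require Import measurable_realfun complex ring lra.

Set Implicit Arguments.
Unset Strict Implicit.
Unset Printing Implicit Defensive.

Import Order.TTheory GRing.Theory Num.Theory numFieldNormedType.Exports.

Local Open Scope classical_set_scope.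
Local Open Scope ring_scope.

Local Notation normc := ComplexField.Normc.normc.
Local Notation Re := complex.Re.
Local Notation Im := complex.Im.

(** * Complex-valued integrals *)

(** After squaring, the derivative contributes two powers of |xi|, and they are spent differently in
    each regime. When D serves as the variable of integration in xi1, one power is the Jacobian and
    only the other is charged to <xi>. The weights must then beat <xi>^(1+2s'): by <xi1>^(-2s)
    <xi2>^(-2s) if both inputs dominate, which is s' <= 2s - 1/2, and by <sigma>^(-2a) with one
    input weight if sigma is large, which is c' <= 3/4 - (s'-s)/2. When <D> is at least of order
    <xi>^2 it is bounded pointwise and cannot also be integrated. Both powers are then charged to
    <xi>, <D>^(-2b) has to beat them, which is b >= (s'-s)/2 + 1/2, and integrability in xi1 comes
    from a surplus <xi1>^(1-4b) or <xi2>^(1-4b) in the small frequency. Integration in tau1 works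
    because D, the difference of the two input modulations, does not contain tau1. The completions
    require finite norms on Schwartz functions, hence decay of the transform in both variables;
    difference quotients give it without integration by parts. *)

Section complex_facts.
Context {R : realType}.
Implicit Types (x y : R[i]) (t : R).

Lemma Re_addc x y : Re (x + y) = Re x + Re y. Proof. by case: x; case: y. Qed.
Lemma Im_addc x y : Im (x + y) = Im x + Im y. Proof. by case: x; case: y. Qed.
Lemma Re_oppc x : Re (- x) = - Re x. Proof. by case: x. Qed.
Lemma Im_oppc x : Im (- x) = - Im x. Proof. by case: x. Qed.
Lemma Re_mulc x y : Re (x * y) = Re x * Re y - Im x * Im y.
Proof. by case: x; case: y. Qed.
Lemma Im_mulc x y : Im (x * y) = Re x * Im y + Im x * Re y.
Proof. by case: x; case: y. Qed.
Lemma Re_conjc x : Re (conjc x) = Re x. Proof. by case: x. Qed.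
Lemma Im_conjc x : Im (conjc x) = - Im x. Proof. by case: x. Qed.

Lemma normcE_sqrt x : normc x = Num.sqrt (Re x ^+ 2 + Im x ^+ 2).
Proof. by case: x. Qed.

Lemma normc_ge0 x : 0 <= normc x.
Proof. by rewrite normcE_sqrt sqrtr_ge0. Qed.

Lemma sqr_normcE x : normc x ^+ 2 = Re x ^+ 2 + Im x ^+ 2.
Proof. by rewrite normcE_sqrt sqr_sqrtr// addr_ge0// sqr_ge0. Qed.

Lemma normc_conj x : normc (conjc x) = normc x.
Proof. by rewrite !normcE_sqrt Re_conjc Im_conjc sqrrN. Qed.

Lemma normr_Re_le x : `|Re x| <= normc x.
Proof.
by rewrite -(@ler_pXn2r _ 2)// ?nnegrE ?normc_ge0// sqr_normcE real_normK ?num_real// lerDl sqr_ge0.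
Qed.

Lemma normr_Im_le x : `|Im x| <= normc x.
Proof.
by rewrite -(@ler_pXn2r _ 2)// ?nnegrE ?normc_ge0// sqr_normcE real_normK ?num_real// lerDr sqr_ge0.
Qed.

Lemma normc_le_Re_Im x : normc x <= `|Re x| + `|Im x|.
Proof.
rewrite -(@ler_pXn2r _ 2)// ?nnegrE ?normc_ge0// ?addr_ge0// sqr_normcE.
rewrite sqrrD !real_normK ?num_real// -addrA lerD2l lerDr.
by rewrite mulrn_wge0// mulr_ge0.
Qed.

Lemma normc_real t : normc (Complex t 0) = `|t|.
Proof. by rewrite normcE_sqrt/= expr0n addr0 sqrtr_sqr. Qed.

Lemma normc_cis t : normc (cis t) = 1.
Proof. by rewrite normcE_sqrt/= cos2Dsin2 sqrtr1. Qed.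

Lemma cisD t u : cis (t + u) = cis t * cis u.
Proof.
apply/eqP; rewrite eq_complex/= cosD sinD.
by apply/andP; split; apply/eqP; ring.
Qed.

Lemma conjc_cis t : conjc (cis t) = cis (- t).
Proof. by rewrite /cis cosN sinN. Qed.

Lemma conjcM x y : conjc (x * y) = conjc x * conjc y.
Proof. exact: rmorphM. Qed.

End complex_facts.

Definition cmeas d (T : measurableType d) (R : realType) (f : T -> R[i]) :=
  measurable_fun setT (fun x => Re (f x)) /\
  measurable_fun setT (fun x => Im (f x)).

Section cmeas.
Context d (T : measurableType d) (R : realType).
Implicit Types f g : T -> R[i].

Lemma cmeasM f g : cmeas f -> cmeas g -> cmeas (fun x => f x * g x).
Proof.
move=> [f1 f2] [g1 g2]; split.
  under [X in measurable_fun _ X]eq_fun do rewrite Re_mulc.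
  by apply: measurable_funB; exact: measurable_funM.
under [X in measurable_fun _ X]eq_fun do rewrite Im_mulc.
by apply: measurable_funD; exact: measurable_funM.
Qed.

Lemma cmeas_conj f : cmeas f -> cmeas (fun x => conjc (f x)).
Proof.
move=> [f1 f2]; split.
  by under [X in measurable_fun _ X]eq_fun do rewrite Re_conjc.
under [X in measurable_fun _ X]eq_fun do rewrite Im_conjc.
exact: measurable_funN.
Qed.

Lemma cmeas_cst (c : R[i]) : cmeas (fun _ : T => c).
Proof. by split; exact: measurable_cst. Qed.

Lemma cmeas_real (f : T -> R) : measurable_fun setT f ->
  cmeas (fun x => Complex (f x) 0).
Proof. by move=> mf; split => //=. Qed.

Lemma cmeas_cis (f : T -> R) : measurable_fun setT f ->
  cmeas (fun x => cis (f x)).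
Proof.
move=> mf; split => /=.
  apply: (measurableT_comp _ mf).
  by apply: continuous_measurable_fun; exact: continuous_cos.
apply: (measurableT_comp _ mf).
by apply: continuous_measurable_fun; exact: continuous_sin.
Qed.

Lemma measurable_normc f : cmeas f -> measurable_fun setT (fun x => normc (f x)).
Proof.
move=> [f1 f2].
under [X in measurable_fun _ X]eq_fun do rewrite normcE_sqrt.
apply: (@measurableT_comp _ _ _ _ _ _ (@Num.sqrt R)).
  by apply: continuous_measurable_fun; exact: sqrt_continuous.
by apply: measurable_funD; exact: measurable_funX.
Qed.

End cmeas.

Lemma cmeas_comp d d' (T : measurableType d) (S : measurableType d')
    (R : realType) (f : S -> R[i]) (h : T -> S) :
  cmeas f -> measurable_fun setT h -> cmeas (fun x => f (h x)).
Proof.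
by move=> [f1 f2] mh; split; [exact: (measurableT_comp f1)|exact: (measurableT_comp f2)].
Qed.

Section cint.
Context d (T : measurableType d) (R : realType).
Variable mu : {measure set T -> \bar R}.
Implicit Types (f g : T -> R[i]) (h k : T -> R).

(** Over [lebesgue2] this unfolds to [cintegral], so [fourierE] holds by conversion. A general
    measure is allowed because the same facts serve the line, the plane and products of two
    planes. *)
Definition cint f : R[i] :=
  Complex (\int[mu]_x Re (f x)) (\int[mu]_x Im (f x)).

Definition integr h := mu.-integrable setT (EFin \o h).

Definition cintegr f := integr (fun x => Re (f x)) /\ integr (fun x => Im (f x)).

Lemma integr_meas h : integr h -> measurable_fun setT h.
Proof. by move/integrableP => [/measurable_EFinP]. Qed.

Lemma integr_le h k : measurable_fun setT h -> (forall x, `|h x| <= k x) ->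
  integr k -> integr h.
Proof.
move=> mh hk ik; apply: le_integrable ik => //.
  exact/measurable_EFinP.
by move=> x _ /=; rewrite lee_fin (le_trans (hk x))// ler_norm.
Qed.

Lemma integr_normr h : integr h -> integr (fun x => `|h x|).
Proof. exact: integrable_norm. Qed.

Lemma integrD h k : integr h -> integr k -> integr (fun x => h x + k x).
Proof. by move=> ih ik; exact: (integrableD measurableT ih ik). Qed.

Lemma integrZ c h : integr h -> integr (fun x => c * h x).
Proof. by move=> ih; exact: (integrableZl measurableT c ih). Qed.

Lemma cintegr_meas f : cintegr f -> cmeas f.
Proof. by move=> [f1 f2]; split; exact: integr_meas. Qed.

Lemma cintegr_le f h : cmeas f -> (forall x, normc (f x) <= h x) ->
  integr h -> cintegr f.
Proof.
move=> [f1 f2] fh ih; split; apply: integr_le ih => // x.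
  exact: le_trans (normr_Re_le _) (fh x).
exact: le_trans (normr_Im_le _) (fh x).
Qed.

Lemma cintegr_norm f : cintegr f -> integr (fun x => normc (f x)).
Proof.
move=> cf; have [f1 f2] := cf.
apply: (integr_le (k := fun x => `|Re (f x)| + `|Im (f x)|)).
- exact/measurable_normc/cintegr_meas.
- by move=> x; rewrite ger0_norm ?normc_ge0// normc_le_Re_Im.
- by apply: integrD; exact: integr_normr.
Qed.

Lemma cintegrD f g : cintegr f -> cintegr g -> cintegr (fun x => f x + g x).
Proof.
move=> [f1 f2] [g1 g2]; split.
  by under [X in integr X]eq_fun do rewrite Re_addc; exact: integrD.
by under [X in integr X]eq_fun do rewrite Im_addc; exact: integrD.
Qed.

Lemma cintegrZ c f : cintegr f -> cintegr (fun x => c * f x).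
Proof.
move=> cf; apply: (cintegr_le (h := fun x => normc c * normc (f x))).
- by apply: cmeasM; [exact: cmeas_cst|exact: cintegr_meas].
- by move=> x; rewrite ComplexField.Normc.normcM.
- exact/integrZ/cintegr_norm.
Qed.

Lemma eq_cint f g : f =1 g -> cint f = cint g.
Proof. by move=> /funext ->. Qed.

Lemma cintD f g : cintegr f -> cintegr g ->
  cint (fun x => f x + g x) = cint f + cint g.
Proof.
move=> [f1 f2] [g1 g2]; rewrite /cint.
under eq_Rintegral do rewrite Re_addc.
under [X in Complex _ X]eq_Rintegral do rewrite Im_addc.
by rewrite !RintegralD.
Qed.

Lemma cintZ c f : cintegr f -> cint (fun x => c * f x) = c * cint f.
Proof.
move=> [f1 f2]; rewrite /cint.
under eq_Rintegral do rewrite Re_mulc.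
under [X in Complex _ X]eq_Rintegral do rewrite Im_mulc.
rewrite RintegralB//; [|exact: integrZ..].
rewrite RintegralD//; [|exact: integrZ..].
rewrite !RintegralZl//.
by apply/eqP; rewrite eq_complex/= Re_mulc Im_mulc/= !eqxx.
Qed.

Lemma RintegralN h : integr h -> \int[mu]_x (- h x) = - \int[mu]_x h x.
Proof.
move=> ih; rewrite -[RHS]mulN1r -RintegralZl//.
by apply: eq_Rintegral => x _; rewrite mulN1r.
Qed.

Lemma cint_conj f : cintegr f ->
  cint (fun x => conjc (f x)) = conjc (cint f).
Proof.
move=> [_ f2]; rewrite /cint; congr Complex.
  by under eq_Rintegral do rewrite Re_conjc.
by under eq_Rintegral do rewrite Im_conjc; rewrite RintegralN.
Qed.

(* With I = cint f, integrate Re (conjc I * f x) <= |I| |f x|. *)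
Lemma normc_cint_le f : cintegr f ->
  normc (cint f) <= \int[mu]_x normc (f x).
Proof.
move=> cf; have [f1 f2] := cf; set I := cint f.
have [->|I0] := eqVneq (normc I) 0.
  by apply: Rintegral_ge0 => x _; exact: normc_ge0.
have Igt0 : 0 < normc I by rewrite lt_def I0 normc_ge0.
rewrite -(ler_pM2l Igt0) -expr2 sqr_normcE -RintegralZl//; last exact: cintegr_norm.
have -> : Re I ^+ 2 + Im I ^+ 2 =
    \int[mu]_x (Re I * Re (f x) + Im I * Im (f x)).
  rewrite RintegralD//; [|exact: integrZ..].
  by rewrite !RintegralZl// !expr2.
apply: le_Rintegral => //.
- by apply: integrD; exact: integrZ.
- by apply: integrZ; exact: cintegr_norm.
move=> x _; rewrite -normc_conj -ComplexField.Normc.normcM.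
apply: le_trans (le_trans (ler_norm _) (normr_Re_le _)).
by rewrite Re_mulc Re_conjc Im_conjc mulNr opprK.
Qed.

Lemma normc_cint_lee f : cintegr f ->
  ((normc (cint f))%:E <= \int[mu]_x (normc (f x))%:E)%E.
Proof.
move=> cf; rewrite -[leRHS]fineK ?lee_fin; first exact: normc_cint_le.
exact/integrable_fin_num/(cintegr_norm cf).
Qed.

Lemma Rintegral_dct (u : nat -> T -> R) h k :
  (forall n, measurable_fun setT (u n)) -> measurable_fun setT h ->
  (forall x, u ^~ x @ \oo --> h x) -> integr k ->
  (forall n x, `|u n x| <= k x) ->
  (fun n => \int[mu]_x u n x) @ \oo --> \int[mu]_x h x.
Proof.
move=> mu_ mh uh ik uk.
have uh' x : setT x -> (fun n => (u n x)%:E) @ \oo --> (h x)%:E.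
  by move=> _; apply: cvg_EFin; [exact: nearW|exact: uh].
have uk' x n : setT x -> (`|(u n x)%:E| <= (k x)%:E)%E.
  by move=> _; rewrite lee_fin.
have [ih _ cvgi] := @dominated_convergence _ _ _ mu setT measurableT
  (fun n x => (u n x)%:E) (fun x => (h x)%:E) (fun x => (k x)%:E)
  (fun n => (measurable_EFinP _ _).2 (mu_ n))
  ((measurable_EFinP _ _).2 mh) (aeW _ uh') ik (aeW _ uk').
apply: fine_cvg.
rewrite fineK; first exact: cvgi.
exact: integrable_fin_num.
Qed.

Definition ccvg (u : nat -> R[i]) (l : R[i]) :=
  (Re (u n) @[n --> \oo] --> Re l) /\ (Im (u n) @[n --> \oo] --> Im l).

Lemma cint_dct (u : nat -> T -> R[i]) f k :
  (forall n, cmeas (u n)) -> cmeas f ->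
  (forall x, ccvg (u ^~ x) (f x)) -> integr k ->
  (forall n x, normc (u n x) <= k x) ->
  ccvg (fun n => cint (u n)) (cint f).
Proof.
move=> mu_ mf uf ik uk; split.
- apply: (@Rintegral_dct (fun n x => Re (u n x)) _ k) => //.
  + by move=> n; case: (mu_ n).
  + by case: mf.
  + by move=> x; case: (uf x).
  + by move=> n x; exact: le_trans (normr_Re_le _) (uk n x).
- apply: (@Rintegral_dct (fun n x => Im (u n x)) _ k) => //.
  + by move=> n; case: (mu_ n).
  + by case: mf.
  + by move=> x; case: (uf x).
  + by move=> n x; exact: le_trans (normr_Im_le _) (uk n x).
Qed.

End cint.

Section ccvg.
Context (R : realType).
Implicit Types (u v : nat -> R[i]) (a b : R[i]).

Lemma ccvg_cst a : ccvg (fun=> a) a.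
Proof. by split; exact: cvg_cst. Qed.

Lemma ccvgM u v a b : ccvg u a -> ccvg v b -> ccvg (fun n => u n * v n) (a * b).
Proof.
move=> [u1 u2] [v1 v2]; split.
  rewrite Re_mulc; under eq_fun do rewrite Re_mulc.
  by apply: cvgB; exact: cvgM.
rewrite Im_mulc; under eq_fun do rewrite Im_mulc.
by apply: cvgD; exact: cvgM.
Qed.

Lemma ccvg_unique u a b : ccvg u a -> ccvg u b -> a = b.
Proof.
move=> [u1 u2] [v1 v2]; apply/eqP; rewrite eq_complex; apply/andP; split; apply/eqP.
  by have := cvg_unique _ u1 v1; apply.
by have := cvg_unique _ u2 v2; apply.
Qed.

Lemma ccvg_normc u a : ccvg u a -> normc (u n) @[n --> \oo] --> normc a.
Proof.
move=> [u1 u2]; rewrite normcE_sqrt; under eq_fun do rewrite normcE_sqrt.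
apply: (cvg_comp _ (@Num.sqrt R)); last exact: sqrt_continuous.
by apply: cvgD; rewrite expr2; under eq_fun do rewrite expr2; exact: cvgM.
Qed.

End ccvg.

(** * Fubini for functions with a product majorant *)

Section fubini.
Context d1 d2 (T1 : measurableType d1) (T2 : measurableType d2) (R : realType).
Variable m1 : {sigma_finite_measure set T1 -> \bar R}.
Variable m2 : {sigma_finite_measure set T2 -> \bar R}.
Local Notation mp := (m1 \x m2)%E.

(** No integrability is assumed: Tonelli gives measurability for the positive and the negative part
    separately, and [fine] is measurable. *)
Lemma measurable_Rintegral1 (F : T1 * T2 -> R) : measurable_fun setT F ->
  measurable_fun setT (fun x => \int[m2]_y F (x, y)).
Proof.
move=> mF; apply: (@measurableT_comp _ _ _ _ _ _ (@fine R)) => //.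
rewrite [X in measurable_fun _ X](_ : _ = fun x =>
  (\int[m2]_y funepos (EFin \o F) (x, y) - \int[m2]_y funeneg (EFin \o F) (x, y))%E); last first.
  by apply/funext => x; rewrite [LHS]integralE; congr (_ - _)%E; apply: eq_integral => y _; rewrite ?funeposE ?funenegE.
apply: emeasurable_funB.
  apply: (measurable_fun_fubini_tonelli_F (funepos (EFin \o F))) => //.
  by apply: measurable_funepos; exact/measurable_EFinP.
apply: (measurable_fun_fubini_tonelli_F (funeneg (EFin \o F))) => //.
by apply: measurable_funeneg; exact/measurable_EFinP.
Qed.

Lemma cmeas_cint1 (F : T1 * T2 -> R[i]) : cmeas F ->
  cmeas (fun x => cint m2 (fun y => F (x, y))).
Proof.
move=> [F1 F2]; split => /=.
  exact: (measurable_Rintegral1 F1).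
exact: (measurable_Rintegral1 F2).
Qed.

Lemma integr_prod (g : T1 -> R) (h : T2 -> R) : integr m1 g -> integr m2 h ->
  integr mp (fun z => g z.1 * h z.2).
Proof.
move=> ig ih.
have mg := integr_meas ig; have mh := integr_meas ih.
have mgh : measurable_fun setT (fun z : T1 * T2 => g z.1 * h z.2).
  by apply: measurable_funM; exact: measurableT_comp.
apply/integrable12ltyP; first exact/measurable_EFinP.
move/integrableP: ig => [_ ig]; move/integrableP: ih => [_ ih].
rewrite (_ : (fun x => _) = fun x => (`|(g x)%:E| * \int[m2]_y `|(h y)%:E|)%E).
  rewrite ge0_integralZr//; [|by do 2 apply: measurableT_comp => //|exact: integral_ge0].
  by rewrite lte_mul_pinfty// ?ge0_fin_numE//; exact: integral_ge0.
apply/funext => x.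
under eq_integral do rewrite /= normrM EFinM.
rewrite ge0_integralZl//.
by do 2 apply: measurableT_comp => //.
Qed.

Section fubini_dominated.
Variables (g : T1 -> R) (h : T2 -> R).
Hypotheses (ig : integr m1 g) (ih : integr m2 h).

Section real.
Variable F : T1 * T2 -> R.
Hypothesis mF : measurable_fun setT F.
Hypothesis Fgh : forall x y, `|F (x, y)| <= g x * h y.

Let iF : mp.-integrable setT (EFin \o F).
Proof. by apply: integr_le (integr_prod ig ih) => // -[x y]; exact: Fgh. Qed.

(** A product majorant makes every slice integrable, not only almost every slice, so iterated
    real-valued integrals involve no exceptional null set. *)
Lemma Rfubini_integr1 x : integr m2 (fun y => F (x, y)).
Proof.
by apply: integr_le (integrZ (g x) ih) => //; exact: measurableT_comp.
Qed.

Lemma Rfubini_integr2 y : integr m1 (fun x => F (x, y)).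
Proof.
apply: integr_le (integrZ (h y) ig) => //; first exact: measurableT_comp.
by move=> x; rewrite mulrC.
Qed.

Lemma Rfubini1 :
  \int[m1]_x (\int[m2]_y F (x, y)) = \int[mp]_z F z.
Proof.
rewrite /Rintegral -(integral12_prod_meas1 iF); congr fine.
apply: eq_integral => x _; rewrite fineK//.
exact: (integrable_fin_num measurableT (Rfubini_integr1 x)).
Qed.

Lemma Rfubini2 :
  \int[m2]_y (\int[m1]_x F (x, y)) = \int[mp]_z F z.
Proof.
rewrite /Rintegral -(integral21_prod_meas1 iF); congr fine.
apply: eq_integral => y _; rewrite fineK//.
exact: (integrable_fin_num measurableT (Rfubini_integr2 y)).
Qed.

End real.

Variable F : T1 * T2 -> R[i].
Hypothesis mF : cmeas F.
Hypothesis Fgh : forall x y, normc (F (x, y)) <= g x * h y.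

Let FRe x y : `|Re (F (x, y))| <= g x * h y.
Proof. exact: le_trans (normr_Re_le _) _. Qed.

Let FIm x y : `|Im (F (x, y))| <= g x * h y.
Proof. exact: le_trans (normr_Im_le _) _. Qed.

Lemma cfubini1 : cint m1 (fun x => cint m2 (fun y => F (x, y))) = cint mp F.
Proof.
have [F1 F2] := mF; rewrite /cint/=.
by rewrite (Rfubini1 F1 FRe) (Rfubini1 F2 FIm).
Qed.

Lemma cfubini2 : cint m2 (fun y => cint m1 (fun x => F (x, y))) = cint mp F.
Proof.
have [F1 F2] := mF; rewrite /cint/=.
by rewrite (Rfubini2 F1 FRe) (Rfubini2 F2 FIm).
Qed.

Lemma cfubini : cint m1 (fun x => cint m2 (fun y => F (x, y))) =
  cint m2 (fun y => cint m1 (fun x => F (x, y))).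
Proof. by rewrite cfubini1 cfubini2. Qed.

End fubini_dominated.

End fubini.

(** * Lebesgue measure on the line and the plane *)

Section affine.
Context {R : realType}.
Local Notation leb := (@lebesgue_measure R).
Local Notation mR := (measurableTypeR R).

Lemma measurable_affine (a b : R) :
  measurable_fun setT (fun x : mR => a * x + b : mR).
Proof. by apply: measurable_funD => //; exact: measurable_funM. Qed.

(** Uniqueness of Lebesgue measure: the push-forward under the affine map, scaled by |a|, gives each
    interval []p, q]] its length. *)
Lemma ge0_integral_affine (a b : R) (f : mR -> \bar R) : a != 0 ->
  measurable_fun setT f -> (forall x, 0 <= f x)%E ->
  (\int[leb]_x f x = `|a|%:E * \int[leb]_x f (a * x + b)%R)%E.
Proof.
move=> a0 mf f0.
pose na : {nonneg R} := NngNum (normr_ge0 a).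
pose phi : mR -> mR := fun x => a * x + b.
have mphi : measurable_fun setT phi := measurable_affine a b.
pose phi_mixin := isMeasurableFun.Build _ _ _ _ _ mphi.
pose phi_pack : {mfun _ >-> _} := HB.pack phi phi_mixin.
rewrite (@eq_measure_integral _ _ _ setT (mscale na (pushforward leb phi_pack)) leb).
  rewrite ge0_integral_mscale//; congr (_ * _)%E.
  by rewrite ge0_integral_pushforward.
move=> A mA _.
apply: (@lebesgue_measure_unique R (mscale na (pushforward leb phi_pack))) => //.
move=> _ [[p q] _ <-].
change (leb `]p, q]%classic = (`|a|%:E * leb (phi @^-1` `]p, q]%classic))%E).
(* A negative slope reverses the interval and moves the closed end to the left; the length is
   unaffected. *)
have pre : phi @^-1` `]p, q]%classic = if 0 < a then `](p - b) / a, (q - b) / a]%classic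
   else `[(q - b) / a, (p - b) / a[%classic.
  case: ltgtP a0 => // a0 _; apply/seteqP; split => x; rewrite /= !in_itv/= /phi.
  - by rewrite ltr_pdivrMr// ler_pdivlMr// ltrBlDr lerBrDr mulrC.
  - by rewrite ltr_pdivrMr// ler_pdivlMr// ltrBlDr lerBrDr mulrC.
  - by rewrite ler_ndivrMr// ltr_ndivlMr// ltrBlDr lerBrDr mulrC andbC.
  - by rewrite ler_ndivrMr// ltr_ndivlMr// ltrBlDr lerBrDr mulrC andbC.
rewrite pre; case: ltgtP a0 => // a0 _; rewrite !lebesgue_measure_itv/= !lte_fin.
  rewrite ltr_pM2r ?invr_gt0// ltrD2r; case: ifPn => pq; last by rewrite mule0.
  by rewrite -!EFinB -EFinM gtr0_norm//; congr EFin; clear -a0; field; lra.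
rewrite ltr_nM2r ?invr_lt0// ltrD2r; case: ifPn => pq; last by rewrite mule0.
by rewrite -!EFinB -EFinM ltr0_norm//; congr EFin; clear -a0; field; lra.
Qed.

Local Notation leb2 := (leb \x leb)%E.

Lemma measurable_affine2 (a b c : R) :
  measurable_fun setT (fun z : mR * mR => (a * z.1 + b, a * z.2 + c) : mR * mR).
Proof.
apply/measurable_fun_pairP; split => /=.
  exact: (measurableT_comp (measurable_affine a b) measurable_fst).
exact: (measurableT_comp (measurable_affine a c) measurable_snd).
Qed.

(** The line case in each variable, by Tonelli. A common factor for both coordinates covers every
    use: translations, the reflection, and the rescaling of the Fejer kernel. *)
Lemma ge0_integral_affine2 (a b c : R) (f : mR * mR -> \bar R) : a != 0 ->
  measurable_fun setT f -> (forall x, 0 <= f x)%E ->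
  (\int[leb2]_z f z =
   (a ^+ 2)%:E * \int[leb2]_z f (a * z.1 + b, a * z.2 + c)%R)%E.
Proof.
move=> a0 mf f0.
have mf' := measurableT_comp mf (measurable_affine2 a b c).
rewrite fubini_tonelli1// (fubini_tonelli1 _ mf')//=.
have mF := measurable_fun_fubini_tonelli_F (m2 := leb) f mf f0.
rewrite (@ge0_integral_affine a b)//; last by move=> x; exact: integral_ge0.
rewrite -real_normK ?num_real// expr2 EFinM -muleA; congr (_ * _)%E.
rewrite -ge0_integralZl//.
- apply: eq_integral => x _.
  rewrite /fubini_F (@ge0_integral_affine a c)//.
  exact: measurableT_comp.
- exact: (measurable_fun_fubini_tonelli_F _ mf' (fun=> f0 _)).
- by move=> x _; apply: integral_ge0 => y _; exact: f0.
Qed.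

Lemma measurable_comp_affine2 (a b c : R) (f : mR * mR -> R) :
  measurable_fun setT f ->
  measurable_fun setT (fun z => f (a * z.1 + b, a * z.2 + c)).
Proof. by move=> mf; exact: (measurableT_comp mf (measurable_affine2 a b c)). Qed.

Lemma integr_affine2 (a b c : R) (f : mR * mR -> R) : a != 0 ->
  integr leb2 f -> integr leb2 (fun z => f (a * z.1 + b, a * z.2 + c)).
Proof.
move=> a0 /integrableP[/measurable_EFinP mf foo].
have mf' := measurable_comp_affine2 a b c mf.
apply/integrableP; split; first exact/measurable_EFinP.
move: foo.
rewrite (@ge0_integral_affine2 a b c)//; last by do 2 apply: measurableT_comp => //.
apply: contraTT; rewrite -!leNgt !leye_eq => /eqP ->.
by rewrite gt0_muley// lte_fin exprn_even_gt0.
Qed.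

Lemma Rintegral_affine2 (a b c : R) (f : mR * mR -> R) : a != 0 ->
  integr leb2 f ->
  \int[leb2]_z f z = a ^+ 2 * \int[leb2]_z f (a * z.1 + b, a * z.2 + c).
Proof.
move=> a0 intf; have mf := integr_meas intf.
have mp : measurable_fun setT (funepos (fun z => (f z)%:E)).
  by apply: measurable_funepos; exact/measurable_EFinP.
have mn : measurable_fun setT (funeneg (fun z => (f z)%:E)).
  by apply: measurable_funeneg; exact/measurable_EFinP.
rewrite /Rintegral integralE.
rewrite (ge0_integral_affine2 b c a0 mp)// (ge0_integral_affine2 b c a0 mn)//.
have intg := integr_affine2 b c a0 intf.
pose g z := (f (a * z.1 + b, a * z.2 + c))%:E.
set P := (\int[leb2]_z _)%E; set N := (\int[leb2]_z _)%E.
have -> : P = (\int[leb2]_z funepos g z)%E.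
  by apply: eq_integral => z _; rewrite !funeposE.
have -> : N = (\int[leb2]_z funeneg g z)%E.
  by apply: eq_integral => z _; rewrite !funenegE.
have ip := integrable_fin_num measurableT (integrable_funepos measurableT intg).
rewrite -muleBr//; last exact: fin_num_adde_defr.
rewrite -integralE fineM//.
exact: (integrable_fin_num measurableT intg).
Qed.

Lemma cint_affine2 (a b c : R) (f : mR * mR -> R[i]) : a != 0 ->
  cintegr leb2 f ->
  cint leb2 f = Complex (a ^+ 2) 0 * cint leb2 (fun z => f (a * z.1 + b, a * z.2 + c)).
Proof.
move=> a0 [f1 f2]; apply/eqP; rewrite eq_complex/=.
rewrite (Rintegral_affine2 b c a0 f1) (Rintegral_affine2 b c a0 f2).
by rewrite !mul0r subr0 addr0 !eqxx.
Qed.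

Lemma cintegr_affine2 (a b c : R) (f : mR * mR -> R[i]) : a != 0 ->
  cintegr leb2 f -> cintegr leb2 (fun z => f (a * z.1 + b, a * z.2 + c)).
Proof.
move=> a0 [f1 f2]; split.
  exact: (integr_affine2 b c a0 f1).
exact: (integr_affine2 b c a0 f2).
Qed.

End affine.

Section continuous_measurable.
Context {R : realType}.
Local Notation mR := (measurableTypeR R).

(* Boxes with rational centers and radii form a countable base of the plane. *)
Lemma open_measurable_plane (A : set (R * R)) : open A ->
  measurable (A : set (mR * mR)).
Proof.
move=> oA.
pose box (a b r : rat) : set (mR * mR) :=
  (ball (ratr a : R) (ratr r)) `*` (ball (ratr b : R) (ratr r)).
pose F a b r : set (mR * mR) := if `[< box a b r `<=` A >] then box a b r else set0.
rewrite (_ : (A : set (mR * mR)) = \bigcup_a \bigcup_b \bigcup_r F a b r); last first.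
  apply/seteqP; split => [[x y] Axy|z [a _ [b _ [r _]]]]; last first.
    by rewrite /F; case: asboolP => // + Fz; apply.
  have /nbhs_ballP[e /= e0 eA] := open_nbhs_nbhs (conj oA Axy).
  have [r] := rat_in_itvoo (divr_gt0 e0 (ltr0n R 2)).
  rewrite in_itv/= => /andP[r0 re].
  have [a] := @rat_in_itvoo R (x - ratr r) (x + ratr r) ltac:(lra).
  rewrite in_itv/= => /andP[a1 a2].
  have [b] := @rat_in_itvoo R (y - ratr r) (y + ratr r) ltac:(lra).
  rewrite in_itv/= => /andP[b1 b2].
  exists a => //; exists b => //; exists r => //; rewrite /F.
  have xr : ball (ratr a : R) (ratr r) x.
    by rewrite /ball/= ltr_norml; apply/andP; split; lra.
  have yr : ball (ratr b : R) (ratr r) y.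
    by rewrite /ball/= ltr_norml; apply/andP; split; lra.
  case: asboolP => [_|[]]; first by split.
  move=> [u v] [/= ua vb]; apply: eA; split => /=.
    by move: xr ua; rewrite /ball/= !ltr_norml => /andP[? ?] /andP[? ?]; apply/andP; split; lra.
  by move: yr vb; rewrite /ball/= !ltr_norml => /andP[? ?] /andP[? ?]; apply/andP; split; lra.
do 3 apply: bigcupT_measurable_rat => ?.
rewrite /F; case: ifPn => // _.
by apply: measurableX; exact: measurable_ball.
Qed.

Lemma continuous_measurable_plane (f : R * R -> R) : continuous f ->
  measurable_fun setT (f : mR * mR -> R).
Proof.
move=> /continuousP cf; apply: (measurability _ (RGenOpens.measurableE R)).
move=> _ [_ [a [b ->] <-]]; rewrite setTI.
by apply: open_measurable_plane; exact/cf/interval_open.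
Qed.

End continuous_measurable.

(** * Integrability of powers of the Japanese bracket *)

Section jap_integral.
Context {R : realType}.
Local Notation leb := (@lebesgue_measure R).
Local Notation mR := (measurableTypeR R).

Lemma jap_gt0 (x : R) : 0 < jap x.
Proof. by rewrite sqrtr_gt0 ltr_pwDl// sqr_ge0. Qed.

Lemma sqr_jap (x : R) : jap x ^+ 2 = 1 + x ^+ 2.
Proof. by rewrite sqr_sqrtr ?real_normK ?num_real// addr_ge0// sqr_ge0. Qed.

Lemma jap_ge1 (x : R) : 1 <= jap x.
Proof.
by rewrite -(@ler_pXn2r _ 2)// ?nnegrE ?(ltW (jap_gt0 _))// sqr_jap expr1n lerDl sqr_ge0.
Qed.

Lemma jap_ge_norm (x : R) : `|x| <= jap x.
Proof.
by rewrite -(@ler_pXn2r _ 2)// ?nnegrE ?(ltW (jap_gt0 _))// sqr_jap real_normK ?num_real// lerDr.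
Qed.

Lemma jap_le1D (x : R) : jap x <= 1 + `|x|.
Proof.
rewrite -(@ler_pXn2r _ 2)// ?nnegrE ?(ltW (jap_gt0 _)) ?addr_ge0// sqr_jap.
rewrite -[x ^+ 2]real_normK ?num_real//; have := normr_ge0 x; nra.
Qed.

Lemma continuous_jap : continuous (@jap R).
Proof.
move=> x; apply: (cvg_comp _ (@Num.sqrt R)); last exact: sqrt_continuous.
apply: cvgD; first exact: cvg_cst.
rewrite expr2; under eq_fun do rewrite expr2.
by apply: cvgM; apply: norm_continuous.
Qed.

Lemma measurable_jap : measurable_fun setT (@jap R).
Proof. exact: continuous_measurable_fun continuous_jap. Qed.

Lemma ge1_jap_half (x : R) : (1 + `|x|) / 2 <= jap x.
Proof. have := jap_ge1 x; have := jap_ge_norm x; lra. Qed.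

Lemma continuous_powR_1Dnorm (q : R) :
  continuous (fun x : R => (1 + `|x|) `^ q).
Proof.
move=> x; apply: (@continuous_comp R^o R^o R^o (fun x => 1 + `|x|) (@powR R ^~ q)).
  by apply: cvgD; [exact: cvg_cst|exact: norm_continuous].
apply: differentiable_continuous; apply/derivable1_diffP/derivable_powR.
by rewrite in_itv/= andbT ltr_pwDl.
Qed.

Lemma cvg_powRN_1D (q : R) : 0 < q -> (1 + x) `^ (- q) @[x --> +oo%R] --> 0.
Proof.
move=> q0; apply/cvgrPdist_le => /= e e0; near=> x.
have x0 : 0 < 1 + x by rewrite ltr_pwDl//; near: x; exact: nbhs_pinfty_ge.
rewrite sub0r normrN ger0_norm ?powR_ge0// powRN invf_ple ?posrE ?powR_gt0//.
have {1}-> : e^-1 = (e^-1 `^ q^-1) `^ q.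
  by rewrite -powRrM mulVf ?gt_eqF// powRr1// invr_ge0 ltW.
apply: ge0_ler_powR; rewrite ?nnegrE ?powR_ge0// ?(ltW q0) ?(ltW x0)//.
rewrite -lerBlDl; near: x; apply: nbhs_pinfty_ge; exact: num_real.
Unshelve. all: end_near. Qed.

(** The primitive is -(1+x)^(1-p)/(p-1), which vanishes at infinity because p > 1. *)
Lemma integral_halfline_powR (p : R) : 1 < p ->
  (\int[leb]_(x in `[0%R, +oo[) ((1 + `|x|) `^ (- p))%:E = ((p - 1)^-1)%:E)%E.
Proof.
move=> p1.
have dpow (x : R) q : 0 <= x ->
    is_derive x 1 (fun x => (1 + x) `^ q) (q * (1 + x) `^ (q - 1)).
  move=> x0.
  have h : is_derive (1 + x) 1 (@powR R ^~ q) (q * (1 + x) `^ (q - 1)).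
    by apply: is_derive1_powR; rewrite ltr_pwDl.
  apply: is_derive_eq; first exact: (@is_derive1_comp R (@powR R ^~ q) (fun x => 1 + x)).
  by rewrite add0r !mulr1.
rewrite (@ge0_continuous_FTC2y R (fun x => (1 + `|x|) `^ (- p))
  (fun x => - (p - 1)^-1 * (1 + x) `^ (1 - p)) 0 0).
- by rewrite addr0 powR1 mulr1 -EFinB opprK add0r.
- by move=> x _; exact: powR_ge0.
- by apply: continuous_subspaceT; exact: continuous_powR_1Dnorm.
- rewrite -[X in _ --> X](mulr0 (- (p - 1)^-1)).
  apply: cvgM; first exact: cvg_cst.
  by rewrite -opprB; apply: cvg_powRN_1D; rewrite subr_gt0.
- move=> x x0; have h := dpow x (1 - p) (ltW x0).
  by apply: derivableM => //; exact: ex_derive.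
- apply: cvg_at_right_filter; apply: cvgM; first exact: cvg_cst.
  have h := dpow 0 (1 - p) (lexx _).
  have /derivable1_diffP/differentiable_continuous := @ex_derive _ _ _ _ _ _ _ h; exact.
- move=> x; rewrite in_itv/= andbT => x0; rewrite derive1E.
  have h := dpow x (1 - p) (ltW x0); have dh := @ex_derive _ _ _ _ _ _ _ h.
  rewrite (@deriveM R R^o (fun=> - (p - 1)^-1))//=.
  rewrite derive_cst scaler0 addr0 derive_val gtr0_norm// /GRing.scale/= mulrA.
  have -> : - (p - 1)^-1 * (1 - p) = 1 by field; lra.
  by rewrite mul1r addrAC subrr add0r.
Qed.

(** The comparison 1 + |x| <= 2 <x> replaces the bracket by a function with an explicit primitive,
    and evenness reduces the line to a half-line. *)
Lemma integr_jap (p : R) : 1 < p -> integr leb (fun x : mR => jap x `^ (- p)).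
Proof.
move=> p1.
have mj : measurable_fun setT (fun x : mR => jap x `^ (- p)).
  by apply: (measurableT_comp (measurable_powR _)); exact: measurable_jap.
pose k (x : R) := (1 + `|x|) `^ (- p).
have ck : continuous k by exact: continuous_powR_1Dnorm.
have ik : integr leb k.
  apply/integrableP; split.
    by apply/measurable_EFinP; exact: continuous_measurable_fun ck.
  under eq_integral do rewrite /= ger0_norm ?powR_ge0//.
  rewrite ge0_symfun_integralT//; last 2 first.
  - by move=> x; exact: powR_ge0.
  - by move=> x; rewrite /k/= normrN.
  by rewrite -set_itvcy integral_halfline_powR// -EFinM ltry.
apply: (integr_le mj _ (integrZ (2 `^ p) ik)).
move=> x; rewrite ger0_norm ?powR_ge0// /k !powRN.
have x1 : 0 < 1 + `|x| by rewrite ltr_pwDl.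
rewrite ler_pdivlMr ?powR_gt0// mulrC ler_pdivrMr ?powR_gt0 ?jap_gt0//.
rewrite -powRM ?(ltW (jap_gt0 _))//; apply: ge0_ler_powR.
- by rewrite (le_trans ler01)// ltW.
- by rewrite nnegrE ltW.
- by rewrite nnegrE mulr_ge0// ltW// jap_gt0.
- by have := ge1_jap_half x; lra.
Qed.

End jap_integral.

(* The canonical sigma-finite structure on products is only found for products
   of probabilities, so the plane measure is given its own. *)
Definition plane_measure (R : realType) :
    set (measurableTypeR R * measurableTypeR R) -> \bar R :=
  (@lebesgue_measure R \x @lebesgue_measure R)%E.
Arguments plane_measure : clear implicits.

HB.instance Definition _ (R : realType) :=
  Measure.copy (plane_measure R) (@lebesgue_measure R \x @lebesgue_measure R)%E.

Lemma plane_measure_sigma_finite (R : realType) : sigma_finite setT (plane_measure R).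
Proof.
pose F (n : nat) : set (measurableTypeR R) := `[- n%:R, n%:R]%classic.
exists (fun n => F n `*` F n).
  apply/seteqP; split => // -[x y] _; exists (Num.bound (Num.max `|x| `|y|)) => //.
  have := archi_boundP (le_trans (normr_ge0 x) (ltac:(by rewrite le_max lexx) : `|x| <= Num.max `|x| `|y|)).
  rewrite gt_max => /andP[/ltW + /ltW]; rewrite !ler_norml => hx hy.
  by split; rewrite /F/= in_itv.
move=> n; have mF : measurable (F n) by exact: measurable_itv.
split; first exact: measurableX.
have Ffin : (@lebesgue_measure R (F n) < +oo)%E.
  by rewrite lebesgue_measure_itv/=; case: ifPn => // _; rewrite -EFinB ltry.
rewrite [X in (X < _)%E](product_measure1E _ _ mF mF).
by rewrite lte_mul_pinfty// ge0_fin_numE.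
Qed.

HB.instance Definition _ (R : realType) :=
  Measure_isSigmaFinite.Build _ _ _ (plane_measure R) (@plane_measure_sigma_finite R).

(** * Schwartz functions and their Fourier transforms *)

Section schwartz_algebra.
Context {R : realType}.
Implicit Types (f g h : R * R -> R) (b : bool).

Definition dirv b : R * R := if b then dir_x R else dir_t R.

Definition decays f := forall k : nat, exists M : R, forall z : R * R,
  (1 + `|z|) ^+ k * `|f z| <= M.

(** Induction on the word of derivatives: a class of differentiable decaying functions that is
    stable under both partial derivatives stays inside itself along every word. *)
Lemma real_schwartz_coind (P : (R * R -> R) -> Prop) :
  (forall f, P f -> [/\ forall z, differentiable f z, decays f &
    forall b, P ('D_(dirv b) f)]) ->
  forall f, P f -> real_schwartz f.
Proof.
move=> Pind f Pf w.
have Pw : P (iter_partial w f).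
  by elim: w => //= b w IH; have [_ _] := Pind _ IH; exact.
by have [d1 d2 _] := Pind _ Pw.
Qed.

Lemma real_schwartz_diff f : real_schwartz f -> forall z, differentiable f z.
Proof. by move=> /(_ [::])[]. Qed.

Lemma real_schwartz_decays f : real_schwartz f -> decays f.
Proof. by move=> /(_ [::])[]. Qed.

Lemma real_schwartz_derive f b : real_schwartz f -> real_schwartz ('D_(dirv b) f).
Proof.
(* The derivative applied first is the last letter of the word. *)
move=> sf w; have := sf (rcons w b).
by rewrite /iter_partial foldr_rcons.
Qed.

(* The derivative of a product is only a sum of products, so the coinduction
   [real_schwartz_coind] needs a class closed under both operations. *)
Inductive schwartz_closure : (R * R -> R) -> Prop :=
| SC_base f : real_schwartz f -> schwartz_closure f
| SC_add f g : schwartz_closure f -> schwartz_closure g -> schwartz_closure (f + g)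
| SC_opp f : schwartz_closure f -> schwartz_closure (- f)
| SC_mul f g : schwartz_closure f -> schwartz_closure g -> schwartz_closure (f * g).

Lemma schwartz_closure_schwartz f : schwartz_closure f -> real_schwartz f.
Proof.
apply: real_schwartz_coind => {}f; elim => {f}.
- move=> f sf; split; [exact: real_schwartz_diff|exact: real_schwartz_decays|].
  by move=> b; exact/SC_base/real_schwartz_derive.
- move=> f g _ [df cf Df] _ [dg cg Dg]; split.
  + by move=> z; exact: differentiableD.
  + move=> k; have [M fM] := cf k; have [N gN] := cg k; exists (M + N) => z.
    apply: (le_trans _ (lerD (fM z) (gN z))); rewrite -mulrDr.
    by apply: ler_wpM2l; [rewrite exprn_ge0// addr_ge0|exact: ler_normD].
  + move=> b; rewrite (_ : 'D_(dirv b) (f + g) = 'D_(dirv b) f + 'D_(dirv b) g).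
      exact: SC_add.
    by apply/funext => z; rewrite deriveD//; exact: diff_derivable.
- move=> f _ [df cf Df]; split.
  + by move=> z; exact: differentiableN.
  + by move=> k; have [M fM] := cf k; exists M => z; rewrite /= normrN.
  + move=> b; rewrite (_ : 'D_(dirv b) (- f) = - 'D_(dirv b) f).
      exact: SC_opp.
    by apply/funext => z; rewrite deriveN//; exact: diff_derivable.
- move=> f g sf [df cf Df] sg [dg cg Dg]; split.
  + by move=> z; exact: differentiableM.
  (* All decay is taken from [f]; the instance [cg 0] only says that [g] is bounded. *)
  + move=> k; have [M fM] := cf k; have [N gN] := cg 0; exists (M * N) => z.
    rewrite /= normrM mulrA ler_pM ?mulr_ge0 ?exprn_ge0// ?addr_ge0//.
    by have := gN z; rewrite expr0 mul1r.
  + move=> b; rewrite (_ : 'D_(dirv b) (f * g) = f * 'D_(dirv b) g + g * 'D_(dirv b) f).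
      by apply: SC_add; exact: SC_mul.
    by apply/funext => z; rewrite deriveM//; exact: diff_derivable.
Qed.

Lemma real_schwartzD f g : real_schwartz f -> real_schwartz g ->
  real_schwartz (fun z => f z + g z).
Proof.
move=> sf sg; apply: schwartz_closure_schwartz.
by apply: SC_add; exact: SC_base.
Qed.

Lemma real_schwartzN f : real_schwartz f -> real_schwartz (fun z => - f z).
Proof.
move=> sf; apply: schwartz_closure_schwartz.
by apply: SC_opp; exact: SC_base.
Qed.

Lemma real_schwartzM f g : real_schwartz f -> real_schwartz g ->
  real_schwartz (fun z => f z * g z).
Proof.
move=> sf sg; apply: schwartz_closure_schwartz.
by apply: SC_mul; exact: SC_base.
Qed.

End schwartz_algebra.

Section schwartz_complex.
Context {R : realType}.
Implicit Types (f g : R * R -> R[i]).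

Lemma schwartzP f : real_schwartz (fun z => Re (f z)) ->
  real_schwartz (fun z => Im (f z)) -> schwartz f.
Proof. by []. Qed.

Lemma schwartzD f g : schwartz f -> schwartz g -> schwartz (fun z => f z + g z).
Proof.
move=> [f1 f2] [g1 g2]; apply: schwartzP.
  under [X in real_schwartz X]eq_fun do rewrite Re_addc; exact: real_schwartzD.
under [X in real_schwartz X]eq_fun do rewrite Im_addc; exact: real_schwartzD.
Qed.

Lemma schwartzN f : schwartz f -> schwartz (fun z => - f z).
Proof.
move=> [f1 f2]; apply: schwartzP.
  under [X in real_schwartz X]eq_fun do rewrite Re_oppc; exact: real_schwartzN.
under [X in real_schwartz X]eq_fun do rewrite Im_oppc; exact: real_schwartzN.
Qed.

Lemma schwartzB f g : schwartz f -> schwartz g -> schwartz (fun z => f z - g z).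
Proof. by move=> sf sg; apply: schwartzD => //; exact: schwartzN. Qed.

Lemma schwartzM f g : schwartz f -> schwartz g -> schwartz (fun z => f z * g z).
Proof.
move=> [f1 f2] [g1 g2]; apply: schwartzP.
  under [X in real_schwartz X]eq_fun do rewrite Re_mulc.
  apply: real_schwartzD; first exact: real_schwartzM.
  exact/real_schwartzN/real_schwartzM.
under [X in real_schwartz X]eq_fun do rewrite Im_mulc.
by apply: real_schwartzD; exact: real_schwartzM.
Qed.

Lemma schwartz_conj f : schwartz f -> schwartz (fun z => conjc (f z)).
Proof.
move=> [f1 f2]; apply: schwartzP.
  by under [X in real_schwartz X]eq_fun do rewrite Re_conjc.
under [X in real_schwartz X]eq_fun do rewrite Im_conjc.
exact: real_schwartzN.
Qed.

(** The instance [true] is convertible to [partial_x]. The derivative in t is there because decay of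
    the transform in tau comes from it. *)
Definition cpartial (b : bool) f : R * R -> R[i] := fun z =>
  Complex ('D_(dirv b) (re_part f) z) ('D_(dirv b) (im_part f) z).

Lemma schwartz_cpartial b f : schwartz f -> schwartz (cpartial b f).
Proof.
by move=> [f1 f2]; apply: schwartzP; exact: real_schwartz_derive.
Qed.

Lemma cpartialD b f g : schwartz f -> schwartz g ->
  cpartial b (fun z => f z + g z) = fun z => cpartial b f z + cpartial b g z.
Proof.
move=> [f1 f2] [g1 g2]; apply/funext => z; rewrite /cpartial.
apply/eqP; rewrite eq_complex/=.
rewrite (_ : re_part _ = re_part f + re_part g); last by apply/funext => y; exact: Re_addc.
rewrite (_ : im_part _ = im_part f + im_part g); last by apply/funext => y; exact: Im_addc.
by rewrite !deriveD ?eqxx//; apply: diff_derivable; exact: real_schwartz_diff.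
Qed.

Lemma schwartz_dx_mul_conj f g : schwartz f -> schwartz g ->
  schwartz (dx_mul_conj f g).
Proof.
move=> sf sg; apply: (@schwartz_cpartial true (fun z => f z * conjc (g z))).
by apply: schwartzM => //; exact: schwartz_conj.
Qed.

End schwartz_complex.

(** * An integrable majorant for Schwartz functions *)

Section schwartz_integrability.
Context {R : realType}.
Local Notation mR := (measurableTypeR R).
Local Notation leb := (@lebesgue_measure R).
Local Notation leb2 := (leb \x leb)%E.
Implicit Types (f g : R * R -> R[i]).

(** The common majorant of all dominated arguments on the plane. Four powers of 1 + |z| pay for it,
    two for each coordinate. *)
Definition K2 (z : R * R) : R := jap z.1 `^ (- 2) * jap z.2 `^ (- 2).

Lemma K2E z : K2 z = (jap z.1 ^+ 2 * jap z.2 ^+ 2)^-1.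
Proof.
rewrite /K2 !powRN -!invfM; congr (_^-1).
by rewrite -!powR_mulrn ?ltW ?jap_gt0.
Qed.

Lemma K2_gt0 z : 0 < K2 z.
Proof. by rewrite K2E invr_gt0 mulr_gt0// exprn_gt0// jap_gt0. Qed.

Lemma integr_K2 : integr leb2 (K2 : mR * mR -> R).
Proof.
have p1 : 1 < 2 :> R by rewrite ltr1n.
exact: (integr_prod (integr_jap p1) (integr_jap p1)).
Qed.

Lemma jap_le_norm1 (z : R * R) : jap z.1 <= 1 + `|z|.
Proof. by rewrite (le_trans (jap_le1D _))// lerD2l prod_normE le_max lexx. Qed.

Lemma jap_le_norm2 (z : R * R) : jap z.2 <= 1 + `|z|.
Proof. by rewrite (le_trans (jap_le1D _))// lerD2l prod_normE le_max lexx orbT. Qed.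

Lemma norm_pow4_K2 (z : R * R) : 1 <= (1 + `|z|) ^+ 4 * K2 z.
Proof.
rewrite K2E ler_pdivlMr ?mul1r ?mulr_gt0 ?exprn_gt0 ?jap_gt0//.
rewrite (_ : 4 = 2 + 2)%N// exprD; apply: ler_pM; rewrite ?exprn_ge0// ?(ltW (jap_gt0 _))//.
  by rewrite lerXn2r ?nnegrE ?(ltW (jap_gt0 _)) ?addr_ge0// jap_le_norm1.
by rewrite lerXn2r ?nnegrE ?(ltW (jap_gt0 _)) ?addr_ge0// jap_le_norm2.
Qed.

Lemma decays_K2 (f : R * R -> R) : decays f ->
  exists2 M, 0 <= M & forall z, (1 + `|z|) ^+ 4 * `|f z| <= M.
Proof.
move=> /(_ 4)[M fM]; exists M => //.
apply: le_trans (fM 0); rewrite mulr_ge0// exprn_ge0// addr_ge0//.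
Qed.

Lemma le_K2 (M t : R) (z : R * R) : 0 <= M -> 0 <= t ->
  (1 + `|z|) ^+ 4 * t <= M -> t <= M * K2 z.
Proof.
move=> M0 t0 h; apply: (@le_trans _ _ ((1 + `|z|) ^+ 4 * t * K2 z)); last first.
  by rewrite ler_pM2r ?K2_gt0.
by rewrite mulrAC -{1}(mul1r t) ler_wpM2r// norm_pow4_K2.
Qed.

Lemma decays_le_K2 (f : R * R -> R) : decays f ->
  exists2 M, 0 <= M & forall z, `|f z| <= M * K2 z.
Proof.
move=> /decays_K2[M M0 fM]; exists M => // z.
by apply: le_K2.
Qed.

Lemma real_schwartz_meas (f : R * R -> R) : real_schwartz f ->
  measurable_fun setT (f : mR * mR -> R).
Proof.
move=> sf; apply: continuous_measurable_plane => z.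
exact/differentiable_continuous/real_schwartz_diff.
Qed.

Lemma schwartz_cmeas f : schwartz f -> cmeas (f : mR * mR -> R[i]).
Proof. by move=> [f1 f2]; split; exact: real_schwartz_meas. Qed.

Lemma schwartz_le_K2 f : schwartz f ->
  exists2 M, 0 <= M & forall z, normc (f z) <= M * K2 z.
Proof.
move=> [/real_schwartz_decays/decays_le_K2[M M0 fM]].
move=> /real_schwartz_decays/decays_le_K2[N N0 fN].
exists (M + N) => [|z]; first exact: addr_ge0.
by apply: (le_trans (normc_le_Re_Im _)); rewrite mulrDl; apply: lerD; [exact: fM|exact: fN].
Qed.

Lemma schwartz_cintegr f : schwartz f -> cintegr leb2 (f : mR * mR -> R[i]).
Proof.
move=> sf; have [M M0 fM] := schwartz_le_K2 sf.
apply: (cintegr_le (schwartz_cmeas sf) fM).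
exact: integrZ integr_K2.
Qed.

End schwartz_integrability.

(** * Difference quotients along a null sequence *)

Section difference_quotient.
Context {R : realType}.
Implicit Types (f : R * R -> R) (g : R * R -> R[i]).

(** Derivatives are limits over a punctured neighbourhood, dominated convergence is sequential; the
    steps 1/(n+1) never vanish and connect the two. *)
Lemma cvg_harmonic_dnbhs : (@harmonic R) @ \oo --> (0 : R)^'.
Proof.
move=> A /= A0; change (\forall n \near \oo, A (harmonic n)).
have : \forall n \near \oo, harmonic n != 0 :> R -> A (harmonic n) := @cvg_harmonic R _ A0.
apply: filterS => n; apply; rewrite gt_eqF//; exact: harmonic_gt0.
Qed.

Lemma cvg_difference_quotient f (e y : R * R) : derivable f y e ->
  (fun n => (harmonic n)^-1 * (f (y + harmonic n *: e) - f y)) @ \oo --> 'D_e f y.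
Proof.
move=> df; have := @cvg_comp _ _ _ _ _ _ _ _ cvg_harmonic_dnbhs df.
by apply: cvg_trans; apply: near_eq_cvg; near=> n; rewrite /= [y + _]addrC.
Unshelve. all: end_near. Qed.

Lemma is_derive_line f (e y : R * R) (t : R) : derivable f (y + t *: e) e ->
  is_derive t 1 (fun t => f (y + t *: e)) ('D_e f (y + t *: e)).
Proof.
have E : (fun h : R => h^-1 *: (((fun t => f (y + t *: e)) \o shift t) (h *: 1) - f (y + t *: e)))
   = (fun h : R => h^-1 *: ((f \o shift (y + t *: e)) (h *: e) - f (y + t *: e))).
  apply/funext => h; congr (_ *: (f _ - _)) => /=.
  by rewrite [h *: 1]mulr1 scalerDl addrCA.
by move=> df; split; rewrite /derivable /derive E.
Qed.

Lemma norm_dirv b : `|@dirv R b| = 1.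
Proof. by case: b; rewrite prod_normE/= normr0 normr1 /Order.max ?ltr01 ?ltr10. Qed.

(** By the mean value theorem the quotient is a derivative at a point y + c e with 0 <= c <= 1, and
    1 + |y| <= 2 (1 + |y + c e|) costs the factor 2^4. The majorant is uniform in the step, as
    dominated convergence demands. *)
Lemma difference_quotient_le f b : real_schwartz f ->
  exists2 M, 0 <= M & forall (h : R) y, 0 < h <= 1 ->
    `|h^-1 * (f (y + h *: dirv b) - f y)| <= M * K2 y.
Proof.
move=> sf; have /real_schwartz_decays/decays_K2[M M0 fM] := real_schwartz_derive b sf.
exists (2 ^+ 4 * M) => [|h y /andP[h0 h1]]; first exact: mulr_ge0.
have dl t := is_derive_line (diff_derivable (real_schwartz_diff sf (y + t *: dirv b)) : derivable f _ (dirv b)).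
have cl : continuous (fun t : R => f (y + t *: dirv b)).
  move=> t; apply: differentiable_continuous; apply/derivable1_diffP.
  exact: (@ex_derive _ _ _ _ _ _ _ (dl t)).
have [c] := @MVT_segment R (fun t : R => f (y + t *: dirv b))
  (fun t : R => 'D_(dirv b) f (y + t *: dirv b)) 0 h (ltW h0) (fun t _ => dl t)
  (continuous_subspaceT cl).
rewrite scale0r addr0 subr0 in_itv/= => /andP[c0 ch] ->.
rewrite mulrCA mulVf ?gt_eqF// mulr1.
apply: le_K2 => //; first exact: mulr_ge0.
apply: le_trans (ler_wpM2l (exprn_ge0 4 (ler0n R 2)) (fM (y + c *: dirv b))).
rewrite mulrA -exprMn ler_wpM2r// lerXn2r ?nnegrE ?mulr_ge0 ?addr_ge0//.
have := ler_normB (y + c *: dirv b) (c *: dirv b); rewrite addrK prod_norm_scale norm_dirv mulr1 ger0_norm//.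
have := normr_ge0 (y + c *: dirv b); lra.
Qed.

End difference_quotient.

(** * Fourier transform of translates and derivatives *)

Section fourier_basic.
Context {R : realType}.
Local Notation mR := (measurableTypeR R).
Local Notation leb := (@lebesgue_measure R).
Local Notation leb2 := (leb \x leb)%E.
Implicit Types (f g : R * R -> R[i]).

Definition phase (y z : R * R) : R := 2 * pi * (y.1 * z.1 + y.2 * z.2).

Lemma fourierE f z : fourier f z = cint leb2 (fun y : mR * mR => cis (- phase y z) * f y).
Proof. by []. Qed.

Lemma measurable_phase (z : R * R) : measurable_fun setT (fun y : mR * mR => phase y z).
Proof.
by apply: measurable_funM => //; apply: measurable_funD; apply: measurable_funM => //.
Qed.

Lemma cmeas_character (z : R * R) : cmeas (fun y : mR * mR => cis (- phase y z)).
Proof. by apply: cmeas_cis; apply: measurable_funN; exact: measurable_phase. Qed.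

Lemma normc_cisM (t : R) (x : R[i]) : normc (cis t * x) = normc x.
Proof. by rewrite ComplexField.Normc.normcM normc_cis mul1r. Qed.

Lemma cintegr_character z f : cintegr leb2 (f : mR * mR -> R[i]) ->
  cintegr leb2 (fun y : mR * mR => cis (- phase y z) * f y).
Proof.
move=> cf; apply: (cintegr_le _ _ (cintegr_norm cf)).
  by apply: cmeasM; [exact: cmeas_character|exact: cintegr_meas cf].
by move=> y; rewrite normc_cisM.
Qed.

Lemma fourierD f g z : cintegr leb2 (f : mR * mR -> R[i]) ->
  cintegr leb2 (g : mR * mR -> R[i]) ->
  fourier (fun y => f y + g y) z = fourier f z + fourier g z.
Proof.
move=> cf cg; rewrite !fourierE -cintD; [|exact: cintegr_character..].
by apply: eq_cint => y; rewrite mulrDr.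
Qed.

Lemma fourierZ c f z : cintegr leb2 (f : mR * mR -> R[i]) ->
  fourier (fun y => c * f y) z = c * fourier f z.
Proof.
move=> cf; rewrite !fourierE -cintZ; last exact: cintegr_character.
by apply: eq_cint => y; rewrite mulrCA.
Qed.

Lemma fourier_shift f (a z : R * R) : cintegr leb2 (f : mR * mR -> R[i]) ->
  fourier (fun y => f (y + a)) z = cis (phase a z) * fourier f z.
Proof.
move=> cf; rewrite !fourierE.
rewrite [in RHS](@cint_affine2 R 1 a.1 a.2 _ (oner_neq0 _)); last exact: cintegr_character.
rewrite expr1n mul1r -cintZ; last first.
  have := @cintegr_affine2 R 1 a.1 a.2 _ (oner_neq0 _) (cintegr_character z cf).
  by [].
apply: eq_cint => y; rewrite mulrA -cisD /=.
rewrite (_ : (1 * y.1 + a.1, 1 * y.2 + a.2) = y + a); last by rewrite !mul1r; case: y; case: a.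
by congr (cis _ * _); rewrite /phase/=; ring.
Qed.

Lemma cmeas_fourier f : cmeas (f : mR * mR -> R[i]) ->
  cmeas (fourier f : mR * mR -> R[i]).
Proof.
move=> mf.
have mF : cmeas (fun p : (mR * mR) * (mR * mR) => cis (- phase p.2 p.1) * f p.2).
  apply: cmeasM; last by apply: (cmeas_comp mf); exact: measurable_snd.
  apply: cmeas_cis; apply: measurable_funN; apply: measurable_funM => //.
  apply: measurable_funD; apply: measurable_funM.
  - exact: (measurableT_comp measurable_fst measurable_snd).
  - exact: (measurableT_comp measurable_fst measurable_fst).
  - exact: (measurableT_comp measurable_snd measurable_snd).
  - exact: (measurableT_comp measurable_snd measurable_fst).
exact: (cmeas_cint1 (plane_measure R) mF).
Qed.

Definition coordv b (z : R * R) : R := if b then z.2 else z.1.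

Lemma phase_dirv (h : R) b z : phase (h *: dirv b) z = 2 * pi * coordv b z * h.
Proof. by rewrite /phase; case: b => /=; rewrite /GRing.scale/=; ring. Qed.

Lemma cvg_quotient0 (phi : R -> R) (d : R) : is_derive (0 : R) 1 phi d ->
  (fun n => (harmonic n)^-1 * (phi (harmonic n) - phi 0)) @ \oo --> d.
Proof.
move=> dphi; have df := @ex_derive _ _ _ _ _ _ _ dphi.
have := @cvg_comp _ _ _ _ _ _ _ _ (@cvg_harmonic_dnbhs R) df.
rewrite -[d](@derive_val _ _ _ _ _ _ _ dphi).
apply: cvg_trans; apply: near_eq_cvg; near=> n.
by rewrite /= addr0 [_ *: 1]mulr1.
Unshelve. all: end_near. Qed.

Lemma ccvg_cis_quotient (a : R) :
  ccvg (fun n => Complex (harmonic n)^-1 0 * (cis (a * harmonic n) - 1)) (Complex 0 a).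
Proof.
have da : is_derive (0 : R) (1 : R) (fun h : R => a * h) a.
  by have := is_deriveZ a (is_derive_id (0 : R) 1); rewrite [a *: _]mulr1.
split.
- under eq_fun do rewrite Re_mulc/= mul0r subr0 -[in X in _ - X]cos0 -(mulr0 a).
  apply: (@cvg_quotient0 (fun h => cos (a * h))).
  apply: (is_derive_eq (is_derive1_comp (is_derive_cos _) da)).
  by rewrite mulr0 sin0 oppr0 mul0r.
- under eq_fun do rewrite Im_mulc/= mul0r addr0 oppr0 addr0 -[X in _ * X]subr0
    -[in X in _ - X]sin0 -(mulr0 a).
  apply: (@cvg_quotient0 (fun h => sin (a * h))).
  apply: (is_derive_eq (is_derive1_comp (is_derive_sin _) da)).
  by rewrite mulr0 cos0 mul1r.
Qed.

(** The transform of a difference quotient is explicit by [fourier_shift]. Its limit is computed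
    twice, through the derivative of the character and under the integral by dominated convergence,
    and limits are unique. *)
Lemma fourier_cpartial b f z : schwartz f ->
  fourier (cpartial b f) z = Complex 0 (2 * pi * coordv b z) * fourier f z.
Proof.
move=> sf; have cf := schwartz_cintegr sf.
have sf' := schwartz_cpartial b sf.
pose q n (y : R * R) := Complex (harmonic n)^-1 0 * (f (y + harmonic n *: dirv b) - f y).
have cshift n : cintegr leb2 (fun y : mR * mR => f (y + harmonic n *: dirv b)).
  have := @cintegr_affine2 R 1 (harmonic n *: dirv b).1 (harmonic n *: dirv b).2 _ (oner_neq0 _) cf.
  congr (cintegr _ _); apply/funext => -[y1 y2] /=; congr f.
  by rewrite !mul1r.
have cdiff n : cintegr leb2 (fun y : mR * mR => f (y + harmonic n *: dirv b) - f y).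
  apply: cintegrD => //.
  by have := cintegrZ (-1) cf; congr (cintegr _ _); apply/funext => y; rewrite mulN1r.
have Fq n : fourier (q n) z =
    Complex (harmonic n)^-1 0 * (cis (2 * pi * coordv b z * harmonic n) - 1) * fourier f z.
  rewrite /q fourierZ// -mulrA; congr (_ * _).
  rewrite fourierD//; last first.
    by have := cintegrZ (-1) cf; congr (cintegr _ _); apply/funext => y; rewrite mulN1r.
  rewrite fourier_shift// phase_dirv mulrBl mul1r; congr (_ + _).
  rewrite -mulN1r -fourierZ//; congr fourier.
  by apply/funext => y; rewrite mulN1r.
have lim1 : ccvg (fun n => fourier (q n) z) (Complex 0 (2 * pi * coordv b z) * fourier f z).
  under [X in ccvg X]eq_fun do rewrite Fq.
  by apply: ccvgM; [exact: ccvg_cis_quotient|exact: ccvg_cst].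
apply: (ccvg_unique _ lim1).
have [M M0 fM] := difference_quotient_le b sf.1.
have [N N0 fN] := difference_quotient_le b sf.2.
have hn n : 0 < (harmonic n : R) <= 1.
  by rewrite harmonic_gt0/= invf_le1// ?ler1n// ltr0n.
apply: (@cint_dct _ _ _ leb2 _ _ (fun y => (M + N) * K2 y)).
- move=> n; apply: cmeasM; first exact: cmeas_character.
  by apply: cmeasM; [exact: cmeas_cst|exact: cintegr_meas (cdiff n)].
- by apply: cmeasM; [exact: cmeas_character|exact: schwartz_cmeas].
- move=> y; apply: ccvgM; first exact: ccvg_cst.
  split.
    under eq_fun do rewrite /q Re_mulc/= mul0r subr0 Re_addc Re_oppc.
    apply: cvg_difference_quotient; apply: diff_derivable.
    exact: (real_schwartz_diff sf.1).
  under eq_fun do rewrite /q Im_mulc/= mul0r addr0 Im_addc Im_oppc.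
  apply: cvg_difference_quotient; apply: diff_derivable.
  exact: (real_schwartz_diff sf.2).
- exact: (integrZ (M + N) integr_K2).
- move=> n y; rewrite normc_cisM; apply: (le_trans (normc_le_Re_Im _)).
  rewrite mulrDl; apply: lerD.
    rewrite /q Re_mulc/= mul0r subr0 Re_addc Re_oppc.
    exact: (fM _ y (hn n)).
  rewrite /q Im_mulc/= mul0r addr0 Im_addc Im_oppc.
  exact: (fN _ y (hn n)).
Qed.

End fourier_basic.

Section fourier_decay.
Context {R : realType}.
Local Notation mR := (measurableTypeR R).
Local Notation leb := (@lebesgue_measure R).
Local Notation leb2 := (leb \x leb)%E.
Implicit Types (f g : R * R -> R[i]).

Lemma normc_fourier_cpartial b f z : schwartz f ->
  normc (fourier (cpartial b f) z) = 2 * pi * `|coordv b z| * normc (fourier f z).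
Proof.
move=> sf; rewrite fourier_cpartial// ComplexField.Normc.normcM; congr (_ * _).
rewrite normcE_sqrt/= expr0n add0r sqrtr_sqr normrM.
by rewrite (@ger0_norm _ (2 * pi))// mulr_ge0// pi_ge0.
Qed.

(** Each power of a frequency coordinate is exchanged for one derivative, and 2 pi >= 1 absorbs the
    constant. The inductions range over all Schwartz functions, since the derivative takes the place
    of the function. *)
Lemma fourier_decay f : schwartz f -> forall j k : nat,
  exists M, forall z, (1 + `|z.1|) ^+ j * (1 + `|z.2|) ^+ k * normc (fourier f z) <= M.
Proof.
have pi2 : 1 <= 2 * pi :> R by have := @pi_ge2 R; lra.
suff H (b : bool) (g : R * R -> R[i]) (w : R * R -> R) : (forall z, 0 <= w z) -> schwartz g ->
    (forall g, schwartz g -> exists M, forall z, w z * normc (fourier g z) <= M) ->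
    exists M, forall z, (1 + `|coordv b z|) * w z * normc (fourier g z) <= M.
  move=> sf j; elim: j f sf => [|j IH] f sf k.
    elim: k f sf => [|k IH] f sf.
      exists (\int[leb2]_y normc (f y)) => z; rewrite !mul1r fourierE.
      apply: le_trans (normc_cint_le (cintegr_character z (schwartz_cintegr sf))) _.
      by under eq_Rintegral do rewrite normc_cisM.
    have [M hM] := H true f (fun z => (1 + `|z.1|) ^+ 0 * (1 + `|z.2|) ^+ k)
      (fun z => mulr_ge0 (exprn_ge0 _ (addr_ge0 ler01 (normr_ge0 _))) (exprn_ge0 _ (addr_ge0 ler01 (normr_ge0 _)))) sf IH.
    by exists M => z; rewrite exprS mulrCA; exact: hM.
  have [M hM] := H false f (fun z => (1 + `|z.1|) ^+ j * (1 + `|z.2|) ^+ k)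
    (fun z => mulr_ge0 (exprn_ge0 _ (addr_ge0 ler01 (normr_ge0 _))) (exprn_ge0 _ (addr_ge0 ler01 (normr_ge0 _)))) sf (fun g sg => IH g sg k).
  by exists M => z; rewrite exprS -[X in X * _]mulrA; exact: hM.
move=> w0 sg hg; have [M hM] := hg g sg; have [N hN] := hg _ (schwartz_cpartial b sg).
exists (M + N) => z; rewrite mulrDl mul1r mulrDl; apply: lerD => //.
apply: le_trans (hN z); rewrite normc_fourier_cpartial//.
rewrite (_ : w z * _ = 2 * pi * (`|coordv b z| * w z * normc (fourier g z))); last by ring.
by rewrite ler_peMl// mulr_ge0 ?normc_ge0// mulr_ge0.
Qed.

End fourier_decay.

(** * The convolution inequality *)

Section tent.
Context {R : realType}.
Local Notation mR := (measurableTypeR R).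
Local Notation leb := (@lebesgue_measure R).

Definition tent (w : R) : R := Num.max 0 (1 - `|w|).

Lemma tent_ge0 w : 0 <= tent w.
Proof. by rewrite le_max lexx. Qed.

Lemma tent_le1 w : tent w <= 1.
Proof. by rewrite ge_max ler01 gerBl normr_ge0. Qed.

Lemma measurable_tent : measurable_fun setT (tent : mR -> R).
Proof.
apply: measurable_maxr => //; apply: measurable_funB => //.
Qed.

Lemma jap_powRN2 (w : R) : jap w `^ (- 2) = (1 + w ^+ 2)^-1.
Proof. by rewrite powRN -sqr_jap -powR_mulrn// ltW// jap_gt0. Qed.

Lemma tent_le_jap w : tent w <= 2 * jap w `^ (- 2).
Proof.
rewrite jap_powRN2 ler_pdivlMr; last by rewrite ltr_pwDl// sqr_ge0.
have [w1|w1] := leP 1 `|w|.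
  by rewrite (_ : tent w = 0) ?mul0r//; apply/max_idPl; rewrite subr_le0.
have : w ^+ 2 <= 1 by rewrite -real_normK ?num_real// expr_le1// ltW.
have := tent_le1 w; have := tent_ge0 w; have := sqr_ge0 w; nra.
Qed.

Lemma integr_tent : integr leb (tent : mR -> R).
Proof.
have p1 : 1 < 2 :> R by rewrite ltr1n.
apply: (integr_le measurable_tent _ (integrZ 2 (integr_jap p1))) => w.
by rewrite ger0_norm ?tent_ge0// tent_le_jap.
Qed.

Lemma FTC2_global (F f : R -> R) (a b : R) : a < b -> continuous f ->
  (forall x, is_derive x (1 : R) F (f x)) ->
  \int[leb]_(x in `[a, b]) f x = F b - F a.
Proof.
move=> ab cf dF; rewrite /Rintegral (@continuous_FTC2 R f F a b)//.
- exact: continuous_subspaceT.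
- have cF : continuous F.
    move=> x; apply: differentiable_continuous; apply/derivable1_diffP.
    exact: (@ex_derive _ _ _ _ _ _ _ (dF x)).
  split.
  + by move=> x _; exact: (@ex_derive _ _ _ _ _ _ _ (dF x)).
  + exact: cvg_at_right_filter (cF a).
  + exact: cvg_at_left_filter (cF b).
- by move=> x _; rewrite derive1E; exact: (@derive_val _ _ _ _ _ _ _ (dF x)).
Qed.

Section tent_transform.
Variables (S T : R -> R).
Hypothesis dS : forall x, is_derive x (1 : R) S (T x).
Hypothesis dT : forall x, is_derive x (1 : R) T (- S x).
Variable c : R.
Hypothesis c0 : c != 0.

Let dSc x : is_derive x (1 : R) (fun w => S (c * w)) (c * T (c * x)).
Proof.
have dc : is_derive x (1 : R) (fun h : R => c * h) c.
  by have := is_deriveZ c (is_derive_id x (1 : R)); rewrite [c *: _]mulr1.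
by apply: (is_derive_eq (is_derive1_comp (dS _) dc)); rewrite mulrC.
Qed.

Let dTc x : is_derive x (1 : R) (fun w => T (c * w)) (- (c * S (c * x))).
Proof.
have dc : is_derive x (1 : R) (fun h : R => c * h) c.
  by have := is_deriveZ c (is_derive_id x (1 : R)); rewrite [c *: _]mulr1.
by apply: (is_derive_eq (is_derive1_comp (dT _) dc)); rewrite mulNr mulrC.
Qed.

Let cT : continuous (fun w : R => T (c * w)).
Proof.
move=> x; apply: differentiable_continuous; apply/derivable1_diffP.
exact: (@ex_derive _ _ _ _ _ _ _ (dTc x)).
Qed.

Let d1B x : is_derive x (1 : R) (fun w : R => 1 - w) (- 1).
Proof. by have := is_deriveB (is_derive_cst (1 : R) x 1) (is_derive_id x (1 : R)); rewrite sub0r. Qed.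

Let d1D x : is_derive x (1 : R) (fun w : R => 1 + w) 1.
Proof. by have := is_deriveD (is_derive_cst (1 : R) x 1) (is_derive_id x (1 : R)); rewrite add0r. Qed.

(** The pair [S], [T] is later [sin], [cos] or [- cos], [sin], so one computation gives both
    components of the transform. The primitive used below comes from one integration by parts. *)
Lemma tent_half_right :
  \int[leb]_(w in `[0, 1]) ((1 - w) * T (c * w)) =
  - T c / c ^+ 2 - S 0 / c + T 0 / c ^+ 2.
Proof.
have cf : continuous (fun w : R => (1 - w) * T (c * w)).
  by move=> x; apply: cvgM; [apply: cvgB; [exact: cvg_cst|exact: cvg_id]|exact: cT].
have dF x : is_derive x (1 : R)
    (fun w : R => c^-1 *: ((1 - w) * S (c * w)) - (c ^- 2) *: T (c * w)) ((1 - x) * T (c * x)).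
  apply: (is_derive_eq (is_deriveB (is_deriveZ c^-1 (is_deriveM (d1B x) (dSc x)))
    (is_deriveZ (c ^- 2) (dTc x)))); by rewrite /GRing.scale/=; field.
rewrite (FTC2_global ltr01 cf dF) !mulr1 !mulr0 subrr mul0r subr0 mul1r /GRing.scale/=.
by field.
Qed.

Lemma tent_half_left :
  \int[leb]_(w in `[-1, 0]) ((1 + w) * T (c * w)) =
  S 0 / c + T 0 / c ^+ 2 - T (- c) / c ^+ 2.
Proof.
have cf : continuous (fun w : R => (1 + w) * T (c * w)).
  by move=> x; apply: cvgM; [apply: cvgD; [exact: cvg_cst|exact: cvg_id]|exact: cT].
have dF x : is_derive x (1 : R)
    (fun w : R => c^-1 *: ((1 + w) * S (c * w)) + (c ^- 2) *: T (c * w)) ((1 + x) * T (c * x)).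
  apply: (is_derive_eq (is_deriveD (is_deriveZ c^-1 (is_deriveM (d1D x) (dSc x)))
    (is_deriveZ (c ^- 2) (dTc x)))); by rewrite /GRing.scale/=; field.
rewrite (FTC2_global (ltrN10 R) cf dF) !mulrN1 !mulr0 subrr mul0r addr0 mul1r /GRing.scale/=.
by field.
Qed.

Lemma Rintegral_tent : \int[leb]_w (tent w * T (c * w)) =
  (2 * T 0 - T c - T (- c)) / c ^+ 2.
Proof.
have cf1 : continuous (fun w : R => (1 - w) * T (c * w)).
  by move=> x; apply: cvgM; [apply: cvgB; [exact: cvg_cst|exact: cvg_id]|exact: cT].
have cf2 : continuous (fun w : R => (1 + w) * T (c * w)).
  by move=> x; apply: cvgM; [apply: cvgD; [exact: cvg_cst|exact: cvg_id]|exact: cT].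
have i1 : leb.-integrable `[0, 1] (EFin \o (fun w : R => (1 - w) * T (c * w))).
  by apply: continuous_compact_integrable; [exact: segment_compact|exact: continuous_subspaceT].
have i2 : leb.-integrable `[-1, 0] (EFin \o (fun w : R => (1 + w) * T (c * w))).
  by apply: continuous_compact_integrable; [exact: segment_compact|exact: continuous_subspaceT].
(* Without the endpoint 0 the two pieces are disjoint, so their restrictions to the line add up to
   the tent. *)
have i1' : leb.-integrable `]0, 1] (EFin \o (fun w : R => (1 - w) * T (c * w))).
  apply: integrableS i1 => //.
  by move=> x; rewrite /= !in_itv/= => /andP[/ltW -> ->].
rewrite (_ : (2 * T 0 - _ - _) / _ = (- T c / c ^+ 2 - S 0 / c + T 0 / c ^+ 2) +
  (S 0 / c + T 0 / c ^+ 2 - T (- c) / c ^+ 2)); last by field.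
rewrite -tent_half_right -tent_half_left.
rewrite -Rintegral_itv_obnd_cbnd// [X in _ = X + _]Rintegral_mkcond [X in _ = _ + X]Rintegral_mkcond.
rewrite -RintegralD//.
- apply: eq_Rintegral => w _; rewrite /patch/= !mem_setE !in_itv/=.
  have [w0|w0] := ltP 0 w => /=.
    rewrite andbF addr0.
    have [w1|w1] := leP w 1; first by rewrite /tent gtr0_norm// (elimT max_idPr _)// subr_ge0.
    by rewrite /tent gtr0_norm// (elimT max_idPl _) ?mul0r// subr_le0 ltW.
  rewrite andbT add0r /tent ler0_norm// opprK.
  have [w1|w1] := leP (-1) w; first by rewrite (elimT max_idPr _)// -lerBlDl sub0r.
  by rewrite (elimT max_idPl _) ?mul0r// -lerBrDl sub0r ltW.
- rewrite -restrict_EFin; have mI : measurable (`]0, 1]%classic : set mR) by exact: measurable_itv.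
  exact: ((integrable_mkcond _ mI).1 i1').
- rewrite -restrict_EFin; have mI : measurable (`[-1, 0]%classic : set mR) by exact: measurable_itv.
  exact: ((integrable_mkcond _ mI).1 i2).
Qed.

End tent_transform.

(* The Fejer kernel: it is nonnegative and decays like <v>^-2, so it is
   integrable with nonzero integral. *)
Definition tentF (v : R) : R[i] :=
  cint leb (fun w : mR => Complex (tent w) 0 * cis (2 * pi * v * w)).

Lemma tentF_Re v : Re (tentF v) = \int[leb]_w (tent w * cos (2 * pi * v * w)).
Proof. by apply: eq_Rintegral => w _; rewrite Re_mulc/= mul0r subr0. Qed.

Lemma tentF_Im v : Im (tentF v) = \int[leb]_w (tent w * sin (2 * pi * v * w)).
Proof. by apply: eq_Rintegral => w _; rewrite Im_mulc/= mul0r addr0. Qed.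

(** The right side is the square of sin(pi v)/(pi v). In this form nonnegativity and decay are read
    off from -1 <= cos <= 1. *)
Lemma tentF_Re_neq0 v : v != 0 ->
  Re (tentF v) = 2 * (1 - cos (2 * pi * v)) / (2 * pi * v) ^+ 2.
Proof.
move=> v0; rewrite tentF_Re.
rewrite (@Rintegral_tent sin cos (@is_derive_sin R) (@is_derive_cos R)); last first.
  by rewrite !mulf_neq0// gt_eqF// pi_gt0.
by rewrite cos0 cosN; congr (_ / _); ring.
Qed.

Lemma tentF_Im0 v : Im (tentF v) = 0.
Proof.
rewrite tentF_Im; have [->|v0] := eqVneq v 0.
  under eq_Rintegral do rewrite mulr0 mul0r sin0 mulr0.
  by rewrite /Rintegral integral0.
have dNcos x : is_derive x (1 : R) (- cos) (sin x).
  by apply: (is_derive_eq (is_deriveN (is_derive_cos x))); rewrite opprK.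
have dsin x : is_derive x (1 : R) sin (- (- cos) x).
  by apply: (is_derive_eq (is_derive_sin x)); rewrite /= opprK.
rewrite (@Rintegral_tent (- cos) sin dNcos dsin); last first.
  by rewrite !mulf_neq0// gt_eqF// pi_gt0.
by rewrite sin0 sinN mulr0 sub0r opprK addNr mul0r.
Qed.

Lemma tentF_Re_ge0 v : 0 <= Re (tentF v).
Proof.
have [->|v0] := eqVneq v 0.
  rewrite tentF_Re; apply: Rintegral_ge0 => w _.
  by rewrite mulr0 mul0r cos0 mulr1 tent_ge0.
by rewrite tentF_Re_neq0// divr_ge0 ?sqr_ge0// mulr_ge0// subr_ge0 cos_le1.
Qed.

Lemma cmeas_tent_cis v : cmeas (fun w : mR => Complex (tent w) 0 * cis (2 * pi * v * w)).
Proof.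
apply: cmeasM; first exact: cmeas_real measurable_tent.
by apply: cmeas_cis; exact: measurable_funM.
Qed.

Lemma cintegr_tent_cis v : cintegr leb (fun w : mR => Complex (tent w) 0 * cis (2 * pi * v * w)).
Proof.
apply: (cintegr_le (cmeas_tent_cis v) _ integr_tent) => w.
by rewrite mulrC ComplexField.Normc.normcM normc_cis mul1r normc_real ger0_norm ?tent_ge0.
Qed.

Definition tent_mass : R := \int[leb]_w tent w.

Lemma normc_tentF_le v : normc (tentF v) <= tent_mass.
Proof.
apply: le_trans (normc_cint_le (cintegr_tent_cis v)) _.
apply: le_Rintegral => //; [exact: cintegr_norm (cintegr_tent_cis v)|exact: integr_tent|].
by move=> w _; rewrite mulrC ComplexField.Normc.normcM normc_cis mul1r normc_real ger0_norm ?tent_ge0.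
Qed.

Lemma tentF_decay v : normc (tentF v) <= (tent_mass + 1) * jap v `^ (- 2).
Proof.
rewrite jap_powRN2 ler_pdivlMr; last by rewrite ltr_pwDl// sqr_ge0.
(* Of the factor 1 + v^2, the 1 is paid by the mass and v^2 by 2 (1 - cos) <= 4 <= (2 pi)^2. *)
rewrite mulrDr mulr1 lerD ?normc_tentF_le//.
have [->|v0] := eqVneq v 0; first by rewrite expr0n mulr0.
rewrite normcE_sqrt tentF_Im0 expr0n addr0 sqrtr_sqr ger0_norm ?tentF_Re_ge0// tentF_Re_neq0//.
rewrite mulrAC ler_pdivrMr ?mul1r; last by rewrite exprn_even_gt0//= !mulf_neq0// gt_eqF// pi_gt0.
have := @pi_ge2 R; have := cos_geN1 (2 * pi * v); have : 0 < v ^+ 2 by rewrite exprn_even_gt0.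
rewrite !exprMn.
set c := cos _; set p := pi; set q := v ^+ 2 => q0 c1 p2.
have : 1 <= p ^+ 2 by rewrite exprn_ege1//; lra.
nra.
Qed.

Lemma cmeas_tentF : cmeas (tentF : mR -> R[i]).
Proof.
have mF : cmeas (fun p : mR * mR => Complex (tent p.2) 0 * cis (2 * pi * p.1 * p.2)).
  apply: cmeasM; first exact: (cmeas_comp (cmeas_real measurable_tent) measurable_snd).
  by apply: cmeas_cis; apply: measurable_funM => //; exact: measurable_funM.
exact: (cmeas_cint1 leb mF).
Qed.

Lemma cintegr_tentF : cintegr leb (tentF : mR -> R[i]).
Proof.
have p1 : 1 < 2 :> R by rewrite ltr1n.
exact: (cintegr_le cmeas_tentF tentF_decay (integrZ _ (integr_jap p1))).
Qed.

(** The real part is nonnegative, so a lower bound on one interval is enough. For 1/4 <= v <= 1/2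
    the cosine is nonpositive, hence the value is at least 2/(2 pi v)^2 >= 2/pi^2. *)
Lemma cint_tentF_neq0 : cint leb (tentF : mR -> R[i]) != 0.
Proof.
suff : Re (cint leb (tentF : mR -> R[i])) != 0 by apply: contra => /eqP ->.
pose I : set mR := `[(4^-1 : R), 1 / 2]%classic.
have mI : measurable I by exact: measurable_itv.
have vI : \int[leb]_x \1_I x = 1 / 4 :> R.
  have LI : leb I = (1 / 4)%:E.
    by rewrite lebesgue_measure_itv/= lte_fin ifT -?EFinB; [congr EFin; lra|lra].
  by rewrite /Rintegral integral_indic// setIT; change (fine (leb I) = 1 / 4); rewrite LI.
have iI : integr leb (\1_I : mR -> R).
  by apply: integrable_indic_itv.
rewrite gt_eqF//; change (0 < \int[leb]_v Re (tentF v)).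
apply: (@lt_le_trans _ _ (\int[leb]_v ((2 / pi ^+ 2) * \1_I v))).
  by rewrite RintegralZl// vI !mulr_gt0// invr_gt0 exprn_gt0// pi_gt0.
apply: le_Rintegral => //; [exact: integrZ|by case: cintegr_tentF|].
move=> v _; rewrite indicE; case: (boolP (v \in I)) => [|_]; last by rewrite mulr0 tentF_Re_ge0.
rewrite inE {1}/I => vI'; have /andP[v1 v2] : 4^-1 <= v <= 1 / 2 by move: vI'; rewrite /= in_itv.
rewrite mulr1.
have v0 : 0 < v by lra.
have pv : 0 < (2 * pi * v) ^+ 2 by rewrite exprn_gt0// !mulr_gt0// pi_gt0.
rewrite tentF_Re_neq0 ?gt_eqF// ler_pdivlMr// mulrAC ler_pdivrMr ?exprn_gt0 ?pi_gt0//.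
have c0 : cos (2 * pi * v) <= 0.
  have := @pi_gt0 R => p0.
  rewrite -[2 * pi * v](subrK (pi / 2)) cosDpihalf oppr_le0 sin_ge0_pi//.
  by apply/andP; split; nra.
rewrite !exprMn; have P0 : 0 <= (pi : R) ^+ 2 by rewrite exprn_ge0// pi_ge0.
have v4 : 0 <= 1 - 4 * v ^+ 2 by nra.
have h1 := mulr_ge0 v4 P0.
have h2 : 0 <= - cos (2 * pi * v) * pi ^+ 2 by rewrite mulr_ge0// oppr_ge0.
by lra.
Qed.

End tent.

Section phase_bilinear.
Context {R : realType}.
Implicit Types (x y z : R * R).

Lemma phaseDl x y z : phase (x + y) z = phase x z + phase y z.
Proof. by rewrite /phase/=; ring. Qed.

Lemma phaseNl x z : phase (- x) z = - phase x z.
Proof. by rewrite /phase/=; ring. Qed.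

Lemma phaseDr x y z : phase x (y + z) = phase x y + phase x z.
Proof. by rewrite /phase/=; ring. Qed.

Lemma phaseNr x z : phase x (- z) = - phase x z.
Proof. by rewrite /phase/=; ring. Qed.

End phase_bilinear.

(** * Approximate Fourier inversion on the plane *)

Section fejer_plane.
Context {R : realType}.
Local Notation mR := (measurableTypeR R).
Local Notation leb := (@lebesgue_measure R).
Local Notation leb2 := (plane_measure R).

Lemma cint_prod (a b : mR -> R[i]) : cintegr leb a -> cintegr leb b ->
  cint leb2 (fun w : mR * mR => a w.1 * b w.2) = cint leb a * cint leb b.
Proof.
move=> ca cb.
have mab : cmeas (fun w : mR * mR => a w.1 * b w.2).
  by apply: cmeasM; [exact: (cmeas_comp (cintegr_meas ca) measurable_fst)
    |exact: (cmeas_comp (cintegr_meas cb) measurable_snd)].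
have dom x y : normc (a x * b y) <= normc (a x) * normc (b y).
  by rewrite ComplexField.Normc.normcM.
transitivity (cint leb (fun x => cint leb (fun y => a x * b y))).
  exact: (esym (cfubini1 (cintegr_norm ca) (cintegr_norm cb) mab dom)).
rewrite (eq_cint _ (fun x => cintZ (a x) cb)).
rewrite (eq_cint _ (fun x => mulrC (a x) (cint leb b))).
by rewrite cintZ// mulrC.
Qed.

Definition tent2 (w : R * R) : R := tent w.1 * tent w.2.

Lemma tent2_ge0 w : 0 <= tent2 w.
Proof. by rewrite mulr_ge0// tent_ge0. Qed.

Lemma tent2_le1 w : tent2 w <= 1.
Proof. by rewrite mulr_ile1 ?tent_ge0 ?tent_le1. Qed.

Lemma integr_tent2 : integr leb2 (tent2 : mR * mR -> R).
Proof. exact: (integr_prod integr_tent integr_tent). Qed.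

Definition fejer (v : R * R) : R[i] := tentF v.1 * tentF v.2.

Lemma cintegr_fejer : cintegr leb2 (fejer : mR * mR -> R[i]).
Proof.
have mF : cmeas (fejer : mR * mR -> R[i]).
  by apply: cmeasM; [exact: (cmeas_comp cmeas_tentF measurable_fst)
    |exact: (cmeas_comp cmeas_tentF measurable_snd)].
have h := integr_prod (cintegr_norm (@cintegr_tentF R)) (cintegr_norm (@cintegr_tentF R)).
apply: (cintegr_le mF _ h) => z.
by rewrite ComplexField.Normc.normcM.
Qed.

Lemma cint_fejer_neq0 : cint leb2 (fejer : mR * mR -> R[i]) != 0.
Proof.
by rewrite (cint_prod cintegr_tentF cintegr_tentF) mulf_neq0// cint_tentF_neq0.
Qed.

Lemma fejerE v :
  fejer v = cint leb2 (fun w : mR * mR => Complex (tent2 w) 0 * cis (phase v w)).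
Proof.
rewrite /fejer /tentF -cint_prod; [|exact: cintegr_tent_cis..].
apply: eq_cint => w; rewrite mulrACA -cisD; congr (_ * _).
  by apply/eqP; rewrite eq_complex/= /tent2 !(mulr0, mul0r, subr0, addr0) !eqxx.
by congr cis; rewrite /phase; ring.
Qed.

(** A frequency cutoff at scale [l]. Being integrable, it justifies Fubini with no appeal to
    integrability of the transform of [f]. *)
Definition tent2s (l : R) (w : R * R) : R := tent2 (l^-1 * w.1, l^-1 * w.2).

Lemma tent2s_ge0 l w : 0 <= tent2s l w. Proof. exact: tent2_ge0. Qed.
Lemma tent2s_le1 l w : tent2s l w <= 1. Proof. exact: tent2_le1. Qed.

Lemma integr_tent2s l : 0 < l -> integr leb2 (tent2s l : mR * mR -> R).
Proof.
move=> l0; have l1 : l^-1 != 0 by rewrite invr_eq0 gt_eqF.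
have := integr_affine2 0 0 l1 integr_tent2.
by congr (integr _ _); apply/funext => w; rewrite !addr0.
Qed.

Lemma normc_realM (t : R) (x : R[i]) : 0 <= t -> normc (Complex t 0 * x) = t * normc x.
Proof. by move=> t0; rewrite ComplexField.Normc.normcM normc_real ger0_norm. Qed.

Lemma measurable_phase2 : measurable_fun setT
  (fun p : (mR * mR) * (mR * mR) => phase p.1 p.2).
Proof.
apply: measurable_funM => //.
apply: measurable_funD; apply: measurable_funM.
- exact: (measurableT_comp measurable_fst measurable_fst).
- exact: (measurableT_comp measurable_fst measurable_snd).
- exact: (measurableT_comp measurable_snd measurable_fst).
- exact: (measurableT_comp measurable_snd measurable_snd).
Qed.

Lemma tent2s_transform l v : 0 < l ->
  cint leb2 (fun w : mR * mR => Complex (tent2s l w) 0 * cis (phase v w)) =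
  Complex (l ^+ 2) 0 * fejer (l * v.1, l * v.2).
Proof.
move=> l0; have ln0 : l != 0 by rewrite gt_eqF.
have mphase : measurable_fun setT (fun w : mR * mR => phase v w).
  by apply: measurable_funM => //; apply: measurable_funD; apply: measurable_funM => //.
have ci : cintegr leb2 (fun w : mR * mR => Complex (tent2s l w) 0 * cis (phase v w)).
  apply: (cintegr_le _ _ (integr_tent2s l0)).
    apply: cmeasM; last exact: cmeas_cis.
    exact: cmeas_real (integr_meas (integr_tent2s l0)).
  by move=> w; rewrite normc_realM ?tent2s_ge0// normcE_sqrt/= cos2Dsin2 sqrtr1 mulr1.
rewrite (cint_affine2 0 0 ln0 ci) fejerE; congr (_ * _).
apply: eq_cint => w; rewrite /tent2s/= !addr0 !mulKf//; case: w => w1 w2 /=.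
by congr (_ * cis _); rewrite /phase/=; ring.
Qed.

Section convolution.
Variables (f g : R * R -> R[i]) (zeta : R * R).
Hypotheses (sf : schwartz f) (sg : schwartz g).

Let cf : cintegr leb2 (f : mR * mR -> R[i]) := schwartz_cintegr sf.
Let cg : cintegr leb2 (g : mR * mR -> R[i]) := schwartz_cintegr sg.

Let MF := \int[leb2]_y normc (f y).

Let FMF z : normc (fourier f z) <= MF.
Proof.
apply: le_trans (normc_cint_le (cintegr_character z cf)) _.
by under eq_Rintegral do rewrite normc_cisM.
Qed.

(** Fubini moves the cutoff onto the characters, where its transform is a rescaled Fejer kernel. The
    substitution x = y - u/l then cancels the factor l^2 and leaves a weighted integral of [f] that
    concentrates near y as l grows. *)
Lemma mollified_inversion l y : 0 < l ->
  cint leb2 (fun w : mR * mR => Complex (tent2s l w) 0 * fourier f w * cis (phase y w)) =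
  cint leb2 (fun u : mR * mR => f (y - l^-1 *: (u : R * R)) * fejer u).
Proof.
move=> l0; have ln0 : - l^-1 != 0 by rewrite oppr_eq0 invr_eq0 gt_eqF.
have it := integr_tent2s l0.
pose H (p : (mR * mR) * (mR * mR)) : R[i] :=
  Complex (tent2s l p.1) 0 * cis (phase y p.1) * (cis (- phase p.2 p.1) * f p.2).
have mH : cmeas H.
  apply: cmeasM; apply: cmeasM.
  - exact: (cmeas_comp (cmeas_real (integr_meas it)) measurable_fst).
  - apply: cmeas_cis; apply: measurable_funM => //.
    apply: measurable_funD; apply: measurable_funM => //.
    + exact: (measurableT_comp measurable_fst measurable_fst).
    + exact: (measurableT_comp measurable_snd measurable_fst).
  - apply: cmeas_cis; apply: measurable_funN.
    have sw : measurable_fun setT (fun p : (mR * mR) * (mR * mR) => (p.2, p.1)).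
      exact: measurable_swap.
    exact: (measurableT_comp measurable_phase2 sw).
  - exact: (cmeas_comp (cintegr_meas cf) measurable_snd).
have dH x z : normc (H (x, z)) <= tent2s l x * normc (f z).
  by rewrite /H/= -mulrA normc_realM ?tent2s_ge0// !normc_cisM.
transitivity (cint leb2 (fun w => cint leb2 (fun x => H (w, x)))).
  apply: eq_cint => w; rewrite fourierE /H/=.
  rewrite [RHS](cintZ _ (cintegr_character w cf)).
  by rewrite mulrAC.
rewrite (cfubini it (cintegr_norm cf) mH dH).
pose G (x : mR * mR) := f x * (Complex (l ^+ 2) 0 * fejer (l * (y - x).1, l * (y - x).2)).
transitivity (cint leb2 G).
  apply: eq_cint => x; rewrite /G -tent2s_transform//.
  rewrite -cintZ; last first.
    apply: (cintegr_le _ _ it).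
      apply: cmeasM; first exact: cmeas_real (integr_meas it).
      apply: cmeas_cis; apply: measurable_funM => //; apply: measurable_funD; exact: measurable_funM.
    by move=> w; rewrite normc_realM ?tent2s_ge0// normcE_sqrt/= cos2Dsin2 sqrtr1 mulr1.
  apply: eq_cint => w; rewrite /H/= phaseDl phaseNl cisD.
  by rewrite [RHS]mulrC -!mulrA.
have cG : cintegr leb2 G.
  apply: (cintegr_le _ _ (integrZ (l ^+ 2 * tent_mass ^+ 2) (cintegr_norm cf))).
  - apply: cmeasM; first exact: cintegr_meas cf.
    apply: cmeasM; first exact: cmeas_cst.
    apply: (cmeas_comp (cintegr_meas cintegr_fejer)).
    by apply/measurable_fun_pairP; split => /=; apply: measurable_funM => //; exact: measurable_funB.
  - move=> x; rewrite /G mulrC ComplexField.Normc.normcM normc_realM ?sqr_ge0//.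
    rewrite ler_wpM2r ?normc_ge0// ler_wpM2l ?sqr_ge0//.
    by rewrite ComplexField.Normc.normcM expr2 ler_pM ?normc_ge0 ?normc_tentF_le.
rewrite (cint_affine2 y.1 y.2 ln0 cG).
rewrite -cintZ; last exact: (cintegr_affine2 y.1 y.2 ln0 cG).
apply: eq_cint => u; rewrite /G/=.
have -> : (- l^-1 * u.1 + y.1, - l^-1 * u.2 + y.2) = y - l^-1 *: (u : R * R).
  by case: u => u1 u2; case: (y) => y1 y2; congr (_, _); rewrite /= mulNr addrC.
have -> : (l * (y.1 - (- l^-1 * u.1 + y.1)), l * (y.2 - (- l^-1 * u.2 + y.2))) = u.
  by case: u => u1 u2; congr (_, _) => /=; field; rewrite gt_eqF.
rewrite mulrCA; congr (_ * _); rewrite mulrA.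
have -> : Complex ((- l^-1) ^+ 2) 0 * Complex (l ^+ 2) 0 = 1 :> R[i].
  apply/eqP; rewrite eq_complex/= !(mulr0, mul0r, subr0, addr0) eqxx andbT.
  by rewrite sqrrN exprVn mulVf// expf_neq0// gt_eqF.
by rewrite mul1r.
Qed.

(** Expanding the transform of [g] produces the character of y at w - zeta. Its w part completes the
    mollified inversion of [f] at y; its zeta part is the character that defines the transform of
    the product. *)
Lemma regularized_convolution l :  0 < l ->
  cint leb2 (fun w : mR * mR => Complex (tent2s l w) 0 * fourier f w *
    conjc (fourier g ((w : R * R) - zeta))) =
  cint leb2 (fun y : mR * mR => cis (- phase y zeta) * conjc (g y) *
    cint leb2 (fun u : mR * mR => f ((y : R * R) - l^-1 *: (u : R * R)) * fejer u)).
Proof.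
move=> l0; have it := integr_tent2s l0.
pose H (p : (mR * mR) * (mR * mR)) : R[i] :=
  Complex (tent2s l p.1) 0 * fourier f p.1 * (cis (phase p.2 p.1) * (cis (- phase p.2 zeta) * conjc (g p.2))).
have mF := cmeas_fourier (cintegr_meas cf).
have msw : measurable_fun setT (fun p : (mR * mR) * (mR * mR) => (p.2, p.1)) by exact: measurable_swap.
have mH : cmeas H.
  apply: cmeasM; apply: cmeasM.
  - exact: (cmeas_comp (cmeas_real (integr_meas it)) measurable_fst).
  - exact: (cmeas_comp mF measurable_fst).
  - by apply: cmeas_cis; exact: (measurableT_comp measurable_phase2 msw).
  - apply: cmeasM; first exact: (cmeas_comp (cmeas_character zeta) measurable_snd).
    exact: (cmeas_comp (cmeas_conj (cintegr_meas cg)) measurable_snd).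
have dH x z : normc (H (x, z)) <= (MF * tent2s l x) * normc (g z).
  rewrite /H/= ComplexField.Normc.normcM normc_realM ?tent2s_ge0// !normc_cisM normc_conj.
  by rewrite ler_wpM2r ?normc_ge0// mulrC ler_wpM2r ?tent2s_ge0.
transitivity (cint leb2 (fun w => cint leb2 (fun y => H (w, y)))).
  apply: eq_cint => w; rewrite [fourier g _]fourierE -cint_conj; last exact: cintegr_character.
  rewrite -cintZ; last first.
    apply: (cintegr_le _ _ (cintegr_norm cg)).
      by apply: cmeas_conj; apply: cmeasM; [exact: cmeas_character|exact: cintegr_meas cg].
    by move=> y; rewrite normc_conj normc_cisM.
  apply: eq_cint => y; rewrite /H /fst /snd conjcM conjc_cis opprK phaseDr phaseNr cisD.
  by rewrite -!mulrA.
rewrite (cfubini (integrZ MF it) (cintegr_norm cg) mH dH).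
apply: eq_cint => y; rewrite -mollified_inversion//.
rewrite -cintZ; last first.
  apply: (cintegr_le _ _ (integrZ MF it)).
  - apply: cmeasM; first by apply: cmeasM => //; exact: cmeas_real (integr_meas it).
    by apply: cmeas_cis; apply: measurable_funM => //; apply: measurable_funD; exact: measurable_funM.
  - move=> w; rewrite mulrC normc_cisM normc_realM ?tent2s_ge0// mulrC.
    by rewrite ler_wpM2r ?tent2s_ge0.
by apply: eq_cint => w; rewrite /H /fst /snd; ring.
Qed.

Let B := \int[leb2]_u normc (fejer (u : mR * mR)).

(** Joint measurability is what makes the integral over the second variable measurable in the
    first. *)
Lemma cmeas_scaled_shift (h : R) : cmeas (fun p : (mR * mR) * (mR * mR) =>
  f ((p.1 : R * R) - h *: (p.2 : R * R)) * fejer p.2).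
Proof.
apply: cmeasM; last exact: (cmeas_comp (cintegr_meas cintegr_fejer) measurable_snd).
apply: (cmeas_comp (cintegr_meas cf)).
apply/measurable_fun_pairP; split => /=; apply: measurable_funB.
- exact: (measurableT_comp measurable_fst measurable_fst).
- by apply: measurable_funM => //; exact: (measurableT_comp measurable_fst measurable_snd).
- exact: (measurableT_comp measurable_snd measurable_fst).
- by apply: measurable_funM => //; exact: (measurableT_comp measurable_snd measurable_snd).
Qed.

Lemma normc_schwartz_bounded : exists2 M, 0 <= M & forall y, normc (f y) <= M.
Proof.
have [M M0 fM] := schwartz_le_K2 sf; exists M => // y.
apply: le_trans (fM y) _; rewrite ler_piMr//.
by rewrite K2E invf_le1 ?mulr_gt0 ?exprn_gt0 ?jap_gt0// mulr_ege1// exprn_ege1// jap_ge1.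
Qed.

Lemma cmeas_scaled_shift2 (h : R) y :
  cmeas (fun u : mR * mR => f ((y : R * R) - h *: (u : R * R)) * fejer u).
Proof.
apply: (cmeas_comp (cmeas_scaled_shift h) (h := fun u => (y, u))).
exact: measurable_pair1.
Qed.

(** Continuity of [f] at y gives pointwise convergence and its boundedness the majorant. Here
    [harmonic n] plays the role of 1/l with l = n + 1. *)
Lemma fejer_limit y :
  ccvg (fun n : nat => cint leb2 (fun u : mR * mR => f (y - (harmonic n : R) *: (u : R * R)) * fejer u))
    (f y * cint leb2 (fejer : mR * mR -> R[i])).
Proof.
have [M M0 fM] := normc_schwartz_bounded.
rewrite -cintZ; last exact: cintegr_fejer.
apply: (@cint_dct _ _ _ leb2 _ _ (fun u : mR * mR => M * normc (fejer u))).
- by move=> n; exact: cmeas_scaled_shift2.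
- by apply: cmeasM; [exact: cmeas_cst|exact: cintegr_meas cintegr_fejer].
- move=> u; apply: ccvgM; last exact: ccvg_cst.
  have ucvg : (fun n => y - (harmonic n : R) *: (u : R * R)) @ \oo --> y.
    rewrite -[X in _ --> X]subr0 -(scale0r (u : R * R)).
    by apply: cvgB; [exact: cvg_cst|apply: cvgZl; exact: cvg_harmonic].
  split.
    apply: (cvg_comp _ (fun z => Re (f z)) ucvg).
    exact: (differentiable_continuous (real_schwartz_diff sf.1 y)).
  apply: (cvg_comp _ (fun z => Im (f z)) ucvg).
  exact: (differentiable_continuous (real_schwartz_diff sf.2 y)).
- exact: integrZ (cintegr_norm cintegr_fejer).
- by move=> n u; rewrite ComplexField.Normc.normcM ler_wpM2r ?normc_ge0.
Qed.

(** A second dominated convergence, in y: the inner integrals are bounded by sup |f| times the L^1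
    norm of the kernel, uniformly in n, and [g] is integrable. *)
Lemma regularized_convolution_limit :
  ccvg (fun n : nat => cint leb2 (fun y : mR * mR => cis (- phase y zeta) * conjc (g y) *
    cint leb2 (fun u : mR * mR => f ((y : R * R) - (harmonic n : R) *: (u : R * R)) * fejer u)))
  (cint leb2 (fejer : mR * mR -> R[i]) * fourier (fun y => f y * conjc (g y)) zeta).
Proof.
have [M M0 fM] := normc_schwartz_bounded.
have mcg : cmeas (fun y : mR * mR => cis (- phase y zeta) * conjc (g y)).
  by apply: cmeasM; [exact: cmeas_character|exact: (cmeas_conj (cintegr_meas cg))].
have cfg : cintegr leb2 (fun y : mR * mR => f y * conjc (g y)).
  exact: (schwartz_cintegr (schwartzM sf (schwartz_conj sg))).
rewrite fourierE -cintZ; last exact: (cintegr_character zeta cfg).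
apply: (@cint_dct _ _ _ leb2 _ _ (fun y : mR * mR => M * B * normc (g y))).
- by move=> n; apply: cmeasM => //; exact: (cmeas_cint1 leb2 (cmeas_scaled_shift (harmonic n))).
- apply: cmeasM; first exact: cmeas_cst.
  by apply: cmeasM; [exact: cmeas_character|exact: cintegr_meas cfg].
- move=> y; rewrite (_ : _ * (_ * _) = cis (- phase y zeta) * conjc (g y) *
    (f y * cint leb2 (fejer : mR * mR -> R[i]))); last by ring.
  by apply: ccvgM; [exact: ccvg_cst|exact: fejer_limit].
- exact: integrZ (cintegr_norm cg).
- move=> n y; rewrite mulrC ComplexField.Normc.normcM normc_cisM normc_conj ler_wpM2r ?normc_ge0//.
  have ci : cintegr leb2 (fun u : mR * mR => f (y - (harmonic n : R) *: (u : R * R)) * fejer u).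
    apply: (cintegr_le (cmeas_scaled_shift2 (harmonic n) y) _ (integrZ M (cintegr_norm cintegr_fejer))).
    by move=> u; rewrite ComplexField.Normc.normcM ler_wpM2r ?normc_ge0.
  apply: le_trans (normc_cint_le ci) _.
  rewrite /B -RintegralZl//; last exact: cintegr_norm cintegr_fejer.
  apply: le_Rintegral => //; [exact: cintegr_norm ci|exact: integrZ (cintegr_norm cintegr_fejer)|].
  by move=> u _; rewrite ComplexField.Normc.normcM ler_wpM2r ?normc_ge0.
Qed.

Lemma regularized_convolution_le l : 0 < l ->
  ((normc (cint leb2 (fun w : mR * mR => Complex (tent2s l w) 0 * fourier f w *
    conjc (fourier g ((w : R * R) - zeta)))))%:E <=
   \int[leb2]_w (normc (fourier f w) * normc (fourier g ((w : R * R) - zeta)))%:E)%E.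
Proof.
move=> l0; have it := integr_tent2s l0.
have mF := cmeas_fourier (cintegr_meas cf).
have mG : cmeas (fun w : mR * mR => fourier g ((w : R * R) - zeta)).
  apply: (cmeas_comp (cmeas_fourier (cintegr_meas cg))).
  by apply/measurable_fun_pairP; split => /=; exact: measurable_funB.
have mH : cmeas (fun w : mR * mR => Complex (tent2s l w) 0 * fourier f w *
    conjc (fourier g ((w : R * R) - zeta))).
  apply: cmeasM; last exact: cmeas_conj.
  by apply: cmeasM => //; exact: cmeas_real (integr_meas it).
have HE w : normc (Complex (tent2s l w) 0 * fourier f w * conjc (fourier g (w - zeta))) =
    tent2s l w * (normc (fourier f w) * normc (fourier g (w - zeta))).
  by rewrite ComplexField.Normc.normcM normc_realM ?tent2s_ge0// normc_conj mulrA.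
have ci : cintegr leb2 (fun w : mR * mR => Complex (tent2s l w) 0 * fourier f w *
    conjc (fourier g ((w : R * R) - zeta))).
  apply: (cintegr_le mH _ (integrZ (MF * \int[leb2]_y normc (g y)) it)) => w.
  rewrite HE mulrC ler_wpM2r ?tent2s_ge0// ler_pM ?normc_ge0//.
  apply: le_trans (normc_cint_le (cintegr_character _ cg)) _.
  by under eq_Rintegral do rewrite normc_cisM.
apply: le_trans (normc_cint_lee ci) _.
apply: ge0_le_integral => //.
- by move=> w _; rewrite lee_fin normc_ge0.
- by apply/measurable_EFinP; exact: measurable_normc.
- by apply/measurable_EFinP; apply: measurable_funM; exact: measurable_normc.
- move=> w _; rewrite HE lee_fin ler_piMl ?tent2s_le1// mulr_ge0 ?normc_ge0//.
Qed.

End convolution.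

(* The value of the integral of the Fejer kernel is irrelevant: any nonzero value
   gives the Fourier inversion formula up to a constant. *)
Lemma normc_fourier_mul_conj_le :
  exists2 C : R, 0 < C & forall (f g : R * R -> R[i]), schwartz f -> schwartz g ->
  forall zeta, ((normc (fourier (fun y => f y * conjc (g y)) zeta))%:E <=
    C%:E * \int[leb2]_w (normc (fourier f w) * normc (fourier g ((w : R * R) - zeta)))%:E)%E.
Proof.
pose I := cint leb2 (fejer : mR * mR -> R[i]).
have I0 : 0 < normc I.
  rewrite lt_def normc_ge0 andbT; apply: contra cint_fejer_neq0 => /eqP.
  by move=> /ComplexField.Normc.eq0_normc h; apply/eqP; exact: h.
exists (normc I)^-1 => [|f g sf sg zeta]; first by rewrite invr_gt0.
rewrite -lee_pdivrMl ?invr_gt0// invrK.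
have := ccvg_normc (regularized_convolution_limit zeta sf sg).
rewrite -/I ComplexField.Normc.normcM => cv.
have le n : ((normc (cint leb2 (fun y : mR * mR => cis (- phase y zeta) * conjc (g y) *
    cint leb2 (fun u : mR * mR => f ((y : R * R) - (harmonic n : R) *: (u : R * R)) * fejer u))))%:E
   <= \int[leb2]_w (normc (fourier f w) * normc (fourier g ((w : R * R) - zeta)))%:E)%E.
  by rewrite -regularized_convolution// regularized_convolution_le.
(* The integral is taken in the extended reals; the limit is needed only when it is finite. *)
move: le; case: (\int[leb2]_w _)%E => [r| |] le.
- rewrite lee_fin; apply: (ler_cvg_to cv (cvg_cst r)).
  by apply: nearW => n; have := le n; rewrite lee_fin.
- by rewrite leey.
- by have := le 0%N; rewrite leeNy_eq.
Qed.

End fejer_plane.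

(** * The kernel estimate *)

Section kernel_pointwise.
Context {R : realType}.

Lemma powR_expR (x p : R) : 0 < x -> x `^ p = expR (p * ln x).
Proof. by move=> x0; rewrite /powR gt_eqF. Qed.

(* In the bounds of this section, X, S, A, B and E stand for <xi>,
   <tau + nu |xi| xi>, <xi1>, <xi1 - xi> and <tau + xi1^2 - (xi1 - xi)^2>.
   Taking logarithms turns each bound into a linear inequality. *)
Section exponents.
Variables (s s' a b : R).
Hypotheses (s0 : 0 <= s) (a0 : 0 <= a) (b0 : 0 <= b).
Hypotheses (e1 : 2 * s' + 1 <= 4 * s) (e2 : 1 + 2 * (s' - s) <= 4 * a).
Hypothesis (e3 : 2 + 2 * (s' - s) <= 4 * b).

Let ln_ge (x y : R) : 0 < x -> x <= y -> ln x <= ln y.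
Proof. by move=> x0 xy; rewrite ler_ln// posrE (lt_le_trans x0). Qed.

(** Both input weights count in full, leaving X to the power 1 + 2s' - 4s, nonpositive by [e1]. *)
Lemma weight_comparable (X A B S k : R) : 1 <= X -> 1 <= S -> 0 < k ->
  k * X <= A -> k * X <= B ->
  X `^ (1 + 2 * s') * S `^ (- (2 * a)) * A `^ (- (2 * s)) * B `^ (- (2 * s))
  <= k `^ (- (4 * s)).
Proof.
move=> X1 S1 k0 kA kB.
have h1 := e1.
have X0 : 0 < X := lt_le_trans ltr01 X1.
have S0 : 0 < S := lt_le_trans ltr01 S1.
have kX0 : 0 < k * X by rewrite mulr_gt0.
have A0 := lt_le_trans kX0 kA; have B0 := lt_le_trans kX0 kB.
have hA := ln_ge kX0 kA; have hB := ln_ge kX0 kB.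
have hX := ln_ge0 X1; have hS := ln_ge0 S1.
rewrite lnM ?posrE// in hA; rewrite lnM ?posrE// in hB.
rewrite !powR_expR// -!expRD ler_expR.
have p1 : 0 <= s * (ln A - ln k - ln X) by rewrite mulr_ge0//; lra.
have p2 : 0 <= s * (ln B - ln k - ln X) by rewrite mulr_ge0//; lra.
have p3 : 0 <= a * ln S by rewrite mulr_ge0.
have p4 : 0 <= (4 * s - 1 - 2 * s') * ln X by rewrite mulr_ge0//; lra.
lra.
Qed.

(** Only the larger input weight counts, and S gives X^(-4a); the remaining power 1 + 2s' - 2s - 4a
    is nonpositive by [e2]. *)
Lemma weight_output_modulation (X A B S k c : R) : 1 <= X -> 0 < k -> 0 < c ->
  c * X ^+ 2 <= S -> 1 <= A -> k * X <= B ->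
  X `^ (1 + 2 * s') * S `^ (- (2 * a)) * A `^ (- (2 * s)) * B `^ (- (2 * s))
  <= c `^ (- (2 * a)) * k `^ (- (2 * s)).
Proof.
move=> X1 k0 c0 cS A1 kB.
have h2 := e2.
have X0 : 0 < X := lt_le_trans ltr01 X1.
have A0 : 0 < A := lt_le_trans ltr01 A1.
have kX0 : 0 < k * X by rewrite mulr_gt0.
have cX0 : 0 < c * X ^+ 2 by rewrite mulr_gt0// exprn_gt0.
have S0 := lt_le_trans cX0 cS; have B0 := lt_le_trans kX0 kB.
have hS := ln_ge cX0 cS; have hB := ln_ge kX0 kB.
have hX := ln_ge0 X1; have hA := ln_ge0 A1.
rewrite expr2 !lnM ?posrE ?mulr_gt0// in hS; rewrite lnM ?posrE// in hB.
rewrite !powR_expR// -!expRD ler_expR.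
have p1 : 0 <= s * ln A by rewrite mulr_ge0.
have p2 : 0 <= s * (ln B - ln k - ln X) by rewrite mulr_ge0//; lra.
have p3 : 0 <= a * (ln S - ln c - 2 * ln X) by rewrite mulr_ge0//; lra.
have p4 : 0 <= (4 * a + 2 * s - 1 - 2 * s') * ln X by rewrite mulr_ge0//; lra.
lra.
Qed.

(** The power of X is 2 + 2s' - 2s - 4b, nonpositive by [e3], so A <= X allows X to be replaced by
    A. Together with A^(-2s) this is at most A^(1-4b) by [e1]. *)
Lemma weight_input_modulation (X A B S E k c : R) : 1 <= X -> 0 < k -> 0 < c ->
  1 <= S -> 1 <= A -> A <= X -> k * X <= B -> c * X ^+ 2 <= E ->
  X `^ (2 + 2 * s') * S `^ (- (2 * a)) * A `^ (- (2 * s)) * B `^ (- (2 * s)) * E `^ (- (2 * b))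
  <= c `^ (- (2 * b)) * k `^ (- (2 * s)) * A `^ (1 - 4 * b).
Proof.
move=> X1 k0 c0 S1 A1 AX kB cE.
have h1 := e1; have h3 := e3.
have X0 : 0 < X := lt_le_trans ltr01 X1.
have A0 : 0 < A := lt_le_trans ltr01 A1.
have S0 : 0 < S := lt_le_trans ltr01 S1.
have kX0 : 0 < k * X by rewrite mulr_gt0.
have cX0 : 0 < c * X ^+ 2 by rewrite mulr_gt0// exprn_gt0.
have E0 := lt_le_trans cX0 cE; have B0 := lt_le_trans kX0 kB.
have hE := ln_ge cX0 cE; have hB := ln_ge kX0 kB; have hAX := ln_ge A0 AX.
have hX := ln_ge0 X1; have hA := ln_ge0 A1; have hS := ln_ge0 S1.
rewrite expr2 !lnM ?posrE ?mulr_gt0// in hE; rewrite lnM ?posrE// in hB.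
rewrite !powR_expR// -!expRD ler_expR.
have p1 : 0 <= a * ln S by rewrite mulr_ge0.
have p2 : 0 <= s * (ln B - ln k - ln X) by rewrite mulr_ge0//; lra.
have p3 : 0 <= b * (ln E - ln c - 2 * ln X) by rewrite mulr_ge0//; lra.
have p4 : 0 <= (4 * b + 2 * s - 2 - 2 * s') * (ln X - ln A) by rewrite mulr_ge0//; lra.
have p5 : 0 <= (4 * s - 1 - 2 * s') * ln A by rewrite mulr_ge0//; lra.
lra.
Qed.

Lemma weight_low_frequency (X A B S : R) : 1 <= X -> X <= 2 -> 1 <= A -> 1 <= B -> 1 <= S ->
  X `^ (1 + 2 * s') * S `^ (- (2 * a)) * A `^ (- (2 * s)) * B `^ (- (2 * s))
  <= 2 `^ `|1 + 2 * s'|.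
Proof.
move=> X1 X2 A1 B1 S1.
have X0 : 0 < X := lt_le_trans ltr01 X1.
have A0 : 0 < A := lt_le_trans ltr01 A1.
have B0 : 0 < B := lt_le_trans ltr01 B1.
have S0 : 0 < S := lt_le_trans ltr01 S1.
have hX := ln_ge0 X1; have hA := ln_ge0 A1; have hB := ln_ge0 B1; have hS := ln_ge0 S1.
have h2 := ln_ge X0 X2.
rewrite !powR_expR// -!expRD ler_expR.
have p1 : 0 <= a * ln S by rewrite mulr_ge0.
have p2 : 0 <= s * ln B by rewrite mulr_ge0.
have p3 : 0 <= s * ln A by rewrite mulr_ge0.
(* The sign of 1 + 2s' is not known, hence the absolute value in the constant. *)
have p4 : (1 + 2 * s') * ln X <= `|1 + 2 * s'| * ln 2.
  apply: (@le_trans _ _ (`|1 + 2 * s'| * ln X)); first by rewrite ler_wpM2r// ler_norm.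
  by rewrite ler_wpM2l.
lra.
Qed.

End exponents.

Lemma jap_scale_le (e x y : R) : 0 <= e <= 1 -> e * `|y| <= `|x| -> e * jap y <= jap x.
Proof.
move=> /andP[e0 e1] h.
rewrite -(@ler_pXn2r _ 2)// ?nnegrE ?mulr_ge0 ?(ltW (jap_gt0 _))// exprMn !sqr_jap.
have : (e * `|y|) ^+ 2 <= x ^+ 2.
  by rewrite -[leRHS]real_normK ?num_real// ler_pXn2r// nnegrE mulr_ge0.
by rewrite exprMn real_normK ?num_real//; nra.
Qed.

Lemma jap_le (x y : R) : `|x| <= `|y| -> jap x <= jap y.
Proof.
by move=> h; have := @jap_scale_le 1 y x; rewrite !mul1r ler01 lexx; apply.
Qed.

Lemma jap_sub_le (x y : R) : jap (x - y) <= jap x + jap y.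
Proof.
rewrite -(@ler_pXn2r _ 2)// ?nnegrE ?addr_ge0 ?(ltW (jap_gt0 _))// sqrrD !sqr_jap.
have h1 := jap_ge_norm x; have h2 := jap_ge_norm y.
have h3 : `|x| * `|y| <= jap x * jap y by rewrite ler_pM.
have h4 : - (x * y) <= `|x| * `|y| by rewrite -normrM -normrN ler_norm.
lra.
Qed.

(* With D = tau + x^2 - (x - xi)^2 one has
   (tau + nu |xi| xi) - D = xi (nu |xi| + xi - 2 x)
                         = xi (nu |xi| - xi - 2 (x - xi)),
   so y is x (m = 1) or x - xi (m = -1). *)
Lemma nonresonant (nu xi y : R) (m : R) : m = 1 \/ m = -1 ->
  `|y| <= `| `|nu| - 1 | / 4 * `|xi| ->
  `| `|nu| - 1 | / 2 * xi ^+ 2 <= `|xi * (nu * `|xi| + m * xi - 2 * y)|.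
Proof.
move=> hm hy; set d := `| `|nu| - 1 |.
have hn : d * `|xi| <= `|nu * `|xi| + m * xi|.
  have h1 : d <= `|nu + 1| by have := ler_dist_dist nu (- 1); rewrite normrN1 opprK.
  have h2 : d <= `|nu - 1| by have := ler_dist_dist nu 1; rewrite normr1.
  have [x0|x0] := leP 0 xi.
    by rewrite (ger0_norm x0) -mulrDl normrM (ger0_norm x0) ler_wpM2r//; case: hm => ->.
  rewrite (ltr0_norm x0) (_ : nu * - xi + m * xi = (nu - m) * - xi); last by ring.
  rewrite normrM normrN (ltr0_norm x0) ler_wpM2r ?oppr_ge0 ?(ltW x0)//.
  by case: hm => ->; rewrite ?opprK.
have hd : d / 2 * `|xi| <= `|nu * `|xi| + m * xi - 2 * y|.
  have : `|nu * `|xi| + m * xi| <= `|nu * `|xi| + m * xi - 2 * y| + `|2 * y|.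
    by rewrite -{1}(subrK (2 * y) (nu * `|xi| + m * xi)) ler_normD.
  by rewrite normrM ger0_norm//; rewrite -/d in hy; lra.
rewrite normrM -[xi ^+ 2]real_normK ?num_real// expr2 mulrCA ler_wpM2l//.
Qed.

Lemma sqr_powR (x p : R) : (x `^ p) ^+ 2 = x `^ (2 * p).
Proof. by rewrite -powR_mulrn ?powR_ge0// -powRrM mulrC. Qed.

Lemma jap_powR_gt0 (x p : R) : 0 < jap x `^ p.
Proof. by rewrite powR_gt0// jap_gt0. Qed.

Section pointwise_bound.
Variables (nu s s' a b : R).
Hypotheses (hnu : `|nu| != 1).
Hypotheses (s0 : 0 <= s) (a0 : 0 <= a) (b0 : 0 <= b).
Hypotheses (e1 : 2 * s' + 1 <= 4 * s) (e2 : 1 + 2 * (s' - s) <= 4 * a).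
Hypothesis (e3 : 2 + 2 * (s' - s) <= 4 * b).

(** With t = |xi|, one power stays next to <D>^(-2b) as the Jacobian for the integration in xi1; the
    other is absorbed into <xi>. The variant below absorbs both, for the case of large D. *)
Let kernel_product (t X Xs S A B E : R) : 0 <= t -> t <= X -> 0 <= Xs -> 0 <= S ->
  0 <= A -> 0 <= B -> 0 <= E ->
  t ^+ 2 * Xs * S * A * B * E <= (X * Xs * S * A * B) * (t * E).
Proof.
move=> t0 tX Xs0 S0' A0 B0' E0.
have P0 : 0 <= Xs * S * A * B * (t * E) by rewrite !mulr_ge0.
have := ler_wpM2r P0 tX.
by congr (_ <= _); ring.
Qed.

Let kernel_product2 (t X Xs S A B E : R) : 0 <= t -> t <= X -> 0 <= Xs -> 0 <= S ->
  0 <= A -> 0 <= B -> 0 <= E ->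
  t ^+ 2 * Xs * S * A * B * E <= (X ^+ 2 * Xs) * S * A * B * E.
Proof.
move=> t0 tX Xs0 S0' A0 B0' E0.
have P0 : 0 <= Xs * S * A * B * E by rewrite !mulr_ge0.
have tX2 : t ^+ 2 <= X ^+ 2 by rewrite ler_pXn2r// nnegrE (le_trans t0).
have := ler_wpM2r P0 tX2.
by congr (_ <= _); ring.
Qed.

Let bound_by_first (L W Ci C t E p q : R) : L <= W * (t * E) -> W <= Ci -> Ci <= C ->
  0 <= C -> 0 <= t * E -> 0 <= p -> 0 <= q -> L <= C * (t * E + p + q).
Proof.
move=> LW WC CC C0 tE p0 q0; apply: (le_trans LW).
apply: (@le_trans _ _ (C * (t * E))).
  by apply: ler_wpM2r => //; exact: le_trans WC CC.
by apply: ler_wpM2l => //; rewrite -addrA lerDl addr_ge0.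
Qed.

(** One summand for each of the four weight bounds; a sum of nonnegative terms dominates each of
    them. *)
Let kernel_constant (e c : R) : R := e `^ (- (4 * s)) + c `^ (- (2 * a)) * e `^ (- (2 * s)) +
  c `^ (- (2 * b)) * e `^ (- (2 * s)) + 2 `^ `|1 + 2 * s'|.

Let kernel_cases (t X S A B E e c : R) : 0 <= t -> t <= X -> 1 <= X -> 1 <= S ->
  1 <= A -> 1 <= B -> 0 < E -> 0 < e -> 0 < c ->
  [\/ X <= 2, e * X <= A /\ e * X <= B,
      [/\ A <= X, e * X <= B & c * X ^+ 2 <= S \/ c * X ^+ 2 <= E] |
      [/\ B <= X, e * X <= A & c * X ^+ 2 <= S \/ c * X ^+ 2 <= E]] ->
  t ^+ 2 * X `^ (2 * s') * S `^ (- (2 * a)) * A `^ (- (2 * s)) * B `^ (- (2 * s)) *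
    E `^ (- (2 * b)) <=
  kernel_constant e c * (t * E `^ (- (2 * b)) + A `^ (1 - 4 * b) + B `^ (1 - 4 * b)).
Proof.
move=> t0 tX X1 S1 A1 B1 E0 e0 c0 hcases.
have X0 : 0 < X := lt_le_trans ltr01 X1.
have P0 (y p : R) : 0 <= y `^ p := powR_ge0 _ _.
have XD1 : X `^ (1 + 2 * s') = X * X `^ (2 * s').
  by rewrite powRD ?(lt0r_neq0 X0) ?implybT// powRr1// ltW.
have XD2 : X `^ (2 + 2 * s') = X ^+ 2 * X `^ (2 * s').
  by rewrite powRD ?(lt0r_neq0 X0) ?implybT// -powR_mulrn// ltW.
have LHS1 := kernel_product t0 tX (P0 X (2 * s')) (P0 S (- (2 * a))) (P0 A (- (2 * s)))
  (P0 B (- (2 * s))) (P0 E (- (2 * b))).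
have LHS2 := kernel_product2 t0 tX (P0 X (2 * s')) (P0 S (- (2 * a))) (P0 A (- (2 * s)))
  (P0 B (- (2 * s))) (P0 E (- (2 * b))).
rewrite -XD1 in LHS1; rewrite -XD2 in LHS2.
have tE : 0 <= t * E `^ (- (2 * b)) := mulr_ge0 t0 (P0 _ _).
have c1 := P0 e (- (4 * s)); have c2 := mulr_ge0 (P0 c (- (2 * a))) (P0 e (- (2 * s))).
have c3 := mulr_ge0 (P0 c (- (2 * b))) (P0 e (- (2 * s))); have c4 := P0 2 `|1 + 2 * s'|.
have C0 : 0 <= kernel_constant e c := addr_ge0 (addr_ge0 (addr_ge0 c1 c2) c3) c4.
have le1 : e `^ (- (4 * s)) <= kernel_constant e c.
  by rewrite /kernel_constant -!addrA lerDl !addr_ge0.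
have le2 : c `^ (- (2 * a)) * e `^ (- (2 * s)) <= kernel_constant e c.
  by rewrite /kernel_constant -addrA addrAC lerDr !addr_ge0.
have le3 : c `^ (- (2 * b)) * e `^ (- (2 * s)) <= kernel_constant e c.
  by rewrite /kernel_constant addrAC lerDr !addr_ge0.
have le4 : 2 `^ `|1 + 2 * s'| <= kernel_constant e c.
  by rewrite /kernel_constant lerDr !addr_ge0.
case: hcases => [X2|[eA eB]|[AX eB [cS|cE]]|[BX eA [cS|cE]]].
- exact: (bound_by_first LHS1 (weight_low_frequency s' s0 a0 X1 X2 A1 B1 S1) le4).
- exact: (bound_by_first LHS1 (weight_comparable s0 a0 e1 X1 S1 e0 eA eB) le1).
- exact: (bound_by_first LHS1 (weight_output_modulation s0 a0 e2 X1 e0 c0 cS A1 eB) le2).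
- apply: (le_trans LHS2); apply: (le_trans (weight_input_modulation s0 a0 b0 e1 e3 X1 e0 c0 S1 A1 AX eB cE)).
  apply: (@le_trans _ _ (kernel_constant e c * A `^ (1 - 4 * b))); first exact: ler_wpM2r.
  by apply: ler_wpM2l => //; rewrite addrAC lerDr addr_ge0.
(* The case of small B follows from the bounds for small A by exchanging the two input weights. *)
- rewrite (mulrAC (X `^ (1 + 2 * s') * S `^ _)) in LHS1.
  exact: (bound_by_first LHS1 (weight_output_modulation s0 a0 e2 X1 e0 c0 cS B1 eA) le2).
- rewrite (mulrAC (X `^ (2 + 2 * s') * S `^ _)) in LHS2.
  apply: (le_trans LHS2); apply: (le_trans (weight_input_modulation s0 a0 b0 e1 e3 X1 e0 c0 S1 B1 BX eA cE)).
  apply: (@le_trans _ _ (kernel_constant e c * B `^ (1 - 4 * b))); first exact: ler_wpM2r.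
  by apply: ler_wpM2l => //; rewrite lerDr addr_ge0.
Qed.

(** Since |xi| >= 1, d/2 xi^2 >= d/4 <xi>^2. This is at most |h| <= <sig> + <D>, so one of the two
    brackets carries half of it, whence d/8. *)
Let dichotomy (sig D xi y h e d : R) : e <= d / 4 -> 1 <= `|xi| -> 0 <= d ->
  `|y| <= e * `|xi| -> sig - D = h ->
  (`|y| <= d / 4 * `|xi| -> d / 2 * xi ^+ 2 <= `|h|) ->
  d / 8 * jap xi ^+ 2 <= jap sig \/ d / 8 * jap xi ^+ 2 <= jap D.
Proof.
move=> ed xi1 d0 hy eq hh.
have h1 := hh (le_trans hy (ler_wpM2r (normr_ge0 _) ed)).
have h2 : `|h| <= jap sig + jap D.
  by rewrite -eq (le_trans (ler_normB _ _))// lerD// jap_ge_norm.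
have h3 : jap xi ^+ 2 <= 2 * xi ^+ 2.
  rewrite sqr_jap -real_normK ?num_real//.
  have : 1 <= `|xi| ^+ 2 by rewrite exprn_ege1.
  lra.
have h4 : d / 8 * jap xi ^+ 2 <= d / 8 * (2 * xi ^+ 2) by rewrite ler_wpM2l// divr_ge0.
have [h5|h5] := lerP (d / 8 * jap xi ^+ 2) (jap sig); [by left|right].
clear hh eq hy ed; lra.
Qed.

Let small_frequency (e xi x : R) : 0 <= e -> e <= 1 / 2 -> `|x| <= e * `|xi| ->
  jap x <= jap xi /\ e * jap xi <= jap (x - xi).
Proof.
move=> e0 e12 hx; have xi0 := normr_ge0 xi.
have h1 : e * `|xi| <= 1 / 2 * `|xi| by rewrite ler_wpM2r.
split; first by apply: jap_le; lra.
apply: jap_scale_le; first by rewrite e0/=; lra.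
have : `|xi| <= `|x| + `|x - xi| by rewrite -{1}(subKr x xi) ler_normB.
lra.
Qed.

Lemma kernel_pointwise_bound : exists2 C : R, 0 < C & forall tau xi x : R,
  xi ^+ 2 * jap xi `^ (2 * s') * jap (tau + nu * `|xi| * xi) `^ (- (2 * a)) *
    jap x `^ (- (2 * s)) * jap (x - xi) `^ (- (2 * s)) *
    jap (tau + x ^+ 2 - (x - xi) ^+ 2) `^ (- (2 * b)) <=
  C * (`|xi| * jap (tau + x ^+ 2 - (x - xi) ^+ 2) `^ (- (2 * b)) +
    jap x `^ (1 - 4 * b) + jap (x - xi) `^ (1 - 4 * b)).
Proof.
pose d := `| `|nu| - 1 |.
have d0 : 0 < d by rewrite normr_gt0 subr_eq0.
(* The threshold for a small input frequency: [d / 4] makes [nonresonant] apply, and [1 / 2] ensures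
   that the other input frequency still dominates. *)
pose e := Num.min (d / 4) (1 / 2).
have e0 : 0 < e by rewrite lt_min !divr_gt0.
have ed : e <= d / 4 by rewrite ge_min lexx.
have e12 : e <= 1 / 2 by rewrite ge_min lexx orbT.
have e01 : 0 <= e <= 1 by rewrite ltW//= (le_trans e12)// ler_pdivrMr// mul1r ler1n.
have c0 : 0 < d / 8 by rewrite divr_gt0.
exists (kernel_constant e (d / 8)) => [|tau xi x].
  by rewrite /kernel_constant !addr_gt0 ?mulr_gt0 ?powR_gt0.
have -> : xi ^+ 2 = `|xi| ^+ 2 by rewrite real_normK ?num_real.
apply: kernel_cases => //; rewrite ?jap_ge1 ?jap_gt0 ?jap_ge_norm//.
have [xi1|xi1] := lerP `|xi| 1.
  by apply: Or41; apply: le_trans (jap_le1D xi) _; rewrite -[2 : R]/(1 + 1) lerD2l.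
have [hx|hx] := lerP `|x| (e * `|xi|).
  have [h1 h2] := small_frequency (ltW e0) e12 hx; apply: Or43; split => //.
  apply: (dichotomy ed (ltW xi1) (ltW d0) hx _ (nonresonant (or_introl erefl))); ring.
have [hx'|hx'] := lerP `|x - xi| (e * `|xi|).
  have hn : `|xi - x| <= e * `|xi| by rewrite distrC.
  have [h1 h2] := small_frequency (ltW e0) e12 hx'; apply: Or44; split => //.
    have [_] := small_frequency (ltW e0) e12 hn.
    by rewrite addrAC subrr sub0r /jap normrN.
  apply: (dichotomy ed (ltW xi1) (ltW d0) hx' _ (nonresonant (or_intror erefl))); ring.
by apply: Or42; split; apply: jap_scale_le => //; exact: ltW.
Qed.

(** The larger of <p> and <q> is at least <p - q>/2. With the two input modulations for p and q, p -
    q is free of tau1, so the first bracket leaves the tau1 integral and the other two are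
    integrable in tau1. *)
Lemma jap_convolution_pointwise (p q : R) :
  jap p `^ (- (2 * b)) * jap q `^ (- (2 * b)) <=
  2 `^ (2 * b) * jap (p - q) `^ (- (2 * b)) * (jap p `^ (- (2 * b)) + jap q `^ (- (2 * b))).
Proof.
have bb : 0 <= 2 * b by rewrite mulr_ge0.
have key (y z : R) : jap y <= jap z -> jap (p - q) <= jap p + jap q ->
    jap p + jap q = jap y + jap z ->
    jap z `^ (- (2 * b)) <= 2 `^ (2 * b) * jap (p - q) `^ (- (2 * b)).
  move=> yz h1 h2; rewrite !powRN ler_pdivlMr ?jap_powR_gt0// mulrC ler_pdivrMr ?jap_powR_gt0//.
  rewrite -powRM ?(ltW (jap_gt0 _))//; apply: ge0_ler_powR => //; rewrite ?nnegrE ?mulr_ge0 ?(ltW (jap_gt0 _))//.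
  by lra.
have h := jap_sub_le p q.
have [pq|qp] := lerP (jap p) (jap q).
  rewrite mulrC; apply: (@le_trans _ _ (2 `^ (2 * b) * jap (p - q) `^ (- (2 * b)) * jap p `^ (- (2 * b)))).
    by rewrite ler_wpM2r ?powR_ge0//; exact: key pq h _.
  by rewrite ler_wpM2l ?mulr_ge0 ?powR_ge0// lerDl powR_ge0.
apply: (@le_trans _ _ (2 `^ (2 * b) * jap (p - q) `^ (- (2 * b)) * jap q `^ (- (2 * b)))).
  by rewrite ler_wpM2r ?powR_ge0//; apply: key (ltW qp) h _; rewrite addrC.
by rewrite ler_wpM2l ?mulr_ge0 ?powR_ge0// lerDr powR_ge0.
Qed.

End pointwise_bound.

End kernel_pointwise.

(** * Uniform bound for the integral of the squared kernel *)

Section kernel_integral.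
Context {R : realType}.
Local Notation mR := (measurableTypeR R).
Local Notation leb := (@lebesgue_measure R).
Local Notation leb2 := (plane_measure R).

Definition weightX (s b : R) (z : R * R) : R :=
  jap z.2 `^ s * jap (z.1 + z.2 ^+ 2) `^ b.

Definition weightY (nu s' a : R) (z : R * R) : R :=
  jap z.2 `^ s' * jap (z.1 + nu * `|z.2| * z.2) `^ a.

Lemma weightX_gt0 s b z : 0 < weightX s b z.
Proof. by rewrite mulr_gt0// jap_powR_gt0. Qed.

Lemma weightY_gt0 nu s' a z : 0 < weightY nu s' a z.
Proof. by rewrite mulr_gt0// jap_powR_gt0. Qed.

Lemma measurable_jap_powR d (T : measurableType d) (p : R) (f : T -> R) :
  measurable_fun setT f -> measurable_fun setT (fun x => jap (f x) `^ p).
Proof.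
move=> mf; apply: (measurableT_comp (measurable_powR p)).
exact: (measurableT_comp (@measurable_jap R)).
Qed.

Lemma measurable_weightX s b : measurable_fun setT (weightX s b : mR * mR -> R).
Proof.
apply: measurable_funM; apply: measurable_jap_powR; first exact: measurable_snd.
by apply: measurable_funD => //; apply: measurable_funX; exact: measurable_snd.
Qed.

Lemma measurable_weightY nu s' a : measurable_fun setT (weightY nu s' a : mR * mR -> R).
Proof.
apply: measurable_funM; apply: measurable_jap_powR; first exact: measurable_snd.
apply: measurable_funD => //; apply: measurable_funM; last exact: measurable_snd.
apply: measurable_funM => //; apply: measurableT_comp; first exact: normr_measurable.
exact: measurable_snd.
Qed.

Lemma integral_jap_powR_shift (p c : R) :
  (\int[leb]_x (jap ((x : R) + c) `^ p)%:E = \int[leb]_x (jap (x : R) `^ p)%:E)%E.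
Proof.
rewrite [RHS](@ge0_integral_affine R 1 c (fun x => (jap (x : R) `^ p)%:E))//.
- by rewrite normr1 mul1e; apply: eq_integral => x _; rewrite mul1r.
- by apply/measurable_EFinP; exact: measurable_jap_powR.
- by move=> x; rewrite lee_fin powR_ge0.
Qed.

(** The substitution has Jacobian 2 |xi| >= |xi|, so the bound is uniform in the slope and the
    offset. At xi = 0 the substitution degenerates but the left side vanishes. *)
Lemma integral_jap_powR_slope (p xi c : R) :
  (\int[leb]_x (`|xi| * jap (2 * xi * (x : R) + c) `^ p)%:E <=
   \int[leb]_x (jap (x : R) `^ p)%:E)%E.
Proof.
have mj : measurable_fun setT (fun x : mR => (jap (x : R) `^ p)%:E).
  by apply/measurable_EFinP; exact: measurable_jap_powR.
have [->|xi0] := eqVneq xi 0.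
  under eq_integral do rewrite normr0 mul0r.
  by rewrite integral0; apply: integral_ge0 => x _; rewrite lee_fin powR_ge0.
have xi2 : 2 * xi != 0 by rewrite mulf_neq0.
rewrite [leRHS](@ge0_integral_affine R (2 * xi) c _ xi2 mj); last first.
  by move=> x; rewrite lee_fin powR_ge0.
under eq_integral do rewrite EFinM.
rewrite ge0_integralZl//; last 2 first.
- apply/measurable_EFinP; apply: measurable_jap_powR.
  by apply: measurable_funD => //; exact: measurable_funM.
- by move=> x _; rewrite lee_fin powR_ge0.
apply: lee_wpmul2r; first by apply: integral_ge0 => x _; rewrite lee_fin powR_ge0.
by rewrite lee_fin normrM ler_peMl// ger0_norm// ler1n.
Qed.

Section kernel.
Variables (nu s s' a b : R).
Hypotheses (hnu : `|nu| != 1).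
Hypotheses (s0 : 0 <= s) (a0 : 0 <= a) (b12 : 1 / 2 < b).
Hypotheses (e1 : 2 * s' + 1 <= 4 * s) (e2 : 1 + 2 * (s' - s) <= 4 * a).
Hypothesis (e3 : 2 + 2 * (s' - s) <= 4 * b).

(** The multiplier that remains once the weights of both inputs are moved into the functions. The
    sign in front of [a] reflects a = 1 - c'. *)
Definition bikernel (zeta w : R * R) : R :=
  `|zeta.2| * weightY nu s' (- a) zeta / (weightX s b w * weightX s b (w - zeta)).

Lemma bikernel_ge0 zeta w : 0 <= bikernel zeta w.
Proof.
by rewrite divr_ge0// mulr_ge0//; apply: ltW; rewrite ?weightX_gt0 ?weightY_gt0.
Qed.

Lemma measurable_weightX_shift (zeta : R * R) :
  measurable_fun setT (fun w : mR * mR => weightX s b ((w : R * R) - zeta)).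
Proof.
apply: (measurableT_comp (measurable_weightX s b)).
by apply/measurable_fun_pairP; split => /=; exact: measurable_funB.
Qed.

Lemma measurable_bikernel zeta : measurable_fun setT (bikernel zeta : mR * mR -> R).
Proof.
rewrite (_ : bikernel zeta = fun w => `|zeta.2| * weightY nu s' (- a) zeta *
    (weightX s b w * weightX s b (w - zeta)) `^ (- 1)); last first.
  apply/funext => w; rewrite /bikernel powR_inv1//.
  by apply: mulr_ge0; apply: ltW; exact: weightX_gt0.
apply: measurable_funM => //.
apply: (measurableT_comp (measurable_powR (- 1))).
apply: measurable_funM; first exact: measurable_weightX.
exact: measurable_weightX_shift.
Qed.

Let sqr_quotient (t X S A P B Q : R) : (t * (X * S) / ((A * P) * (B * Q))) ^+ 2 =
  t ^+ 2 * X ^+ 2 * S ^+ 2 * (A ^+ 2)^-1 * (B ^+ 2)^-1 * ((P ^+ 2)^-1 * (Q ^+ 2)^-1).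
Proof. by rewrite !(exprMn, exprVn, invfM); ring. Qed.

Lemma sqr_bikernel zeta w : bikernel zeta w ^+ 2 =
  zeta.2 ^+ 2 * jap zeta.2 `^ (2 * s') * jap (zeta.1 + nu * `|zeta.2| * zeta.2) `^ (- (2 * a)) *
  jap w.2 `^ (- (2 * s)) * jap (w.2 - zeta.2) `^ (- (2 * s)) *
  (jap (w.1 + w.2 ^+ 2) `^ (- (2 * b)) *
   jap (w.1 - zeta.1 + (w.2 - zeta.2) ^+ 2) `^ (- (2 * b))).
Proof.
have sq_inv (x p : R) : ((x `^ p) ^+ 2)^-1 = x `^ (- (2 * p)) by rewrite sqr_powR powRN.
apply: (etrans (sqr_quotient _ _ _ _ _ _ _)).
congr (_ * _ * _ * _ * _ * (_ * _)).
- exact: real_normK (num_real _).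
- exact: sqr_powR.
- by apply: (etrans (sqr_powR _ _)); rewrite mulrN.
- exact: sq_inv.
- exact: sq_inv.
- exact: sq_inv.
- exact: sq_inv.
Qed.

Lemma integral_sqr_bikernel_le : exists2 K : R, 0 < K & forall zeta,
  (\int[leb2]_w (bikernel zeta w ^+ 2)%:E <= K%:E)%E.
Proof.
have b0 : 0 <= b by apply: ltW; apply: lt_trans b12; rewrite divr_gt0.
have [C C0 hC] := kernel_pointwise_bound hnu s0 a0 b0 e1 e2 e3.
have b12' := b12.
(* Both follow from b > 1/2: the first makes the integral over a modulation or over D finite, the
   second the integral over the small input frequency. *)
have p1 : 1 < 2 * b by lra.
have p2 : 1 < 4 * b - 1 by lra.
have [J JE] : exists J : \bar R, J = (\int[leb]_x (jap (x : R) `^ (- (2 * b)))%:E)%E by eexists.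
have [J' J'E] : exists J : \bar R, J = (\int[leb]_x (jap (x : R) `^ (1 - 4 * b))%:E)%E by eexists.
have J0 : (0 <= J)%E by rewrite JE; apply: integral_ge0 => x _; rewrite lee_fin powR_ge0.
have J'0 : (0 <= J')%E by rewrite J'E; apply: integral_ge0 => x _; rewrite lee_fin powR_ge0.
have Jfin : J \is a fin_num by rewrite JE; exact: (integrable_fin_num measurableT (integr_jap p1)).
have J'fin : J' \is a fin_num.
  rewrite J'E; have := integrable_fin_num measurableT (integr_jap p2).
  by under [X in X \is a fin_num -> _]eq_integral do rewrite opprB.
have [c [c0 cE]] : exists c, 0 <= c /\ c = 2 `^ (2 * b) * C.
  by eexists; split; last reflexivity; rewrite mulr_ge0 ?powR_ge0// ltW.
have JJ0 : (0 <= J + J)%E by exact: adde_ge0.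
have JJJ0 : (0 <= J + J' + J')%E by apply: adde_ge0 => //; exact: adde_ge0.
have [K [K0 KE]] : exists K : R, 0 <= K /\ K%:E = (c%:E * ((J + J' + J') * (J + J)))%E.
  exists (fine (c%:E * ((J + J' + J') * (J + J)))%E); split.
    by apply: fine_ge0; apply: mule_ge0; [rewrite lee_fin|exact: mule_ge0].
  by rewrite fineK//; apply: fin_numM => //; apply: fin_numM; rewrite !fin_numD ?Jfin ?J'fin.
(* Adding 1 makes the constant positive without having to show that the integrals are nonzero. *)
exists (K + 1) => [|[tau xi]]; first exact: (ltr_wpDl K0 ltr01).
apply: (@le_trans _ _ K%:E); last by rewrite lee_fin lerDl.
pose j1 (w : R * R) := jap (w.1 + w.2 ^+ 2) `^ (- (2 * b)).
pose j2 (w : R * R) := jap (w.1 - tau + (w.2 - xi) ^+ 2) `^ (- (2 * b)).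
pose Phi (x : R) := `|xi| * jap (tau + x ^+ 2 - (x - xi) ^+ 2) `^ (- (2 * b)) +
   jap x `^ (1 - 4 * b) + jap (x - xi) `^ (1 - 4 * b).
have Phi0 x : 0 <= Phi x by rewrite !addr_ge0 ?mulr_ge0 ?powR_ge0.
have mPhi : measurable_fun setT (Phi : mR -> R).
  apply: measurable_funD; first apply: measurable_funD.
  - apply: measurable_funM => //; apply: measurable_jap_powR.
    apply: measurable_funB; first by apply: measurable_funD => //; exact: measurable_funX.
    by apply: measurable_funX; exact: measurable_funB.
  - exact: measurable_jap_powR.
  - by apply: measurable_jap_powR; exact: measurable_funB.
have mj1 : measurable_fun setT (j1 : mR * mR -> R).
  apply: measurable_jap_powR; apply: measurable_funD => //.
  by apply: measurable_funX; exact: measurable_snd.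
have mj2 : measurable_fun setT (j2 : mR * mR -> R).
  apply: measurable_jap_powR; apply: measurable_funD => //; first exact: measurable_funB.
  by apply: measurable_funX; exact: measurable_funB.
have mj1' x : measurable_fun setT (fun y : mR => (j1 (y, x))%:E).
  apply/measurable_EFinP; exact: (measurableT_comp mj1 (measurable_pair2 x)).
have mj2' x : measurable_fun setT (fun y : mR => (j2 (y, x))%:E).
  apply/measurable_EFinP; exact: (measurableT_comp mj2 (measurable_pair2 x)).
have j12_ge0 x y : (0 <= (j1 (y, x) + j2 (y, x))%:E)%E.
  by rewrite lee_fin; apply: addr_ge0; exact: powR_ge0.
have m12 x : measurable_fun setT (fun y : mR => (j1 (y, x) + j2 (y, x))%:E).
  have mj12 : measurable_fun setT (fun w : mR * mR => j1 w + j2 w) by exact: measurable_funD.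
  by apply/measurable_EFinP; exact: (measurableT_comp mj12 (measurable_pair2 x)).
have inner x : (\int[leb]_y (j1 (y, x) + j2 (y, x))%:E = J + J)%E.
  transitivity (\int[leb]_y (j1 (y, x))%:E + \int[leb]_y (j2 (y, x))%:E)%E.
    have g1 (y : mR) : setT y -> (0 <= (j1 (y, x))%:E)%E by move=> _; rewrite lee_fin; exact: powR_ge0.
    have g2 (y : mR) : setT y -> (0 <= (j2 (y, x))%:E)%E by move=> _; rewrite lee_fin; exact: powR_ge0.
    exact: (ge0_integralD leb measurableT g1 (mj1' x) g2 (mj2' x)).
  have -> : (\int[leb]_y (j1 (y, x))%:E = J)%E by rewrite JE; exact: (integral_jap_powR_shift (- (2 * b)) (x ^+ 2)).
  have -> : (\int[leb]_y (j2 (y, x))%:E = J)%E.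
    rewrite JE; apply: etrans (integral_jap_powR_shift (- (2 * b)) (- tau + (x - xi) ^+ 2)).
    by apply: eq_integral => y _; rewrite /j2 addrA.
  by [].
(* In this majorant tau1 = [w.1] occurs only in [j1] and [j2], whose integrals over it equal [J] for
   every xi1; what is left is the integral of [Phi]. *)
have bound w : bikernel (tau, xi) w ^+ 2 <= c * Phi w.2 * (j1 w + j2 w).
  rewrite sqr_bikernel /=.
  set P := _ * jap (w.2 - xi) `^ (- (2 * s)).
  have P0 : 0 <= P.
    by do 4 (apply: mulr_ge0; last exact: powR_ge0); exact: sqr_ge0.
  apply: (@le_trans _ _ (P * (2 `^ (2 * b) * jap (tau + w.2 ^+ 2 - (w.2 - xi) ^+ 2) `^ (- (2 * b)) * (j1 w + j2 w)))).
    rewrite ler_wpM2l//.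
    apply: le_trans (jap_convolution_pointwise b0 _ _) _.
    by rewrite (_ : w.1 + _ - _ = tau + w.2 ^+ 2 - (w.2 - xi) ^+ 2)//; ring.
  rewrite (_ : P * _ = 2 `^ (2 * b) * (P * jap (tau + w.2 ^+ 2 - (w.2 - xi) ^+ 2) `^ (- (2 * b))) * (j1 w + j2 w)); last by ring.
  apply: ler_wpM2r; first by rewrite addr_ge0// powR_ge0.
  rewrite cE -[leRHS]mulrA; apply: ler_wpM2l; first exact: powR_ge0.
  exact: hC.
have mG : measurable_fun setT (fun w : mR * mR => (c * Phi w.2 * (j1 w + j2 w))%:E).
  apply/measurable_EFinP; apply: measurable_funM; last exact: measurable_funD.
  by apply: measurable_funM => //; exact: (measurableT_comp mPhi measurable_snd).
apply: (@le_trans _ _ (\int[leb2]_w (c * Phi w.2 * (j1 w + j2 w))%:E)%E).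
  apply: ge0_le_integral => //.
  - by move=> w _; rewrite lee_fin sqr_ge0.
  - by apply/measurable_EFinP; apply: measurable_funX; exact: measurable_bikernel.
  - by move=> w _; rewrite lee_fin.
rewrite KE.
have -> : (\int[leb2]_w (c * Phi w.2 * (j1 w + j2 w))%:E =
    \int[leb]_x ((c * Phi x)%:E * (J + J)))%E.
  rewrite [LHS](fubini_tonelli2 (m1 := leb) (m2 := leb) _ mG); last first.
    move=> w; rewrite lee_fin; apply: mulr_ge0; first exact: mulr_ge0.
    by apply: addr_ge0; exact: powR_ge0.
  apply: eq_integral => x _; rewrite -(inner x).
  by rewrite -ge0_integralZl// lee_fin mulr_ge0.
have mP : measurable_fun setT (fun x : mR => (Phi x)%:E) by exact/measurable_EFinP.
have mcP : measurable_fun setT (fun x : mR => (c * Phi x)%:E).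
  by apply/measurable_EFinP; exact: measurable_funM.
have P0 (x : mR) : setT x -> (0 <= (Phi x)%:E)%E by rewrite lee_fin.
have cP0 (x : mR) : setT x -> (0 <= (c * Phi x)%:E)%E by rewrite lee_fin mulr_ge0.
have ce0 : (0 <= c%:E)%E by rewrite lee_fin.
rewrite (ge0_integralZr leb measurableT mcP cP0 JJ0) muleA; apply: lee_wpmul2r; first exact: JJ0.
under eq_integral do rewrite EFinM.
rewrite (ge0_integralZl leb measurableT mP P0 ce0); apply: lee_wpmul2l => //.
have mjap (p : R) (h : mR -> R) : measurable_fun setT h ->
    measurable_fun setT (fun x => (jap (h x) `^ p)%:E).
  by move=> mh; apply/measurable_EFinP; exact: measurable_jap_powR.
under eq_integral do rewrite /Phi !EFinD.
have m1 : measurable_fun setT (fun x : mR =>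
    (`|xi| * jap (tau + x ^+ 2 - (x - xi) ^+ 2) `^ (- (2 * b)))%:E).
  apply/measurable_EFinP; apply: measurable_funM => //; apply: measurable_jap_powR.
  apply: measurable_funB; first by apply: measurable_funD => //; exact: measurable_funX.
  by apply: measurable_funX; exact: measurable_funB.
have m2 : measurable_fun setT (fun x : mR => (jap (x : R) `^ (1 - 4 * b))%:E) by exact: mjap.
have m3 : measurable_fun setT (fun x : mR => (jap ((x : R) - xi) `^ (1 - 4 * b))%:E).
  by apply: mjap; exact: measurable_funB.
have g1 (x : mR) : setT x -> (0 <= (`|xi| * jap (tau + x ^+ 2 - (x - xi) ^+ 2) `^ (- (2 * b)))%:E)%E.
  by move=> _; rewrite lee_fin mulr_ge0// powR_ge0.
have g2 (x : mR) : setT x -> (0 <= (jap (x : R) `^ (1 - 4 * b))%:E)%E.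
  by move=> _; rewrite lee_fin powR_ge0.
have g3 (x : mR) : setT x -> (0 <= (jap ((x : R) - xi) `^ (1 - 4 * b))%:E)%E.
  by move=> _; rewrite lee_fin powR_ge0.
have g12 (x : mR) (hx : setT x) := adde_ge0 (g1 x hx) (g2 x hx).
rewrite (ge0_integralD leb measurableT g12 (emeasurable_funD m1 m2) g3 m3).
rewrite (ge0_integralD leb measurableT g1 m1 g2 m2).
rewrite integral_jap_powR_shift -J'E; apply: leeD => //; apply: leeD => //; rewrite JE.
rewrite (eq_integral (fun x : mR => (`|xi| * jap (2 * xi * (x : R) + (tau - xi ^+ 2)) `^ (- (2 * b)))%:E)).
  exact: integral_jap_powR_slope.
by move=> x _; congr (_ * jap _ `^ _)%:E; ring.
Qed.

End kernel.
End kernel_integral.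

(** * The bilinear estimate *)

Section square_norm.
Context d (T : measurableType d) (R : realType).
Variable mu : {measure set T -> \bar R}.
Implicit Types f g : T -> R.

Lemma poweR2 (x : \bar R) : (0 <= x)%E -> (x `^ 2 = x * x)%E.
Proof.
case: x => [r| |] // r0; first by rewrite poweR_EFin powR_mulrn// expr2 EFinM.
by rewrite poweRyr ?pnatr_eq0// mulyy.
Qed.

(** L^2 norms are compared through their squares, as extended reals; this avoids square roots and
    any finiteness condition. *)
Lemma Lnorm2_sqr f : (Lnorm mu 2%:E (EFin \o f) * Lnorm mu 2%:E (EFin \o f) =
  \int[mu]_x (f x ^+ 2)%:E)%E.
Proof.
rewrite -poweR2 ?Lnorm_ge0// poweR_Lnorm//.
apply: eq_integral => x _ /=.
by rewrite powR_mulrn// real_normK ?num_real.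
Qed.

Lemma lee_sqr_inv (x y : \bar R) : (0 <= y)%E -> (x * x <= y * y)%E -> (x <= y)%E.
Proof.
move=> y0; apply: contraTT; rewrite -!ltNge.
case: y y0 => [r| |] // r0; case: x => [t| |] // rt; last by rewrite mulyy -EFinM ltry.
by rewrite -!EFinM !lte_fin in r0 rt *; rewrite ltr_pM// (le_lt_trans r0).
Qed.

Lemma cauchy_schwarz f g : measurable_fun setT f -> measurable_fun setT g ->
  (forall x, 0 <= f x) -> (forall x, 0 <= g x) ->
  ((\int[mu]_x (f x * g x)%:E) * (\int[mu]_x (f x * g x)%:E) <=
   (\int[mu]_x (f x ^+ 2)%:E) * (\int[mu]_x (g x ^+ 2)%:E))%E.
Proof.
move=> mf mg f0 g0.
have h := @hoelder _ _ _ mu f g 2 2 mf mg (ltr0n R 2) (ltr0n R 2)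
  (ltac:(by rewrite -[RHS](@divff _ 2)// mulrDl mul1r)).
have E1 : (\int[mu]_x (f x * g x)%:E = Lnorm mu 1%:E (EFin \o (f \* g)%R))%E.
  rewrite Lnorm1; apply: eq_integral => x _ /=.
  by rewrite ger0_norm// mulr_ge0.
have I0 : (0 <= \int[mu]_x (f x * g x)%:E)%E.
  by apply: integral_ge0 => x _; rewrite lee_fin mulr_ge0.
rewrite -!Lnorm2_sqr muleACA; rewrite -E1 in h.
by apply: lee_pmul.
Qed.

End square_norm.

(** * Cauchy-Schwarz and Tonelli for the weighted convolution *)

Section bilinear_estimate.
Context {R : realType}.
Local Notation mR := (measurableTypeR R).
Local Notation leb := (@lebesgue_measure R).
Local Notation leb2 := (plane_measure R).

Lemma integral_reflect (f : mR * mR -> \bar R) (w : R * R) :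
  measurable_fun setT f -> (forall z, 0 <= f z)%E ->
  (\int[leb2]_z f (w - (z : R * R))%R = \int[leb2]_z f z)%E.
Proof.
move=> mf f0; have n1 : - 1 != 0 :> R by rewrite oppr_eq0 oner_neq0.
rewrite [RHS](ge0_integral_affine2 w.1 w.2 n1 mf f0) sqrrN expr1n mul1e.
apply: eq_integral => -[z1 z2] _; congr f.
by case: w => w1 w2; congr (_, _); rewrite /= mulN1r addrC.
Qed.

Lemma measurable_sub_plane : measurable_fun setT
  (fun p : (mR * mR) * (mR * mR) => ((p.2 : R * R) - (p.1 : R * R)) : mR * mR).
Proof.
apply/measurable_fun_pairP; split => /=; apply: measurable_funB.
- exact: (measurableT_comp measurable_fst measurable_snd).
- exact: (measurableT_comp measurable_fst measurable_fst).
- exact: (measurableT_comp measurable_snd measurable_snd).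
- exact: (measurableT_comp measurable_snd measurable_fst).
Qed.

(** Tonelli, then invariance of the plane measure under the map from zeta to w - zeta. *)
Lemma integral_convolution (f g : mR * mR -> R) :
  measurable_fun setT f -> measurable_fun setT g ->
  (forall z, 0 <= f z) -> (forall z, 0 <= g z) ->
  (\int[leb2]_zeta (\int[leb2]_w (f w * g ((w : R * R) - (zeta : R * R)))%:E) =
   (\int[leb2]_w (f w)%:E) * (\int[leb2]_w (g w)%:E))%E.
Proof.
move=> mf mg f0 g0.
pose H (p : (mR * mR) * (mR * mR)) := (f p.2 * g ((p.2 : R * R) - (p.1 : R * R)))%:E.
have mH : measurable_fun setT H.
  apply/measurable_EFinP; apply: measurable_funM.
    exact: (measurableT_comp mf measurable_snd).
  exact: (measurableT_comp mg measurable_sub_plane).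
have H0 p : (0 <= H p)%E by rewrite lee_fin mulr_ge0.
apply: (etrans (fubini_tonelli (m1 := leb2) (m2 := leb2) H mH H0)).
have If0 : (0 <= \int[leb2]_w (g w)%:E)%E by apply: integral_ge0 => z _; rewrite lee_fin.
have mgE : measurable_fun setT (fun z => (g z)%:E) by exact/measurable_EFinP.
have mfE : measurable_fun setT (fun z => (f z)%:E) by exact/measurable_EFinP.
have f0' z : setT z -> (0 <= (f z)%:E)%E by rewrite lee_fin.
have g0' z : (0 <= (g z)%:E)%E by rewrite lee_fin.
rewrite -(ge0_integralZr leb2 measurableT mfE f0' If0).
apply: eq_integral => w _; rewrite /H /fst /snd.
rewrite -(integral_reflect w mgE g0').
rewrite -(ge0_integralZl leb2 measurableT); first by apply: eq_integral.
- apply: (measurableT_comp mgE).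
  by apply/measurable_fun_pairP; split => /=; exact: measurable_funB.
- by move=> z _; exact: g0'.
- exact: f0'.
Qed.

Section weighted_bound.
Variables (nu s s' a b : R).
Variable K : R.
Hypothesis K0 : 0 < K.
Hypothesis hK : forall zeta, (\int[leb2]_w (bikernel nu s s' a b zeta w ^+ 2)%:E <= K%:E)%E.

(** For fixed zeta, Cauchy-Schwarz in w separates the kernel, whose square integral is at most [K],
    from the convolution-type integral of u^2 and v^2. Integrating the latter over zeta gives the
    product of the two integrals. *)
Lemma weighted_convolution_bound (m u v : mR * mR -> R) (c : R) : 0 <= c ->
  measurable_fun setT m -> measurable_fun setT u -> measurable_fun setT v ->
  (forall z, 0 <= m z) -> (forall z, 0 <= u z) -> (forall z, 0 <= v z) ->
  (forall zeta, ((m zeta)%:E <= c%:E * \int[leb2]_w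
     (bikernel nu s s' a b zeta w * (u w * v ((w : R * R) - (zeta : R * R))))%:E)%E) ->
  (\int[leb2]_z (m z ^+ 2)%:E <=
   (c ^+ 2 * K)%:E * ((\int[leb2]_z (u z ^+ 2)%:E) * (\int[leb2]_z (v z ^+ 2)%:E)))%E.
Proof.
move=> c0 mm mu mv m0 u0 v0 hm.
have mv' (zeta : mR * mR) : measurable_fun setT (fun w : mR * mR => v ((w : R * R) - (zeta : R * R))).
  apply: (measurableT_comp mv).
  by apply/measurable_fun_pairP; split => /=; exact: measurable_funB.
have mu2 : measurable_fun setT (fun z => u z ^+ 2) by exact: measurable_funX.
have mv2 : measurable_fun setT (fun z => v z ^+ 2) by exact: measurable_funX.
have u20 z : 0 <= u z ^+ 2 by exact: sqr_ge0.
have v20 z : 0 <= v z ^+ 2 by exact: sqr_ge0.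
rewrite -(integral_convolution mu2 mv2 u20 v20).
pose G (zeta : mR * mR) := (\int[leb2]_w (u w ^+ 2 * v ((w : R * R) - (zeta : R * R)) ^+ 2)%:E)%E.
have G0 zeta : (0 <= G zeta)%E.
  by apply: integral_ge0 => w _; rewrite lee_fin mulr_ge0.
have cK0 : (0 <= (c ^+ 2 * K)%:E)%E by rewrite lee_fin mulr_ge0 ?sqr_ge0// ltW.
have pointwise zeta : ((m zeta ^+ 2)%:E <= (c ^+ 2 * K)%:E * G zeta)%E.
  set I := (\int[leb2]_w (bikernel nu s s' a b zeta w * (u w * v ((w : R * R) - (zeta : R * R))))%:E)%E.
  have I0 : (0 <= I)%E.
    by apply: integral_ge0 => w _; rewrite lee_fin mulr_ge0 ?bikernel_ge0// mulr_ge0.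
  have CS : (I * I <= K%:E * G zeta)%E.
    have muv : measurable_fun setT (fun w : mR * mR => u w * v ((w : R * R) - (zeta : R * R))).
      exact: measurable_funM.
    have := cauchy_schwarz leb2 (measurable_bikernel nu s s' a b zeta) muv
      (bikernel_ge0 nu s s' a b zeta) (fun w => mulr_ge0 (u0 w) (v0 _)).
    move=> /le_trans; apply.
    have -> : (\int[leb2]_w ((u w * v ((w : R * R) - (zeta : R * R))) ^+ 2)%:E = G zeta)%E.
      by apply: eq_integral => w _; rewrite exprMn.
    exact: lee_wpmul2r.
  rewrite expr2 EFinM; apply: (@le_trans _ _ ((c%:E * I) * (c%:E * I))%E).
    by apply: lee_pmul => //; rewrite lee_fin.
  rewrite muleACA -EFinM -expr2 [X in (_ <= X * _)%E]EFinM -muleA.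
  by apply: lee_wpmul2l => //; rewrite lee_fin sqr_ge0.
have mG : measurable_fun setT G.
  apply: (measurable_fun_fubini_tonelli_F (m2 := leb2)
    (fun p : (mR * mR) * (mR * mR) => (u p.2 ^+ 2 * v ((p.2 : R * R) - (p.1 : R * R)) ^+ 2)%:E)).
    apply/measurable_EFinP; apply: measurable_funM.
      exact: (measurableT_comp mu2 measurable_snd).
    exact: (measurableT_comp mv2 measurable_sub_plane).
  by move=> p; rewrite lee_fin mulr_ge0.
have G0' z : setT z -> (0 <= G z)%E by [].
rewrite -(ge0_integralZl leb2 measurableT mG G0' cK0).
apply: ge0_le_integral => //.
- by move=> z _; rewrite lee_fin sqr_ge0.
- by apply/measurable_EFinP; exact: measurable_funX.
- by apply: emeasurable_funM => //.
Qed.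

End weighted_bound.
End bilinear_estimate.

Section fourier_norm.
Context {R : realType}.
Local Notation mR := (measurableTypeR R).
Local Notation leb2 := (plane_measure R).
Implicit Types f g : R * R -> R[i].

Lemma measurable_normc_fourier f : schwartz f ->
  measurable_fun setT (fun z : mR * mR => normc (fourier f z)).
Proof.
by move=> sf; apply: measurable_normc; apply: cmeas_fourier; exact: schwartz_cmeas.
Qed.

Section weight.
Variable W : mR * mR -> R.
Hypothesis mW : measurable_fun setT W.
Hypothesis W0 : forall z, 0 <= W z.

Lemma fourier_norm_sqr f : (fourier_norm W f * fourier_norm W f =
  \int[leb2]_z ((W z * normc (fourier f z)) ^+ 2)%:E)%E.
Proof. exact: (Lnorm2_sqr leb2). Qed.

Lemma fourier_norm_ge0 f : (0 <= fourier_norm W f)%E.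
Proof. exact: Lnorm_ge0. Qed.

Lemma measurable_weight_fourier f : schwartz f ->
  measurable_fun setT (fun z : mR * mR => W z * normc (fourier f z)).
Proof. by move=> /measurable_normc_fourier ?; exact: measurable_funM. Qed.

Lemma fourier_normD f g : schwartz f -> schwartz g ->
  (fourier_norm W (fun z => (f z + g z)%R) <= fourier_norm W f + fourier_norm W g)%E.
Proof.
move=> sf sg.
have mf := measurable_weight_fourier sf.
have mg := measurable_weight_fourier sg.
have := minkowski_EFin leb2 mf mg (ler1n R 2).
apply: le_trans.
apply: lee_sqr_inv; first exact: Lnorm_ge0.
rewrite fourier_norm_sqr (Lnorm2_sqr leb2).
apply: ge0_le_integral => //.
- by move=> z _; rewrite lee_fin sqr_ge0.
- apply/measurable_EFinP; apply: measurable_funX.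
  exact: (measurable_weight_fourier (schwartzD sf sg)).
- by apply/measurable_EFinP; apply: measurable_funX; exact: measurable_funD.
move=> z _; rewrite lee_fin lerXn2r ?nnegrE ?addr_ge0 ?mulr_ge0 ?normc_ge0//.
rewrite (fourierD _ (schwartz_cintegr sf) (schwartz_cintegr sg)) /= -mulrDr.
by apply: ler_wpM2l => //; exact: (@le_normcD R (fourier f z) (fourier g z)).
Qed.

End weight.
End fourier_norm.

(** * Finiteness of the norms on Schwartz functions *)

Section finite_norm.
Context {R : realType}.
Local Notation mR := (measurableTypeR R).
Local Notation leb2 := (plane_measure R).
Implicit Types f g : R * R -> R[i].

Lemma powR_jap_le_expn (x p : R) (n : nat) : p <= n%:R -> jap x `^ p <= jap x ^+ n.
Proof.
move=> pn; rewrite -powR_mulrn; last exact/ltW/jap_gt0.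
by apply: ler_powR => //; exact: jap_ge1.
Qed.

Lemma jap_parabola_le (t x : R) : jap (t + x ^+ 2) <= 2 * ((1 + `|t|) * (1 + `|x|) ^+ 2).
Proof.
have h := jap_sub_le t (- x ^+ 2); rewrite opprK in h.
have h1 := jap_le1D t; have h2 := jap_le1D (- x ^+ 2).
rewrite normrN normrX in h2.
have t0 := normr_ge0 t; have x0 := normr_ge0 x.
apply: (le_trans h); apply: (le_trans (lerD h1 h2)); move: t0 x0.
move: `|t| `|x| => p q p0 q0.
rewrite -subr_ge0.
have -> : 2 * ((1 + p) * (1 + q) ^+ 2) - (1 + p + (1 + q ^+ 2)) =
  p + 4 * q + q ^+ 2 + 4 * (p * q) + 2 * (p * q ^+ 2) by ring.
by rewrite !addr_ge0// ?mulr_ge0// ?exprn_ge0 ?mulr_ge0.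
Qed.

(** Of the [3 * n] powers in xi, [n] come from <xi>^s and [2 * n] from the xi^2 inside the
    modulation. *)
Lemma weightX_le_expn (s b : R) (n : nat) (z : R * R) : s <= n%:R -> b <= n%:R ->
  weightX s b z <= 2 ^+ n * ((1 + `|z.1|) ^+ n * (1 + `|z.2|) ^+ (3 * n)).
Proof.
move=> sn bn.
have z10 : 0 <= 1 + `|z.1| by rewrite addr_ge0.
have z20 : 0 <= 1 + `|z.2| by rewrite addr_ge0.
have h1 : jap z.2 `^ s <= (1 + `|z.2|) ^+ n.
  apply: (le_trans (powR_jap_le_expn _ sn)); apply: lerXn2r.
  - by rewrite nnegrE (ltW (jap_gt0 _)).
  - by rewrite nnegrE.
  - exact: jap_le1D.
have h2 : jap (z.1 + z.2 ^+ 2) `^ b <= (2 * ((1 + `|z.1|) * (1 + `|z.2|) ^+ 2)) ^+ n.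
  apply: (le_trans (powR_jap_le_expn _ bn)); apply: lerXn2r.
  - by rewrite nnegrE (ltW (jap_gt0 _)).
  - by rewrite nnegrE !mulr_ge0 ?exprn_ge0.
  - exact: jap_parabola_le.
apply: (@le_trans _ _ ((1 + `|z.2|) ^+ n * (2 * ((1 + `|z.1|) * (1 + `|z.2|) ^+ 2)) ^+ n)).
  by apply: ler_pM => //; exact: powR_ge0.
rewrite le_eqVlt; apply/orP; left; apply/eqP.
have -> : (2 * ((1 + `|z.1|) * (1 + `|z.2|) ^+ 2)) ^+ n =
    2 ^+ n * ((1 + `|z.1|) ^+ n * ((1 + `|z.2|) ^+ 2) ^+ n).
  by rewrite exprMn [in LHS]exprMn.
rewrite -exprM mulrCA; congr (_ * _); rewrite mulrCA -exprD; congr (_ * _ ^+ _).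
Qed.

Lemma inv_expn2_le_K2 (z : R * R) : 1 <= (1 + `|z.1|) ^+ 2 * (1 + `|z.2|) ^+ 2 * K2 z.
Proof.
have j1 : 0 < jap z.1 ^+ 2 by rewrite exprn_gt0 ?jap_gt0.
have j2 : 0 < jap z.2 ^+ 2 by rewrite exprn_gt0 ?jap_gt0.
rewrite K2E (ler_pdivlMr _ _ (mulr_gt0 j1 j2)) mul1r.
by apply: ler_pM; rewrite ?(ltW j1) ?(ltW j2)// lerXn2r ?nnegrE ?addr_ge0 ?(ltW (jap_gt0 _)) ?jap_le1D.
Qed.

Lemma weightX_fourier_le (s b : R) f : schwartz f ->
  exists2 M, 0 <= M & forall z, weightX s b z * normc (fourier f z) <= M * K2 z.
Proof.
move=> sf.
pose n := (Num.bound `|s| + Num.bound `|b|)%N.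
have sn : s <= n%:R.
  apply: (le_trans (ler_norm s)); apply: (le_trans (ltW (archi_boundP (normr_ge0 s)))).
  by rewrite ler_nat leq_addr.
have bn : b <= n%:R.
  apply: (le_trans (ler_norm b)); apply: (le_trans (ltW (archi_boundP (normr_ge0 b)))).
  by rewrite ler_nat leq_addl.
(* The two additional powers in each variable pay for [K2]. *)
clearbody n; have [M hM] := fourier_decay sf (n + 2) (3 * n + 2).
have M0 : 0 <= M by apply: le_trans (hM 0); rewrite !mulr_ge0 ?exprn_ge0 ?addr_ge0 ?normc_ge0.
exists (2 ^+ n * M) => [|z]; first by rewrite mulr_ge0 ?exprn_ge0.
apply: (@le_trans _ _ (2 ^+ n * ((1 + `|z.1|) ^+ n * (1 + `|z.2|) ^+ (3 * n)) * normc (fourier f z))).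
  by apply: ler_wpM2r; rewrite ?normc_ge0// weightX_le_expn.
have hz := hM z; rewrite (exprD _ n) (exprD _ (3 * n)) in hz.
have k0 := ltW (K2_gt0 z); have k1 := inv_expn2_le_K2 z.
have z10 : 0 <= 1 + `|z.1| by rewrite addr_ge0.
have z20 : 0 <= 1 + `|z.2| by rewrite addr_ge0.
rewrite -!mulrA; apply: ler_wpM2l; first by rewrite exprn_ge0.
apply: le_trans (ler_wpM2r k0 hz).
set A := (1 + `|z.1|); set B := 1 + `|z.2|; set F := normc _.
have E : A ^+ n * A ^+ 2 * (B ^+ (3 * n) * B ^+ 2) * F * K2 z =
  (A ^+ n * (B ^+ (3 * n) * F)) * (A ^+ 2 * B ^+ 2 * K2 z) by ring.
rewrite E.
by rewrite ler_peMr// !mulr_ge0 ?exprn_ge0 ?normc_ge0.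
Qed.

(** The weighted transform is at most M K2, and K2 <= 1 makes its square integrable as well.
    Finiteness turns the norms along a Cauchy sequence into a real sequence. *)
Lemma X_norm_lty (s b : R) f : schwartz f -> (X_norm s b f < +oo)%E.
Proof.
move=> sf; have [M M0 hM] := weightX_fourier_le s b sf.
have h : (X_norm s b f * X_norm s b f < +oo)%E.
  rewrite [X in (X < _)%E](fourier_norm_sqr (weightX s b)).
  apply: (@le_lt_trans _ _ (\int[leb2]_z (M ^+ 2 * K2 z)%:E)%E).
    apply: ge0_le_integral => //.
    - by move=> z _; rewrite lee_fin sqr_ge0.
    - apply/measurable_EFinP; apply: measurable_funX.
      exact: (measurable_weight_fourier (measurable_weightX s b) sf).
    - by apply: measurable_int; exact: (integrZ (M ^+ 2) integr_K2).
    move=> z _; rewrite lee_fin.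
    have w0 : 0 <= weightX s b z * normc (fourier f z).
      by rewrite mulr_ge0 ?normc_ge0 ?(ltW (weightX_gt0 _ _ _)).
    have k0 := ltW (K2_gt0 z).
    have k1 : K2 z <= 1.
      rewrite K2E invf_le1; last by rewrite mulr_gt0 ?exprn_gt0 ?jap_gt0.
      by rewrite mulr_ege1// exprn_ege1// jap_ge1.
    apply: (@le_trans _ _ ((M * K2 z) ^+ 2)); first by apply: lerXn2r; rewrite ?nnegrE ?(mulr_ge0 M0).
    by rewrite exprMn ler_wpM2l ?sqr_ge0// expr2 ler_piMr.
  have : integr leb2 (fun z : mR * mR => M ^+ 2 * K2 z) by exact: (integrZ (M ^+ 2) integr_K2).
  move=> /integral_fune_lt_pinfty; exact.
move: h; have : (0 <= X_norm s b f)%E by exact: Lnorm_ge0.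
by case: (X_norm s b f) => [r| |] // _; rewrite ?ltry// mulyy.
Qed.

End finite_norm.

Section schwartz_estimate.
Context {R : realType}.
Local Notation mR := (measurableTypeR R).
Local Notation leb2 := (plane_measure R).
Implicit Types f g : R * R -> R[i].
Variables (nu s s' a b : R).
Hypothesis nu1 : `|nu| != 1.
Hypotheses (s0 : 0 <= s) (a0 : 0 <= a) (b12 : 1 / 2 < b).
Hypotheses (e1 : 2 * s' + 1 <= 4 * s) (e2 : 1 + 2 * (s' - s) <= 4 * a).
Hypothesis e3 : 2 + 2 * (s' - s) <= 4 * b.

Lemma Y_norm_dx_mul_conj_le : exists2 C, 0 < C & forall f g, schwartz f -> schwartz g ->
  (Y_norm nu s' (- a) (dx_mul_conj f g) <= C%:E * X_norm s b f * X_norm s b g)%E.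
Proof.
have [K K0 hK] := integral_sqr_bikernel_le nu1 s0 a0 b12 e1 e2 e3.
have [C C0 hC] := @normc_fourier_mul_conj_le R.
(* The factor 2 pi comes from the derivative and [C] from the convolution inequality; the square
   root of [K] below comes from Cauchy-Schwarz against the kernel. *)
pose c := 2 * pi * C.
have c0 : 0 < c by rewrite !mulr_gt0// pi_gt0.
exists (c * Num.sqrt K) => [|f g sf sg]; first by rewrite mulr_gt0 ?sqrtr_gt0.
apply: lee_sqr_inv.
  have X0 h : (0 <= X_norm s b h)%E by exact: Lnorm_ge0.
  by rewrite !mule_ge0 ?X0// lee_fin mulr_ge0 ?sqrtr_ge0 ?(ltW c0).
have -> : ((c * Num.sqrt K)%:E * X_norm s b f * X_norm s b g *
   ((c * Num.sqrt K)%:E * X_norm s b f * X_norm s b g) =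
   (c ^+ 2 * K)%:E * ((X_norm s b f * X_norm s b f) * (X_norm s b g * X_norm s b g)))%E.
  rewrite muleACA [X in (X * _)%E]muleACA -muleA; congr (_ * _)%E.
  by rewrite -EFinM -expr2 exprMn sqr_sqrtr// ltW.
rewrite [X in (X <= _)%E](fourier_norm_sqr (weightY nu s' (- a))).
rewrite [X in (_ <= _ * (X * _))%E](fourier_norm_sqr (weightX s b)).
rewrite [X in (_ <= _ * (_ * X))%E](fourier_norm_sqr (weightX s b)).
have sfg := schwartzM sf (schwartz_conj sg).
have wX z : 0 < weightX s b z by exact: weightX_gt0.
have wY z : 0 < weightY nu s' (- a) z by exact: weightY_gt0.
apply: (weighted_convolution_bound K0 hK (ltW c0)).
- exact: (measurable_weight_fourier (measurable_weightY nu s' (- a)) (schwartz_dx_mul_conj sf sg)).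
- exact: (measurable_weight_fourier (measurable_weightX s b) sf).
- exact: (measurable_weight_fourier (measurable_weightX s b) sg).
- by move=> z; rewrite mulr_ge0 ?normc_ge0 ?(ltW (wY z)).
- by move=> z; rewrite mulr_ge0 ?normc_ge0 ?(ltW (wX z)).
- by move=> z; rewrite mulr_ge0 ?normc_ge0 ?(ltW (wX z)).
move=> zeta.
have -> : normc (fourier (dx_mul_conj f g) zeta) =
  2 * pi * `|zeta.2| * normc (fourier (fun y => f y * conjc (g y)) zeta).
  exact: (normc_fourier_cpartial true zeta sfg).
pose d := `|zeta.2| * weightY nu s' (- a) zeta.
have d0 : 0 <= d by rewrite mulr_ge0 ?(ltW (wY _)).
have -> : (\int[leb2]_w (bikernel nu s s' a b zeta w *
     ((weightX s b w * normc (fourier f w)) *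
      (weightX s b ((w : R * R) - (zeta : R * R)) * normc (fourier g ((w : R * R) - (zeta : R * R))))))%:E =
   d%:E * \int[leb2]_w (normc (fourier f w) * normc (fourier g ((w : R * R) - (zeta : R * R))))%:E)%E.
  rewrite -(ge0_integralZl leb2 measurableT).
  - apply: eq_integral => w _; rewrite -EFinM; congr EFin; rewrite /bikernel -/d.
    move: (wX w) (wX ((w : R * R) - (zeta : R * R))); rewrite /d.
    move: (weightX s b w) (weightX s b _) (normc _) (normc _) (weightY _ _ _ _) => x y u v q x0 y0.
    by field; rewrite !gt_eqF.
  - apply/measurable_EFinP; apply: measurable_funM; first exact: measurable_normc_fourier.
    apply: (measurableT_comp (measurable_normc_fourier sg)).
    by apply/measurable_fun_pairP; split => /=; exact: measurable_funB.
  - by move=> w _; rewrite lee_fin mulr_ge0 ?normc_ge0.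
  - by rewrite lee_fin.
rewrite muleA -EFinM.
have -> : weightY nu s' (- a) zeta * (2 * pi * `|zeta.2| * normc (fourier (fun y => f y * conjc (g y)) zeta)) =
   (2 * pi * d) * normc (fourier (fun y => f y * conjc (g y)) zeta) by rewrite /d; ring.
have -> : c * d = (2 * pi * d) * C by rewrite /c; ring.
rewrite EFinM [X in (_ <= X * _)%E]EFinM -muleA; apply: lee_wpmul2l; last exact: hC.
by rewrite lee_fin; apply: mulr_ge0 => //; rewrite mulr_ge0 ?pi_ge0.
Qed.

End schwartz_estimate.

(** * Passage to the completions *)

Section completion.
Context {R : realType}.
Implicit Types (f g : R * R -> R[i]) (u v : nat -> R * R -> R[i]).

(** By the triangle inequality the norms of a Cauchy sequence form a Cauchy sequence of reals. The
    [limn] in [completion_norm] is therefore a true, finite limit and not a default value. *)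
Lemma fourier_norm_completion_cvg (W : measurableTypeR R * measurableTypeR R -> R) u :
  measurable_fun setT W -> (forall z, 0 <= W z) ->
  completion (fourier_norm W) u -> (forall n, fourier_norm W (u n) < +oo)%E ->
  exists2 l : R, completion_norm (fourier_norm W) u = l%:E &
    fine (fourier_norm W (u n)) @[n --> \oo] --> l.
Proof.
move=> mW W0 [su cu] finu; set N := fourier_norm W in cu finu *.
have NE n : N (u n) = (fine (N (u n)))%:E.
  by rewrite fineK// ge0_fin_numE ?fourier_norm_ge0.
have le_sub m n : (N (u m) <= N (fun z => (u m z - u n z)%R) + N (u n))%E.
  have := fourier_normD mW W0 (schwartzB (su m) (su n)) (su n).
  by under [X in fourier_norm W X]eq_fun do rewrite subrK.
have fine_lt (e : R) m n : (N (fun z => (u m z - u n z)%R) < e%:E)%E ->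
    fine (N (u m)) < e + fine (N (u n)).
  move=> lte; rewrite -lte_fin EFinD -!NE; apply: (le_lt_trans (le_sub m n)).
  by rewrite lteD2rE// NE.
have : cvgn (fun n => fine (N (u n))).
  apply/cauchy_cvgP/cauchy_exP => e e0; have [n0 hn0] := cu e e0.
  exists (fine (N (u n0))); exists n0 => // n /= n0n; rewrite /ball /=.
  have h1 := fine_lt _ _ _ (hn0 _ _ n0n (leqnn n0)).
  have h2 := fine_lt _ _ _ (hn0 _ _ (leqnn n0) n0n).
  by rewrite ltr_norml; lra.
move=> cvgN; exists (lim (fine (N (u n)) @[n --> \oo])) => //.
rewrite /completion_norm; apply/cvg_lim => //.
rewrite (_ : (fun n => N (u n)) = (fun n => (fine (N (u n)))%:E)); last exact/funext.
by apply: cvg_EFin; [exact: nearW|].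
Qed.

(** Telescoping through the mixed product of f' and the conjugate of g: each term on the right has a
    difference in one argument only, so the bilinear bound makes it small. *)
Lemma dx_mul_conj_sub f f' g g' : schwartz f -> schwartz f' -> schwartz g -> schwartz g' ->
  (fun z => dx_mul_conj f g z - dx_mul_conj f' g' z) =
  (fun z => dx_mul_conj (fun y => f y - f' y) g z + dx_mul_conj f' (fun y => g y - g' y) z).
Proof.
move=> sf sf' sg sg'.
have sM (h k : R * R -> R[i]) : schwartz h -> schwartz k -> schwartz (fun z => h z * conjc (k z)).
  by move=> sh sk; exact: schwartzM sh (schwartz_conj sk).
have E1 : (fun z => f z * conjc (g z)) =
    (fun z => (f z - f' z) * conjc (g z) + f' z * conjc (g z)).
  by apply/funext => z; rewrite -mulrDl subrK.
have E2 : (fun z => f' z * conjc (g z)) =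
    (fun z => f' z * conjc (g z - g' z) + f' z * conjc (g' z)).
  by apply/funext => z; rewrite -mulrDr -rmorphD subrK.
have D1 := congr1 (cpartial true) E1; have D2 := congr1 (cpartial true) E2.
rewrite (cpartialD true (sM _ _ (schwartzB sf sf') sg) (sM _ _ sf' sg)) in D1.
rewrite (cpartialD true (sM _ _ sf' (schwartzB sg sg')) (sM _ _ sf' sg')) in D2.
apply/funext => z; move: (congr1 (@^~ z) D1) (congr1 (@^~ z) D2) => D1z D2z.
have {}D1z : dx_mul_conj f g z =
    dx_mul_conj (fun y => f y - f' y) g z + dx_mul_conj f' g z by exact: D1z.
have {}D2z : dx_mul_conj f' g z =
    dx_mul_conj f' (fun y => g y - g' y) z + dx_mul_conj f' g' z by exact: D2z.
by rewrite D1z D2z addrA addrK.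
Qed.

(** The bound on Schwartz functions is used twice: on the telescoped differences, to see that the
    image sequence is Cauchy, and on the terms themselves, where it passes to the limit. *)
Lemma completion_dx_mul_conj_bound (s b nu s' a C : R) u v : 0 < C ->
  (forall f g, schwartz f -> schwartz g ->
    Y_norm nu s' a (dx_mul_conj f g) <= C%:E * X_norm s b f * X_norm s b g)%E ->
  X_space s b u -> X_space s b v ->
  Y_space nu s' a (completion_dx_mul_conj u v) /\
  (completion_norm (Y_norm nu s' a) (completion_dx_mul_conj u v) <=
   C%:E * completion_norm (X_norm s b) u * completion_norm (X_norm s b) v)%E.
Proof.
move=> C0 hC Xu Xv; have [su cu] := Xu; have [sv cv] := Xv.
have mX := measurable_weightX s b; have mY := measurable_weightY nu s' a.
have X0 z : 0 <= weightX s b z by rewrite ltW// weightX_gt0.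
have Y0 z : 0 <= weightY nu s' a z by rewrite ltW// weightY_gt0.
have [lu luE ulu] := fourier_norm_completion_cvg mX X0 Xu (fun n => X_norm_lty s b (su n)).
have [lv lvE vlv] := fourier_norm_completion_cvg mX X0 Xv (fun n => X_norm_lty s b (sv n)).
have NE f : schwartz f -> X_norm s b f = (fine (X_norm s b f))%:E.
  by move=> sf; rewrite fineK// ge0_fin_numE ?X_norm_lty//; exact: fourier_norm_ge0.
have N0 f : 0 <= fine (X_norm s b f) by rewrite fine_ge0//; exact: fourier_norm_ge0.
have hC' f g : schwartz f -> schwartz g ->
    (Y_norm nu s' a (dx_mul_conj f g) <= (C * fine (X_norm s b f) * fine (X_norm s b g))%:E)%E.
  by move=> sf sg; rewrite 2!EFinM -!NE//; exact: hC.
have Yfin n : (Y_norm nu s' a (completion_dx_mul_conj u v n) < +oo)%E.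
  by apply: (le_lt_trans (hC' _ _ (su n) (sv n))); rewrite ltry.
have Yuv : Y_space nu s' a (completion_dx_mul_conj u v).
  split=> [n|e e0]; first exact: schwartz_dx_mul_conj.
  (* Strictly above both limits, hence above the norms of [u n] and [v n] for all large n. *)
  pose M := `|lu| + `|lv| + 1.
  have M0 : 0 < M by rewrite ltr_wpDl// addr_ge0.
  have [luM lvM] : lu < M /\ lv < M.
    have := ler_norm lu; have := ler_norm lv; have := normr_ge0 lu; have := normr_ge0 lv.
    by rewrite /M; lra.
  have [p _ hp] := cvgr_lt lu ulu M luM; have [q _ hq] := cvgr_lt lv vlv M lvM.
  (* Each of the two telescoped terms is then below C M de = e/2. *)
  pose de := e / (2 * C * M).
  have de0 : 0 < de by rewrite divr_gt0// !mulr_gt0.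
  have [p' hp'] := cu de de0; have [q' hq'] := cv de de0.
  exists (maxn (maxn p q) (maxn p' q')) => m n; rewrite !geq_max.
  move=> /andP[/andP[_ qm] /andP[p'm q'm]] /andP[/andP[pn _] /andP[p'n q'n]].
  rewrite /completion_dx_mul_conj (dx_mul_conj_sub (su m) (su n) (sv m) (sv n)).
  have su' := schwartzB (su m) (su n); have sv' := schwartzB (sv m) (sv n).
  apply: (le_lt_trans (fourier_normD mY Y0 (schwartz_dx_mul_conj su' (sv m))
    (schwartz_dx_mul_conj (su n) sv'))).
  apply: (le_lt_trans (leeD (hC' _ _ su' (sv m)) (hC' _ _ (su n) sv'))).
  have := hp' _ _ p'm p'n; have := hq' _ _ q'm q'n; rewrite (NE _ su') (NE _ sv').
  rewrite -EFinD !lte_fin.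
  have := hp _ pn; have := hq _ qm; rewrite /=.
  move: (N0 (u n)) (N0 (v m)) (N0 (fun z => u m z - u n z)) (N0 (fun z => v m z - v n z)).
  have -> : e = C * (de * M) + C * (M * de).
    by rewrite /de; field; rewrite !gt_eqF.
  move: (fine _) (fine _) (fine _) (fine _) => x y x' y' x0 y0 x'0 y'0 yM xM y'd x'd.
  clearbody de; rewrite -!mulrA; apply: ltrD; rewrite (ltr_pM2l C0).
    exact: (ltr_pM x'0 y0 x'd yM).
  exact: (ltr_pM x0 y'0 xM y'd).
split => //.
have [ly lyE yly] := fourier_norm_completion_cvg mY Y0 Yuv Yfin.
have {}luE : completion_norm (X_norm s b) u = lu%:E by exact: luE.
have {}lvE : completion_norm (X_norm s b) v = lv%:E by exact: lvE.
have {}lyE : completion_norm (Y_norm nu s' a) (completion_dx_mul_conj u v) = ly%:E by exact: lyE.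
rewrite luE lvE lyE -!EFinM lee_fin.
have hlim : C * fine (X_norm s b (u n)) * fine (X_norm s b (v n)) @[n --> \oo] --> C * lu * lv.
  by apply: cvgM vlv; apply: cvgM ulu; exact: cvg_cst.
apply: (ler_cvg_to yly hlim).
apply: nearW => n /=; rewrite -lee_fin fineK; first exact: hC'.
rewrite ge0_fin_numE; [exact: Yfin|exact: fourier_norm_ge0].
Qed.

End completion.

Theorem theorem2p2 (R : realType) (nu : R) (nu_neq1 : `|nu| != 1)
    (s s' : R) (s_ge0 : 0 <= s) (s'_le : s' <= 2 * s - 1 / 2)
    (s'_lt : s' < s + 1 / 2) (b c' : R)
    (b_gt : Num.max (1 / 2) ((s' - s) / 2 + 1 / 2) < b)
    (c'_lt : c' < Num.min (3 / 4 - (s' - s) / 2) (3 / 4)) :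
  exists C : R, 0 < C /\
    forall u1 u2 : nat -> R * R -> R[i],
      X_space s b u1 -> X_space s b u2 ->
      Y_space nu s' (c' - 1) (completion_dx_mul_conj u1 u2) /\
      (completion_norm (Y_norm nu s' (c' - 1)) (completion_dx_mul_conj u1 u2)
       <= C%:E * completion_norm (X_norm s b) u1
              * completion_norm (X_norm s b) u2)%E.
Proof.
move: b_gt c'_lt; rewrite gt_max lt_min => /andP[b1 b2] /andP[c1 c2].
(* With a = 1 - c', [a0] comes from c' < 3/4, [e1] restates [s'_le], and [e2] and [e3] are the
   non-strict forms of the bounds on c' and b that involve s' - s. *)
have a0 : 0 <= 1 - c' by lra.
have e1 : 2 * s' + 1 <= 4 * s by lra.
have e2 : 1 + 2 * (s' - s) <= 4 * (1 - c') by lra.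
have e3 : 2 + 2 * (s' - s) <= 4 * b by lra.
have [C C0 hC] := Y_norm_dx_mul_conj_le nu_neq1 s_ge0 a0 b1 e1 e2 e3.
rewrite opprB in hC.
exists C; split=> // u1 u2; exact: completion_dx_mul_conj_bound.
Qed.
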